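(* Let $n\ge 2$, $1/2<s<1$, and let $\mu$ be a compactly supported finite signed Radon measure on $\mathbb R^n$. With the standard normalization of $(-\Delta)^s$, define $$u(x)=\int_{\mathbb R^n}\Phi_{n,s}(x-y)\,d\mu(y),\qquad \Phi_{n,s}(z)=\kappa_{n,s}|z|^{2s-n}.$$ Then $u\in L^1_{\rm loc}(\mathbb R^n)$ and $(-\Delta)^su=\mu$ in $\mathcal D'(\mathbb R^n)$. Each of the following estimates holds at every point $x$ where its right-hand side is finite: $$|u(x)|\le C\,\mathbf I_{2s}^{|\mu|}(x),\qquad |\nabla u(x)|\le C\,\mathbf I_{2s-1}^{|\mu|}(x).$$ The gradient in the second estimate is defined by the absolutely convergent differentiated potential. Both orders are sharp in the local scaling sense, as shown by taking $\mu=\delta_0$.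
   Context: $(-\Delta)^s$ is normalized to have Fourier symbol $|\xi|^{2s}$, and $$\kappa_{n,s}=\frac{\Gamma\left(\frac{n-2s}{2}\right)}{2^{2s}\pi^{n/2}\Gamma(s)}.$$ $C$ denotes a positive constant. For $0<\beta<n$, the untruncated Riesz potential of the total variation measure $|\mu|$ is $$\mathbf I_\beta^{|\mu|}(x)=\int_0^\infty\frac{|\mu|(B_\rho(x))}{\rho^{n-\beta}}\frac{d\rho}{\rho}$$ whenever this integral is finite. The differentiated potential is $\int_{\mathbb R^n}\nabla\Phi_{n,s}(x-y)\,d\mu(y)$. $(-\Delta)^su=\mu$ in $\mathcal D'(\mathbb R^n)$ means $\int_{\mathbb R^n}u\,(-\Delta)^s\varphi\,dx=\int_{\mathbb R^n}\varphi\,d\mu$ for every $\varphi\in C_c^\infty(\mathbb R^n)$. $\delta_0$ is the Dirac mass at the origin. *)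

(* Defs.v *)
From HB Require Import structures.
From mathcomp Require Import all_boot all_order all_algebra.
From mathcomp Require Import all_classical all_reals all_analysis.
From mathcomp Require Import measurable_realfun.

Set Implicit Arguments.
Unset Strict Implicit.
Unset Printing Implicit Defensive.

Import Order.TTheory GRing.Theory Num.Theory.
Import numFieldNormedType.Exports.

Local Open Scope classical_set_scope.
Local Open Scope ring_scope.

(* R^n is 'rV[R]_n with its Borel sigma-algebra. *)
HB.instance Definition _ (R : realType) (n : nat) :=
  Measurable.copy 'rV[R]_n (g_sigma_algebraType (@open 'rV[R]_n)).

Lemma open_measurable_rV (R : realType) n (U : set 'rV[R]_n) :
  open U -> measurable U.
Proof. exact: sub_sigma_algebra. Qed.

Lemma measurable_coord (R : realType) n (i : 'I_n) :
  measurable_fun [set: 'rV[R]_n] (fun v => v ord0 i).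
Proof.
apply: (measurability _ (RGenOpens.measurableE R)).
move=> _ [_ [a [b ->]] <-]; rewrite setTI; apply: open_measurable_rV.
apply: open_comp; last exact: interval_open.
by move=> x _; exact: coord_continuous.
Qed.

Lemma measurable_fun_rV d (T : measurableType d) (R : realType) n
    (f : T -> 'rV[R]_n) :
  (forall i, measurable_fun [set: T] (fun t => f t ord0 i)) ->
  measurable_fun [set: T] f.
Proof.
move=> mf; apply: (@measurability _ _ _ _ _ _ (@open 'rV[R]_n)) => //.
move=> _ [U oU <-]; rewrite setTI.
pose D := [set p : 'rV[rat]_n * nat |
  ball (map_mx (@ratr R) p.1) p.2.+1%:R^-1 `<=` U].
have -> : U = \bigcup_(p in D) ball (map_mx (@ratr R) p.1) p.2.+1%:R^-1.
  apply/seteqP; split=> [x Ux|x [p Dp]]; last exact: Dp.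
  have /nbhs_ballP[e /= e0 xeU] : nbhs x U by exact: open_nbhs_nbhs.
  have [k ke] : exists k, k.+1%:R^-1 < e / 2.
    have /= [k _ /(_ k (leqnn _))] :=
      near_infty_natSinv_lt (PosNum (divr_gt0 e0 (ltr0n R 2))).
    by exists k.
  have ex i : exists q : rat, `|ratr q - x ord0 i| < k.+1%:R^-1.
    have [] : exists q, ratr q \in `]x ord0 i - k.+1%:R^-1, x ord0 i[.
      by apply: rat_in_itvoo; rewrite gtrBl.
    move=> q; rewrite in_itv /= => /andP[q1 q2]; exists q.
    by rewrite distrC gtr0_norm ?subr_gt0// ltrBlDr -ltrBlDl.
  have [q Hq] := choice ex.
  have xq : ball (map_mx (@ratr R) (\row_i q i)) k.+1%:R^-1 x.
    by split=> [//|i j]; rewrite !mxE (ord1 i); exact: Hq.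
  exists (\row_i q i, k) => // y yq; apply: xeU.
  rewrite (splitr e); apply: (@ball_triangle _ _ (map_mx (@ratr R) (\row_i q i))).
    by apply: ball_sym; apply: le_ball xq; exact: ltW.
  by apply: le_ball yq; exact: ltW.
rewrite preimage_bigcup bigcup_mkcond; apply: countable_bigcupT_measurable.
  exact: countableP.
move=> p; case: ifPn => // _.
rewrite [X in measurable X](_ : _ = \bigcap_(i in [set: 'I_n])
  ((fun t => f t ord0 i) @^-1` ball (ratr (p.1 ord0 i) : R) p.2.+1%:R^-1)).
  apply: fin_bigcap_measurable => // i _; rewrite -[X in measurable X]setTI.
  by apply: mf => //; apply: open_measurable; exact: ball_open.
apply/seteqP; split=> [t [_ bt] i _|t bt] /=.
  by have := bt ord0 i; rewrite mxE.
by split=> // i j; rewrite mxE (ord1 i); exact: bt.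
Qed.

Section lebesgue_rV.
Context (R : realType).

Definition cons_rV n (p : measurableTypeR R * 'rV[R]_n) : 'rV[R]_n.+1 :=
  row_mx (p.1 : R)%:M p.2.

Lemma measurable_cons_rV n : measurable_fun setT (@cons_rV n).
Proof.
apply: measurable_fun_rV => i.
case: (split_ordP (i : 'I_(1 + n))) => j ->.
  rewrite [X in measurable_fun _ X](_ : _ = fst)//.
  by apply/funext => t; rewrite [LHS](@row_mxEl _ 1 1 n) (ord1 j)
    mxE eqxx mulr1n.
rewrite [X in measurable_fun _ X](_ : _ = (fun v : 'rV[R]_n => v ord0 j) \o snd).
  by apply: measurableT_comp => //; exact: measurable_coord.
by apply/funext => t; rewrite [LHS](@row_mxEr _ 1 1 n).
Qed.

(* Lebesgue measure on R^(n+1) is the image of the product of the Lebesgue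
   measures on R and R^n under (t, v) |-> (t, v_1, ..., v_n). *)
Definition cons_measure n (m : {measure set 'rV[R]_n -> \bar R}) :
    set 'rV[R]_n.+1 -> \bar R :=
  pushforward (@lebesgue_measure R \x^ m)%E (@cons_rV n).

Section cons_measure_instance.
Context n (m : {measure set 'rV[R]_n -> \bar R}).

Let push : {measure set 'rV[R]_n.+1 -> \bar R} :=
  measure_function_pushforward__canonical__measure_function_Measure
    (@lebesgue_measure R \x^ m)%E (@measurable_cons_rV n).

HB.instance Definition _ := isMeasure.Build _ _ _ (cons_measure m)
  (measure0 push) (measure_ge0 push) (@measure_semi_sigma_additive _ _ _ push).

End cons_measure_instance.

Fixpoint lebesgue_rV n : {measure set 'rV[R]_n -> \bar R} :=
  match n with
  | 0%N => dirac (0 : 'rV[R]_0)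
  | n'.+1 => cons_measure (lebesgue_rV n')
  end.

End lebesgue_rV.

Section signed_measures.
Context d (T : measurableType d) (R : realType).
Implicit Types (mu : {charge set T -> \bar R}) (f : T -> R).

Lemma hahn_sets_ex mu :
  exists PN : set T * set T, hahn_decomposition mu PN.1 PN.2.
Proof. by have [P [N PN]] := Hahn_decomposition mu; exists (P, N). Qed.

(* The Hahn sets are chosen; mu^+, mu^- and |mu| do not depend on the choice
   (Hahn_decomposition_uniq). *)
Definition hahnP mu := projT2 (cid (hahn_sets_ex mu)).

Definition charge_tv mu : {measure set T -> \bar R} :=
  charge_variation (hahnP mu).

Definition charge_integrable mu f :=
  (charge_tv mu).-integrable [set: T] (EFin \o f).

Definition charge_integral mu f : R :=
  \int[jordan_pos (hahnP mu)]_y f y - \int[jordan_neg (hahnP mu)]_y f y.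

End signed_measures.

Section euclidean.
Context (R : realType) (n : nat).
Implicit Types (x y : 'rV[R]_n) (nu : {measure set 'rV[R]_n -> \bar R}).

(* The library's norm on 'rV[R]_n is the sup norm. *)
Definition dotp x y : R := \sum_i x ord0 i * y ord0 i.
Definition enorm x : R := Num.sqrt (dotp x x).
Definition eball x (r : R) : set 'rV[R]_n := [set y | enorm (y - x) < r].

Definition msupport nu : set 'rV[R]_n :=
  [set x | forall U, open U -> U x -> (0 < nu U)%E].

Definition locally_integrable_rV (f : 'rV[R]_n -> R) :=
  measurable_fun [set: 'rV[R]_n] f /\
  forall K, compact K -> (\int[lebesgue_rV R n]_(x in K) `|f x|%:E < +oo)%E.

Definition partial (i : 'I_n) (f : 'rV[R]_n -> R) : 'rV[R]_n -> R :=
  'D_(delta_mx ord0 i) (f : 'rV[R]_n -> R^o).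

Definition gradient (f : 'rV[R]_n -> R) x : 'rV[R]_n :=
  \row_i partial i f x.

Fixpoint Ck (k : nat) (f : 'rV[R]_n -> R) : Prop :=
  continuous f /\
  if k is k'.+1 then
    forall i, (forall x, derivable (f : 'rV[R]_n -> R^o) x (delta_mx ord0 i)) /\
              Ck k' (partial i f)
  else True.

Definition test_function (phi : 'rV[R]_n -> R) :=
  (forall k, Ck k phi) /\ compact (closure [set x | phi x != 0]).

End euclidean.

Section fractional_laplacian.
Context (R : realType) (n : nat) (s : R).
Implicit Types (x y z xi : 'rV[R]_n) (mu : {charge set 'rV[R]_n -> \bar R}).

(* Real and imaginary parts of the Fourier transform
   \int phi(y) exp(- i y.xi) dy of a real-valued phi. *)
Definition fourier_re (phi : 'rV[R]_n -> R) xi : R :=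
  \int[lebesgue_rV R n]_y (phi y * cos (dotp y xi)).
Definition fourier_im (phi : 'rV[R]_n -> R) xi : R :=
  - \int[lebesgue_rV R n]_y (phi y * sin (dotp y xi)).

(* (2 pi)^-n \int |xi|^(2s) phi^(xi) exp(i x.xi) dxi; only the real part of the
   integrand is kept, as its imaginary part is odd in xi. *)
Definition frac_laplacian (phi : 'rV[R]_n -> R) x : R :=
  (2 * pi) ^- n * \int[lebesgue_rV R n]_xi (enorm xi `^ (2 * s) *
    (cos (dotp x xi) * fourier_re phi xi - sin (dotp x xi) * fourier_im phi xi)).

Definition Gamma (a : R) : R :=
  \int[@lebesgue_measure R]_(t in `]0, +oo[) (t `^ (a - 1) * expR (- t)).

Definition kappa : R :=
  Gamma ((n%:R - 2 * s) / 2) / (2 `^ (2 * s) * pi `^ (n%:R / 2) * Gamma s).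

(* At the singular point z = 0 the totalized powR gives Phi the value 0. *)
Definition Phi z : R := kappa * enorm z `^ (2 * s - n%:R).

Definition potential mu x : R := charge_integral mu (fun y => Phi (x - y)).

Definition grad_potential mu x : 'rV[R]_n :=
  \row_i charge_integral mu (fun y => gradient Phi (x - y) ord0 i).

(* I_beta^{|mu|}, with value +oo where the integral diverges. *)
Definition riesz_potential (beta : R) mu x : \bar R :=
  (\int[@lebesgue_measure R]_(rho in `]0%R, +oo[)
     (charge_tv mu (eball x rho) *
      ((rho `^ (n%:R - beta))^-1 * rho^-1)%:E))%E.

(* (-Delta)^s u = mu in D'(R^n). *)
Definition frac_laplace_eq (u : 'rV[R]_n -> R) mu :=
  forall phi, test_function phi ->
    (lebesgue_rV R n).-integrable [set: 'rV[R]_n]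
      (fun x => (u x * frac_laplacian phi x)%:E) /\
    \int[lebesgue_rV R n]_x (u x * frac_laplacian phi x) =
      charge_integral mu phi.

Definition delta0 : {charge set 'rV[R]_n -> \bar R} :=
  charge_of_finite_measure (dirac (0 : 'rV[R]_n)).

End fractional_laplacian.

(* Main.v *)
(* Everything is reduced to the heat kernel h_t(z) = (4 pi t)^(-n/2) exp (- |z|^2 / 4t):
   Gamma(s) Phi = \int_0^oo t^(s-1) h_t dt, while the multiplier |xi|^(2s) is a multiple
   of \int_0^oo t^(-s-1) (1 - exp (- t |xi|^2)) dt. The second formula shows that
   g = (- Delta)^s phi is bounded and integrable for a test function phi; the first one,
   the Fourier transform of Gaussians and Fourier inversion give Phi * g = phi. As
   Phi * |g| is bounded, Fubini's theorem for Lebesgue measure and the positive and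
   negative parts of mu yields (- Delta)^s u = mu; the same bound with the indicator
   function of a box in place of g gives local integrability. By Tonelli's theorem
   I_beta^{|mu|}(x) = \int |x - y|^(beta - n) / (n - beta) d|mu|(y), so that the pointwise
   estimates are comparisons of kernels, and for mu = delta_0 they are equalities up to
   constants. Integrals over t in (0, oo) are written over the line with t = exp tau. *)

(* The Fourier integral of Phi does not converge absolutely, so the multipliers |xi|^(-2s) and
   |xi|^(2s) cannot be cancelled by one application of Fubini. At a fixed time t the heat kernel is
   integrable and its transform is a Gaussian, so the exchange in (x, xi) is absolute there. It
   stands between an exchange in (x, t), which opens Phi, and one in (xi, t), which performs the
   t-integral of the multiplier. The second obstacle is that g = (- Delta)^s phi has no compact
   support. Its boundedness rests on the decay of the transform of phi; its integrability does not
   follow from that. Off the support of phi the term phi x drops out of the heat formula, and the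
   heat mass at distance at least 1 is at most min (1, K t), which is integrable against t^(-s-1) dt
   because 0 < s < 1. Finally Phi is integrable on the unit box and bounded off it. Since g is both
   bounded and integrable, Phi convolved with |g| is bounded uniformly in the centre, which is
   exactly what integration against a finite measure requires. *)
Require Import Defs.
From HB Require Import structures.
From mathcomp Require Import all_boot all_order all_algebra.
From mathcomp Require Import all_classical all_reals all_analysis.
From mathcomp Require Import measurable_realfun.
From mathcomp Require Import ring lra.

Set Implicit Arguments.
Unset Strict Implicit.
Unset Printing Implicit Defensive.

Import Order.TTheory GRing.Theory Num.Theory.
Import numFieldNormedType.Exports.

Local Open Scope classical_set_scope.
Local Open Scope ring_scope.

(** * Lebesgue measure on R^n *)

Section lebesgue_rV_theory.
Context (R : realType).
Local Notation L := (@lebesgue_measure R).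

(* [lebesgue_rV] is a fixpoint; a constant head is needed to attach the
   sigma-finite structure to it. *)
Definition leb n : set 'rV[R]_n -> \bar R := lebesgue_rV R n.
Arguments leb : clear implicits.

HB.instance Definition _ n := Measure.copy (leb n) (lebesgue_rV R n).

(** Given by coordinates, so that its preimage under [cons_rV] is a product and inductions on the
    dimension apply. *)
Definition box n (r : R) : set 'rV[R]_n :=
  [set v | forall i, `|v ord0 i| <= r].

Lemma measurable_box n r : measurable (@box n r).
Proof.
rewrite /box [X in measurable X](_ : _ = \bigcap_(i in [set: 'I_n])
  ((fun v : 'rV[R]_n => v ord0 i) @^-1` `[- r, r])).
  apply: fin_bigcap_measurable => // i _; rewrite -[X in measurable X]setTI.
  by apply: measurable_coord.
by apply/seteqP; split=> v /= bv i; [move=> _|]; have := bv i;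
  rewrite /= in_itv/= -ler_norml// => /(_ I).
Qed.

Lemma cons_rV0 n (p : measurableTypeR R * 'rV[R]_n) :
  cons_rV p ord0 ord0 = p.1.
Proof.
have -> : ord0 = lshift n (ord0 : 'I_1) by apply/val_inj.
by rewrite [LHS](@row_mxEl _ 1 1 n) mxE eqxx mulr1n.
Qed.

Lemma cons_rVS n (p : measurableTypeR R * 'rV[R]_n) i :
  cons_rV p ord0 (lift ord0 i) = p.2 ord0 i.
Proof.
have -> : lift ord0 i = rshift 1 i by apply/val_inj; rewrite /= /bump leq0n.
by rewrite [LHS](@row_mxEr _ 1 1 n).
Qed.

Lemma leb0E : leb 0 = dirac (0 : 'rV[R]_0). Proof. by []. Qed.

Lemma lebSE n : leb n.+1 = pushforward (L \x^ leb n)%E (@cons_rV R n).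
Proof. by []. Qed.

Lemma leb_box_lty n r : (leb _ (@box n r) < +oo)%E.
Proof.
elim: n => [|n ih]; first by rewrite leb0E diracE ltry.
rewrite lebSE /pushforward.
have -> : @cons_rV R n @^-1` @box n.+1 r = `[- r, r]%classic `*` @box n r.
  apply/seteqP; split=> -[t v] /= bv.
    split=> /= [|i].
      by have := bv ord0; rewrite cons_rV0/= in_itv/= -ler_norml.
    by have := bv (lift ord0 i); rewrite cons_rVS.
  move=> i; case: (unliftP ord0 i) => [j|] ->; rewrite ?cons_rVS ?cons_rV0.
    exact: bv.2.
  by have := bv.1; rewrite /= in_itv/= -ler_norml.
rewrite product_measure2E//; last exact: measurable_box.
apply: lte_mul_pinfty => //.
by rewrite /= lebesgue_measure_itv/=; case: ifPn.
Qed.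

Lemma leb_sigma_finite n : sigma_finite [set: 'rV[R]_n] (leb n).
Proof.
exists (fun k => @box n k%:R); last first.
  by move=> k; split; [exact: measurable_box|exact: leb_box_lty].
apply/seteqP; split=> // v _.
(* A sum in place of a maximum: one term bounds the coordinate i and the others are nonnegative. *)
exists (\sum_i (Num.trunc `|v ord0 i|).+1)%N => // i.
rewrite (bigD1 i)//= natrD.
apply: ler_wpDr => //; apply/ltW/truncnS_gt.
Qed.

HB.instance Definition _ n := Measure_isSigmaFinite.Build _ _ _ (leb n)
  (@leb_sigma_finite n).

End lebesgue_rV_theory.
Arguments leb {R} n _.

(** Bridge between the measure of the definitions and the copy that carries the sigma-finite
    structure. *)
Lemma lebE (R : realType) n :
  (leb n : {measure set _ -> \bar R}) = lebesgue_rV R n.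
Proof. exact/eq_measure. Qed.

Section invariance.
Context (R : realType).
Local Notation L := (@lebesgue_measure R).

Lemma ge0_integral_leb_prod n (f : 'rV[R]_n.+1 -> \bar R) :
  measurable_fun setT f -> (forall x, 0 <= f x)%E ->
  (\int[leb n.+1]_x f x = \int[L \x leb n]_p f (cons_rV p))%E.
Proof.
move=> mf f0; rewrite lebSE ge0_integral_pushforward//=; last first.
  exact: measurable_cons_rV.
(* [lebesgue_rV] is built on the product [\x^], while the right-hand side uses [\x]. They agree on
   rectangles, hence everywhere. *)
rewrite preimage_setT; apply: eq_measure_integral => A mA _; apply/esym.
by apply: product_measure_unique => // B C mB mC; exact: product_measure2E.
Qed.

Lemma ge0_integral_lebS n (f : 'rV[R]_n.+1 -> \bar R) :
  measurable_fun setT f -> (forall x, 0 <= f x)%E ->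
  (\int[leb n.+1]_x f x = \int[leb n]_v \int[L]_t f (cons_rV (t, v)))%E.
Proof.
move=> mf f0; rewrite ge0_integral_leb_prod// fubini_tonelli2//.
by apply: measurableT_comp => //; exact: measurable_cons_rV.
Qed.

Lemma integral_leb_prod n (f : 'rV[R]_n.+1 -> \bar R) :
  measurable_fun setT f ->
  (\int[leb n.+1]_x f x = \int[L \x leb n]_p f (cons_rV p))%E.
Proof.
move=> mf; rewrite integralE [RHS]integralE; congr (_ - _)%E.
  rewrite ge0_integral_leb_prod//; last exact: measurable_funepos.
  by apply: eq_integral => x _; rewrite !funeposE.
rewrite ge0_integral_leb_prod//; last exact: measurable_funeneg.
by apply: eq_integral => x _; rewrite !funenegE.
Qed.

Lemma lebesgue_measureD (a : R) (A : set (measurableTypeR R)) : measurable A ->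
  pushforward L (+%R^~ a : _ -> measurableTypeR R) A = L A.
Proof.
move=> mA; apply/esym/lebesgue_measure_unique => //=.
  by apply: measurable_funD => //; exact: measurable_cst.
move=> _ _ [[c d]] _ <-.
rewrite /pushforward.
have -> : (+%R^~ a) @^-1` [set` `]c, d]] = [set` `]c - a, d - a]].
  by apply/seteqP; split=> x /=; rewrite !in_itv/= ltrBlDr lerBrDr.
rewrite /= !lebesgue_measure_itv/= !lte_fin ltrD2r; case: ifPn => // _.
by rewrite -!EFinB; congr (_%:E); ring.
Qed.

Lemma ge0_integralD1 (a : R) (f : R -> \bar R) : measurable_fun setT f ->
  (forall x, 0 <= f x)%E -> (\int[L]_t f (t + a)%R = \int[L]_t f t)%E.
Proof.
move=> mf f0.
have ma : measurable_fun setT (+%R^~ a : measurableTypeR R -> measurableTypeR R).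
  by apply: measurable_funD => //; exact: measurable_cst.
pose P : {measure set (measurableTypeR R) -> \bar R} :=
  measure_function_pushforward__canonical__measure_function_Measure L ma.
transitivity (\int[P]_t f t)%E; last first.
  by apply: eq_measure_integral => A mA _; apply: (lebesgue_measureD a mA).
by rewrite (ge0_integral_pushforward ma).
Qed.

Lemma ge0_integralN1 (f : R -> \bar R) : measurable_fun setT f ->
  (forall x, 0 <= f x)%E -> (\int[L]_t f (- t)%R = \int[L]_t f t)%E.
Proof.
move=> mf f0.
have mN : measurable_fun setT (-%R : measurableTypeR R -> measurableTypeR R).
  by apply: measurable_funN; exact: measurable_id.
pose P : {measure set (measurableTypeR R) -> \bar R} :=
  measure_function_pushforward__canonical__measure_function_Measure L mN.
transitivity (\int[P]_t f t)%E; last first.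
  by apply: eq_measure_integral => A mA _; apply: (lebesgue_measureN mA).
by rewrite (ge0_integral_pushforward mN).
Qed.

Lemma measurable_fun_rVD n (a : 'rV[R]_n) : measurable_fun setT (fun x : 'rV[R]_n => x + a).
Proof.
apply: measurable_fun_rV => i.
under eq_fun do rewrite mxE.
by apply: measurable_funD => //; exact: measurable_coord.
Qed.

(** By induction on n: a translation moves the first coordinate and the tail separately, so
    one-dimensional invariance handles the inner integral and the induction hypothesis the outer
    one. *)
Lemma ge0_integral_lebD n (a : 'rV[R]_n) (f : 'rV[R]_n -> \bar R) :
  measurable_fun setT f -> (forall x, 0 <= f x)%E ->
  (\int[leb n]_x f (x + a)%R = \int[leb n]_x f x)%E.
Proof.
elim: n a f => [|n ih] a f mf f0.
  by apply: eq_integral => x _; congr f; apply/rowP => -[].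
rewrite ge0_integral_lebS//; last first.
  by apply: measurableT_comp => //; exact: measurable_fun_rVD.
pose a' : 'rV[R]_n := \row_i a ord0 (lift ord0 i).
rewrite [RHS](ge0_integral_lebS mf f0).
have consD t v : cons_rV (t, v) + a = cons_rV (t + a ord0 ord0, v + a').
  apply/rowP => i; rewrite mxE; case: (unliftP ord0 i) => [j|] ->.
    by rewrite !cons_rVS/= !mxE.
  by rewrite !cons_rV0.
under eq_integral => v _.
  under eq_integral => t _ do rewrite consD.
  rewrite (ge0_integralD1 _ (f := fun t => f (cons_rV (t, v + a'))))//.
    over.
  apply: (measurableT_comp mf).
  by apply: (measurableT_comp (@measurable_cons_rV _ _)).
rewrite (ih a' (fun v => \int[L]_t f (cons_rV (t, v)))%E)//.
  apply: (measurable_fun_fubini_tonelli_G (m1 := L) (f \o @cons_rV R n)) => //=.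
  by apply: measurableT_comp => //; exact: measurable_cons_rV.
by move=> v; exact: integral_ge0.
Qed.

Lemma integral_lebD n (a : 'rV[R]_n) (f : 'rV[R]_n -> \bar R) :
  measurable_fun setT f ->
  (\int[leb n]_x f (x + a)%R = \int[leb n]_x f x)%E.
Proof.
move=> mf; rewrite integralE [RHS]integralE.
congr (_ - _)%E.
  rewrite -[RHS](ge0_integral_lebD a (f := f^\+%E))//; last exact: measurable_funepos.
  by apply: eq_integral => x _; rewrite !funeposE.
rewrite -[RHS](ge0_integral_lebD a (f := f^\-%E))//; last exact: measurable_funeneg.
by apply: eq_integral => x _; rewrite !funenegE.
Qed.

Lemma measurable_set1_rV n (a : 'rV[R]_n) : measurable [set a].
Proof.
rewrite [X in measurable X](_ : _ = \bigcap_(i in [set: 'I_n])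
  ((fun v : 'rV[R]_n => v ord0 i) @^-1` [set a ord0 i])).
  apply: fin_bigcap_measurable => // i _; rewrite -[X in measurable X]setTI.
  by apply: measurable_coord.
apply/seteqP; split=> v /=; first by move=> ->.
by move=> va; apply/rowP => i; exact: va.
Qed.

(** Every section of a point along the first coordinate contains at most one real. In dimension 0
    the measure is a Dirac mass, hence the hypothesis on n. *)
Lemma leb_set1 n (a : 'rV[R]_n) : (0 < n)%N -> leb n [set a] = 0%E.
Proof.
case: n a => // n a _.
have ma : measurable ((@cons_rV R n) @^-1` [set a]).
  rewrite -[X in measurable X]setTI.
  by apply: measurable_cons_rV => //; exact: measurable_set1_rV.
rewrite lebSE /pushforward /product_measure2 integral0_eq// => v _ /=.
apply: subset_measure0 (lebesgue_measure_set1 (a ord0 ord0)) => //.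
  exact: measurable_ysection.
move=> t; rewrite /ysection/= inE/= => <-.
by rewrite cons_rV0.
Qed.

End invariance.

(** * Measurability and Fubini for real-valued functions *)

Section measurable_rV.
Context d (T : measurableType d) (R : realType) (n : nat).
Implicit Types f g : T -> 'rV[R]_n.

Lemma measurable_rVcoord f i : measurable_fun setT f ->
  measurable_fun setT (fun t => f t ord0 i).
Proof. by move=> mf; exact: (measurableT_comp (measurable_coord i) mf). Qed.

Lemma measurable_rVD f g : measurable_fun setT f -> measurable_fun setT g ->
  measurable_fun setT (fun t => f t + g t).
Proof.
move=> mf mg; apply: measurable_fun_rV => i; under eq_fun do rewrite mxE.
by apply: measurable_funD; exact: measurable_rVcoord.
Qed.

Lemma measurable_rVN f : measurable_fun setT f ->
  measurable_fun setT (fun t => - f t).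
Proof.
move=> mf; apply: measurable_fun_rV => i; under eq_fun do rewrite mxE.
by apply: measurable_funN; exact: measurable_rVcoord.
Qed.

Lemma measurable_dotp f g : measurable_fun setT f -> measurable_fun setT g ->
  measurable_fun setT (fun t => dotp (f t) (g t)).
Proof.
move=> mf mg; apply: measurable_sum => i.
by apply: measurable_funM; exact: measurable_rVcoord.
Qed.

Lemma measurable_enorm f : measurable_fun setT f ->
  measurable_fun setT (fun t => enorm (f t)).
Proof.
move=> mf; apply: (measurableT_comp (continuous_measurable_fun
  (@sqrt_continuous R)) (g := fun t => dotp (f t) (f t))).
exact: measurable_dotp.
Qed.

End measurable_rV.

(** Measurability by recursion on the shape of the function. Sums, differences and opposites are
    tried first as real-valued and then as vector-valued. *)
Ltac mfun1 :=
  match goal with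
  | |- measurable_fun _ (fun=> _) => exact: measurable_cst
  | |- measurable_fun _ (fun x => x) => exact: measurable_id
  | |- measurable_fun _ fst => exact: measurable_fst
  | |- measurable_fun _ snd => exact: measurable_snd
  | |- measurable_fun _ (fun x => fst x) => exact: measurable_fst
  | |- measurable_fun _ (fun x => snd x) => exact: measurable_snd
  | |- measurable_fun _ (fun x => fst (@?f x)) =>
      apply: (measurableT_comp measurable_fst (g := f))
  | |- measurable_fun _ (fun x => snd (@?f x)) =>
      apply: (measurableT_comp measurable_snd (g := f))
  | |- measurable_fun _ (fun x => (@?f x)%:E) =>
      apply/measurable_EFinP; change (measurable_fun [set: _] f)
  | |- measurable_fun _ (EFin \o ?f) =>
      apply/measurable_EFinP; change (measurable_fun [set: _] f)
  | |- measurable_fun _ (fun x => dotp (@?f x) (@?g x)) =>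
      apply: (measurable_dotp (f := f) (g := g))
  | |- measurable_fun _ (fun x => enorm (@?f x)) =>
      apply: (measurable_enorm (f := f))
  | |- measurable_fun _ (fun x => (@?f x * @?g x)%R) =>
      apply: (measurable_funM (f := f) (g := g))
  | |- measurable_fun _ (fun x => (@?f x - @?g x)%R) =>
      first [apply: (measurable_funB (f := f) (g := g))
        |apply: (measurable_rVD (f := f) (g := fun x => - g x))]
  | |- measurable_fun _ (fun x => (@?f x + @?g x)%R) =>
      first [apply: (measurable_funD (f := f) (g := g))
        |apply: (measurable_rVD (f := f) (g := g))]
  | |- measurable_fun _ (fun x => (- @?f x)%R) =>
      first [apply: (measurable_funN (f := f))
        |apply: (measurable_rVN (f := f))]
  | |- measurable_fun _ (fun x => ((@?f x) ^+ ?n)%R) =>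
      apply: (measurable_funX (f := f) n)
  | |- measurable_fun _ (fun x => `|@?f x|%R) =>
      apply: (measurableT_comp (@normr_measurable _ setT) (g := f))
  | |- measurable_fun _ (fun x => expR (@?f x)) =>
      apply: (measurableT_comp (@measurable_expR _) (g := f))
  | |- measurable_fun _ (fun x => cos (@?f x)) =>
      apply: (measurableT_comp (continuous_measurable_fun
        (@continuous_cos _)) (g := f))
  | |- measurable_fun _ (fun x => sin (@?f x)) =>
      apply: (measurableT_comp (continuous_measurable_fun
        (@continuous_sin _)) (g := f))
  | |- measurable_fun _ (fun x => powR (@?f x) ?p) =>
      apply: (measurableT_comp (measurable_powR p) (g := f))
  | H : measurable_fun _ ?F |- measurable_fun _ ?F => exact: H
  | H : measurable_fun _ ?F |- measurable_fun _ (fun x => ?F x) => exact: H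
  | H : measurable_fun _ ?F |- measurable_fun _ (fun x => ?F (@?g x)) =>
      apply: (measurableT_comp H (g := g))
  end.
Ltac mfun := repeat mfun1.

Section integral_tools.
Context d (T : measurableType d) (R : realType).
Variable m : {measure set T -> \bar R}.

Lemma ge0_le_integralT (f g : T -> R) :
  measurable_fun setT f -> measurable_fun setT g ->
  (forall x, 0 <= f x) -> (forall x, f x <= g x) ->
  (\int[m]_x (f x)%:E <= \int[m]_x (g x)%:E)%E.
Proof.
move=> mf mg f0 fg; apply: ge0_le_integral => //.
- by move=> x _; rewrite lee_fin.
- exact/measurable_EFinP.
- exact/measurable_EFinP.
- by move=> x _; rewrite lee_fin.
Qed.

Lemma integrable_normP (f : T -> R) : measurable_fun setT f ->
  (\int[m]_x `|f x|%:E < +oo)%E -> m.-integrable setT (EFin \o f).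
Proof. by move=> mf fy; apply/integrableP; split; first exact/measurable_EFinP. Qed.

Lemma integrable_norm_lty (f : T -> R) : m.-integrable setT (EFin \o f) ->
  (\int[m]_x `|f x|%:E < +oo)%E.
Proof. by move=> /integrableP[]. Qed.

Lemma integrable_meas (f : T -> R) : m.-integrable setT (EFin \o f) ->
  measurable_fun setT f.
Proof. by move=> /integrableP[/measurable_EFinP]. Qed.

Lemma integrable_le (f g : T -> R) : measurable_fun setT f ->
  m.-integrable setT (EFin \o g) -> (forall x, `|f x| <= g x) ->
  m.-integrable setT (EFin \o f).
Proof.
move=> mf ig fg; apply: le_integrable ig => //; first exact/measurable_EFinP.
by move=> x _ /=; rewrite lee_fin (le_trans (fg x))// ler_norm.
Qed.

Lemma integrable_mulrl (k : R) (f : T -> R) :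
  m.-integrable setT (EFin \o f) ->
  m.-integrable setT (EFin \o (fun x => k * f x)).
Proof.
move=> fi; have := integrableZl measurableT k fi.
by apply: eq_integrable => // x _; rewrite /= EFinM.
Qed.

Lemma integrable_addr (f g : T -> R) :
  m.-integrable setT (EFin \o f) -> m.-integrable setT (EFin \o g) ->
  m.-integrable setT (EFin \o (fun x => f x + g x)).
Proof.
move=> fi gi; have := integrableD measurableT fi gi.
by apply: eq_integrable.
Qed.

Lemma EFin_Rintegral (f : T -> R) : m.-integrable setT (EFin \o f) ->
  (\int[m]_x f x)%:E = (\int[m]_x (f x)%:E)%E.
Proof. by move=> fi; rewrite /Rintegral fineK//; exact: integrable_fin_num. Qed.

Lemma Rintegral_dominated_cvg (f_ : nat -> T -> R) (f g : T -> R) :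
  (forall k, measurable_fun setT (f_ k)) ->
  (forall x, f_ k x @[k --> \oo] --> f x) ->
  m.-integrable setT (EFin \o g) ->
  (forall k x, `|f_ k x| <= g x) ->
  \int[m]_x f_ k x @[k --> \oo] --> \int[m]_x f x.
Proof.
move=> mf cf ig fg.
have mlim : measurable_fun setT f.
  by apply: (measurable_fun_cvg (h := f_)) => //.
have fi : m.-integrable setT (EFin \o f).
  apply: (integrable_le mlim ig) => x.
  have cn : `|f_ k x| @[k --> \oo] --> `|f x| by apply: cvg_norm; exact: cf.
  rewrite -(cvg_lim _ cn)//; apply: limr_le; first by apply/cvg_ex; eexists; exact: cn.
  by apply: nearW => k; exact: fg.
apply: fine_cvg; rewrite EFin_Rintegral//.
apply: (@dominated_cvg _ _ _ m setT measurableT (fun k x => (f_ k x)%:E) (EFin \o f) (EFin \o g)) => //.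
- by move=> k; exact/measurable_EFinP.
- by move=> x _; apply: cvg_EFin; [exact: nearW|exact: cf].
- by move=> k x _; rewrite lee_fin.
Qed.

End integral_tools.

Section fubini_tools.
Context d1 d2 (T1 : measurableType d1) (T2 : measurableType d2) (R : realType).
Variable m1 : {sigma_finite_measure set T1 -> \bar R}.
Variable m2 : {sigma_finite_measure set T2 -> \bar R}.
Variable f : T1 -> T2 -> R.
Hypothesis mf : measurable_fun setT (fun p : T1 * T2 => f p.1 p.2).

Lemma measurable_param_l x : measurable_fun setT (f x).
Proof. exact: (measurable_fun_pair2 x mf). Qed.

Lemma measurable_param_r y : measurable_fun setT (f ^~ y).
Proof. exact: (measurable_fun_pair1 y mf). Qed.

Let mF (g : T1 * T2 -> \bar R) : measurable_fun setT g ->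
  measurable_fun setT (fun x => \int[m2]_y g (x, y))%E.
Proof.
move=> mg.
have -> : (fun x => \int[m2]_y g (x, y))%E =
    ((fun x => \int[m2]_y g^\+ (x, y)) \- (fun x => \int[m2]_y g^\- (x, y)))%E.
  apply/funext => x; rewrite integralE/=; congr (_ - _)%E.
    by apply: eq_integral => y _; rewrite !funeposE.
  by apply: eq_integral => y _; rewrite !funenegE.
apply: emeasurable_funB.
  by apply: measurable_fun_fubini_tonelli_F => //; exact: measurable_funepos.
by apply: measurable_fun_fubini_tonelli_F => //; exact: measurable_funeneg.
Qed.

Lemma measurable_Rintegral_param :
  measurable_fun setT (fun x => \int[m2]_y f x y).
Proof.
apply: (measurableT_comp (fine_measurable measurableT)).
by apply: (mF (g := fun p => (f p.1 p.2)%:E)); exact/measurable_EFinP.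
Qed.

Lemma tonelli : (forall x y, 0 <= f x y) ->
  (\int[m1]_x \int[m2]_y (f x y)%:E = \int[m2]_y \int[m1]_x (f x y)%:E)%E.
Proof.
move=> f0.
apply: (fubini_tonelli (fun p => (f p.1 p.2)%:E)).
  exact/measurable_EFinP.
by move=> p; rewrite lee_fin.
Qed.

Lemma tonelli_abs :
  (\int[m1]_x \int[m2]_y `|f x y|%:E = \int[m2]_y \int[m1]_x `|f x y|%:E)%E.
Proof.
apply: (fubini_tonelli (fun p => `|f p.1 p.2|%:E)).
  by apply/measurable_EFinP; apply: (measurableT_comp (@normr_measurable _ setT)).
by move=> p; rewrite lee_fin.
Qed.

Hypothesis fy : (\int[m1]_x \int[m2]_y `|f x y|%:E < +oo)%E.

Let fi : (m1 \x m2)%E.-integrable setT (fun p => (f p.1 p.2)%:E).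
Proof. by apply/integrable12ltyP => //; exact/measurable_EFinP. Qed.

(** Only almost everywhere: where the inner integral is infinite, the real-valued integral has the
    default value 0. *)
Let eqF : ae_eq m1 setT (fun x => (\int[m2]_y f x y)%:E)
  (fun x => \int[m2]_y (f x y)%:E)%E.
Proof.
have := ae_integrable1 fi; apply: filterS => x /= xi _.
by rewrite EFin_Rintegral.
Qed.

Let eqG : ae_eq m2 setT (fun y => (\int[m1]_x f x y)%:E)
  (fun y => \int[m1]_x (f x y)%:E)%E.
Proof.
have := ae_integrable2 fi; apply: filterS => x /= xi _.
by rewrite EFin_Rintegral.
Qed.

Lemma integrable_Rintegral_param :
  m1.-integrable setT (fun x => (\int[m2]_y f x y)%:E).
Proof.
have : m1.-integrable setT (fun x => \int[m2]_y (f x y)%:E)%E.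
  exact: integrable_fubini_F fi.
move=> /integrableP[mF' Fy]; apply/integrableP; split.
  by apply/measurable_EFinP; exact: measurable_Rintegral_param.
rewrite (_ : (\int[m1]_x _ = \int[m1]_x `|\int[m2]_y (f x y)%:E|)%E)//.
apply: ae_eq_integral => //.
- apply: (measurableT_comp (@abse_measurable _ setT)).
  by apply/measurable_EFinP; exact: measurable_Rintegral_param.
- exact: (measurableT_comp (@abse_measurable _ setT)).
- by move: eqF; apply: filterS => x H Hx; congr abse; exact: H.
Qed.

Lemma Rintegral_prod :
  \int[(m1 \x m2)%E]_p f p.1 p.2 = \int[m1]_x \int[m2]_y f x y.
Proof.
rewrite /Rintegral; congr fine; rewrite -(integral12_prod_meas1 fi).
apply/esym/ae_eq_integral => //.
  by apply/measurable_EFinP; exact: measurable_Rintegral_param.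
exact: (mF (g := fun p => (f p.1 p.2)%:E) (measurable_int _ fi)).
Qed.

Lemma Rintegral_fubini :
  \int[m1]_x \int[m2]_y f x y = \int[m2]_y \int[m1]_x f x y.
Proof.
rewrite /Rintegral; congr fine.
transitivity (\int[m1]_x \int[m2]_y (f x y)%:E)%E.
  apply: ae_eq_integral => //.
    by apply/measurable_EFinP; exact: measurable_Rintegral_param.
  exact: (mF (g := fun p => (f p.1 p.2)%:E) (measurable_int _ fi)).
transitivity (\int[m2]_y \int[m1]_x (f x y)%:E)%E.
  exact: (Fubini fi).
apply/esym/ae_eq_integral => //.
  apply/measurable_EFinP; apply: (measurableT_comp (fine_measurable measurableT)).
  exact: measurable_fubini_G fi.
exact: measurable_fubini_G fi.
Qed.

End fubini_tools.

(** * Gamma integrals *)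

Section real_line.
Context (R : realType).
Local Notation L := (@lebesgue_measure R).
Implicit Types (a p r s x : R).

(** If the integral were 0, f would vanish almost everywhere, and the whole line would be a null
    set. *)
Lemma integral_gt0 (f : R -> R) : measurable_fun setT f ->
  (forall x, 0 < f x) -> (0 < \int[L]_x (f x)%:E)%E.
Proof.
move=> mf f0; rewrite lt0e; apply/andP; split; last first.
  by apply: integral_ge0 => x _; rewrite lee_fin ltW.
apply/eqP => f00.
have : ae_eq L setT (EFin \o f) (cst 0%E).
  apply/(ae_eq_integral_abs L measurableT); first exact/measurable_EFinP.
  by rewrite -[RHS]f00; apply: eq_integral => x _ /=; rewrite ger0_norm// ltW.
case=> N [mN N0 subN].
have : L setT = 0%E.
  apply: (subset_measure0 _ mN) N0 => //= x _; apply: subN => /= /(_ I) [] /eqP.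
  by rewrite gt_eqF.
have -> : [set: R] = [set` `]-oo, +oo[] by rewrite set_itvE.
by rewrite lebesgue_measure_itv.
Qed.

Lemma derive1_expR : (@expR R)^`()%classic = @expR R.
Proof. by apply/funext => x; rewrite derive1E; exact: (@derive_val _ _ _ _ _ _ _ (is_derive_expR x)). Qed.

(** Substitution t = exp x on the compact interval from exp (- k) to exp k, followed by monotone
    convergence in k on both sides. *)
Lemma ge0_integral_expR (G : R -> R) :
  (forall t, 0 < t -> {for t, continuous G}) -> (forall t, 0 < t -> 0 <= G t) ->
  (\int[L]_(t in `]0%R, +oo[) (G t)%:E = \int[L]_x (G (expR x) * expR x)%:E)%E.
Proof.
move=> cG G0.
pose A (k : nat) : set R := [set` `[expR (- k%:R), expR k%:R]].
pose B (k : nat) : set R := [set` `[- k%:R, k%:R]].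
have UA : \bigcup_k A k = [set` `]0, +oo[].
  apply/seteqP; split=> [t [k _]|t]; rewrite /A /= !in_itv/= ?andbT.
    by move=> /andP[h _]; rewrite (lt_le_trans _ h)// expR_gt0.
  move=> t0; exists (Num.trunc `|ln t|).+1 => //=; rewrite in_itv/=.
  rewrite -{2 3}(lnK t0) !ler_expR -ler_norml.
  exact/ltW/truncnS_gt.
have UB : \bigcup_k B k = [set: R].
  apply/seteqP; split=> // x _; exists (Num.trunc `|x|).+1 => //=.
  by rewrite /B /= in_itv/= -ler_norml; exact/ltW/truncnS_gt.
have cGA k : {in A k, forall t, {for t, continuous G}}.
  move=> t; rewrite inE /A /= in_itv/= => /andP[kt _].
  by apply: cG; rewrite (lt_le_trans _ kt)// expR_gt0.
have iAB k : (\int[L]_(t in A k) (G t)%:E =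
    \int[L]_(x in B k) (G (expR x) * expR x)%:E)%E.
  rewrite /A integration_by_substitution_increasing.
  - by apply: eq_integral => x _; rewrite /= derive1_expR.
  - by rewrite lerNl (le_trans _ (ler0n _ k))// oppr_le0.
  - by move=> x y _ _; rewrite ltr_expR.
  - by move=> x _; rewrite derive1_expR; exact: continuous_expR.
  - rewrite derive1_expR; apply/cvg_ex; exists (expR (- k%:R)).
    by apply: cvg_at_right_filter; exact: continuous_expR.
  - rewrite derive1_expR; apply/cvg_ex; exists (expR k%:R).
    by apply: cvg_at_left_filter; exact: continuous_expR.
  - split; first by move=> x _; exact: derivable_expR.
      by apply: cvg_at_right_filter; exact: continuous_expR.
    by apply: cvg_at_left_filter; exact: continuous_expR.
  - by apply: continuous_in_subspaceT => x xA; exact: (cGA k).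
have mGA k : measurable_fun (A k) (EFin \o G).
  apply/measurable_EFinP; apply: subspace_continuous_measurable_fun.
    exact: measurable_itv.
  by apply: continuous_in_subspaceT => x xA; exact: (cGA k).
have mGB k : measurable_fun (B k) (fun x => (G (expR x) * expR x)%:E).
  apply/measurable_EFinP.
  apply: measurable_funTS; apply: continuous_measurable_fun => x.
  apply: cvgM; last exact: continuous_expR.
  apply: (continuous_comp (f := expR) (g := G)); first exact: continuous_expR.
  by apply: cG; exact: expR_gt0.
have cA : (\int[L]_(t in A k) (G t)%:E)%E @[k --> \oo] -->
    (\int[L]_(t in `]0%R, +oo[) (G t)%:E)%E.
  rewrite -UA; apply: ge0_nondecreasing_set_cvg_integral => //.
  - move=> m n mn; rewrite subsetEset => t; rewrite /A /B /= !in_itv/= => /andP[h1 h2].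
    rewrite (le_trans _ h1) ?(le_trans h2)// ler_expR ?lerN2 ler_nat//.
  - by move=> k; exact: measurable_itv.
  move=> k t; rewrite /A/= in_itv/= => /andP[h _].
  by rewrite lee_fin G0// (lt_le_trans _ h)// expR_gt0.
have cB : (\int[L]_(x in B k) (G (expR x) * expR x)%:E)%E @[k --> \oo] -->
    (\int[L]_x (G (expR x) * expR x)%:E)%E.
  rewrite -[X in (_ --> \int[L]_(x in X) _)%E]UB.
  apply: ge0_nondecreasing_set_cvg_integral => //.
  - move=> m n mn; rewrite subsetEset => t; rewrite /A /B /= !in_itv/= => /andP[h1 h2].
    by rewrite (le_trans _ h1) ?(le_trans h2)// ?lerN2 ler_nat.
  - by move=> k; exact: measurable_itv.
  by move=> k t _; rewrite lee_fin mulr_ge0 ?expR_ge0// G0// expR_gt0.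
have iABE : (fun k => \int[L]_(t in A k) (G t)%:E)%E =
    (fun k => \int[L]_(x in B k) (G (expR x) * expR x)%:E)%E.
  by apply/funext => k; exact: iAB.
by rewrite iABE in cA; rewrite -(cvg_lim _ cA)// -(cvg_lim _ cB).
Qed.

(** The common majorant of the integrals over t = exp x: it encodes power decay of order m at t = 0
    and at t = +oo. It is bounded by 1 / m times the exponential density of rate m plus its mirror
    image. *)
Lemma integrable_expN_norm m : 0 < m ->
  L.-integrable setT (EFin \o (fun x => expR (- (m * `|x|)))).
Proof.
move=> m0; have mE : measurable_fun setT (fun x : R => expR (- (m * `|x|))).
  by mfun.
have h : measurable_fun setT (EFin \o @exponential_pdf R m).
  by apply/measurable_EFinP; exact: measurable_exponential_pdf.
have i1 : (\int[L]_x (exponential_pdf m x)%:E = 1)%E.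
  exact: integral_exponential_pdf.
have i2 : (\int[L]_x (exponential_pdf m (- x))%:E = 1)%E.
  rewrite (@ge0_integralN1 R (EFin \o exponential_pdf m))// => x.
  by rewrite lee_fin exponential_pdf_ge0 ?ltW.
have h' : measurable_fun setT (fun x => (exponential_pdf m (- x))%:E).
  apply/measurable_EFinP.
  apply: (measurableT_comp (@measurable_exponential_pdf R m)).
  by apply: measurable_funN.
apply: integrable_normP => //.
apply: (@le_lt_trans _ _ (\int[L]_x ((m^-1)%:E *
    ((exponential_pdf m x)%:E + (exponential_pdf m (- x))%:E)))%E).
  apply: ge0_le_integral => //.
  - by apply/measurable_EFinP; mfun.
  - by apply: measurable_funeM; exact: emeasurable_funD.
  move=> x _; rewrite -EFinD -EFinM lee_fin ger0_norm ?expR_ge0//.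
  rewrite ler_pdivlMl//.
  have [x0|x0] := leP 0 x.
    rewrite exponential_pdfE// ger0_norm//= mulNr.
    by rewrite lerDl exponential_pdf_ge0 ?ltW.
  rewrite (@exponential_pdfE R m (- x)); last by rewrite oppr_ge0 ltW.
  rewrite /= ltr0_norm// mulNr.
  by rewrite lerDr exponential_pdf_ge0 ?ltW.
rewrite ge0_integralZl//=; last 3 first.
- exact: emeasurable_funD.
- by move=> x _; rewrite adde_ge0// lee_fin exponential_pdf_ge0 ?ltW.
- by rewrite lee_fin invr_ge0 ltW.
rewrite ge0_integralD//=; last 2 first.
- by move=> x _; rewrite lee_fin exponential_pdf_ge0 ?ltW.
- by move=> x _; rewrite lee_fin exponential_pdf_ge0 ?ltW.
by rewrite i1 i2 -EFinD -EFinM ltry.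
Qed.

End real_line.

Section gamma_integrals.
Context (R : realType).
Local Notation L := (@lebesgue_measure R).
Implicit Types (a p r s x : R).

Lemma powR_expR_ln p r : 0 < r -> r `^ p = expR (p * ln r).
Proof. by move=> r0; rewrite /powR gt_eqF. Qed.

Lemma powR_continuous p t : 0 < t -> {for t, continuous (fun u => u `^ p)}.
Proof.
move=> t0; apply: differentiable_continuous; apply/derivable1_diffP.
by apply: derivable_powR; rewrite in_itv/= t0.
Qed.

Lemma GammaE a : Gamma a = \int[L]_x expR (a * x - expR x).
Proof.
rewrite /Gamma /Rintegral; congr fine.
rewrite (@ge0_integral_expR R (fun t => t `^ (a - 1) * expR (- t))).
- apply: eq_integral => x _; congr EFin.
  rewrite -expRM mulrAC -expRD -expRD; congr expR; ring.
- move=> t t0; apply: (@cvgM _ _ _ _ (fun u : R => u `^ (a - 1))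
    (fun u : R => expR (- u))); first exact: powR_continuous.
  apply: (continuous_comp (f := -%R) (g := expR)); first exact: opp_continuous.
  exact: continuous_expR.
- by move=> t t0; rewrite mulr_ge0 ?expR_ge0// powR_ge0.
Qed.

Lemma integrable_gamma a : 0 < a ->
  L.-integrable setT (EFin \o (fun x => expR (a * x - expR x))).
Proof.
move=> a0; set m := Num.min a 1.
have m0 : 0 < m by rewrite /m lt_min a0 ltr01.
(* From the tangent of exp at ln (a + 1), whose slope is a + 1: a x - exp x <= - x + (a + 1) (ln (a
   + 1) - 1). This serves x >= 0; for x < 0 the term a x is enough. *)
set C := `|(a + 1) * (ln (a + 1) - 1)|.
have iC : L.-integrable setT
    (EFin \o (fun x => expR C * expR (- (m * `|x|)))).
  by apply: integrable_mulrl; exact: integrable_expN_norm.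
apply: integrable_le iC _; first by mfun.
move=> x; rewrite ger0_norm ?expR_ge0// -expRD ler_expR.
have a10 : 0 < a + 1 by rewrite ltr_wpDr// ltW.
have ex : (a + 1) * (1 + (x - ln (a + 1))) <= expR x.
  have := expR_ge1Dx (x - ln (a + 1)).
  by rewrite -(ler_pM2l a10) => /le_trans; apply;
    rewrite expRB lnK// mulrC divfK// gt_eqF.
have ma : m <= a by rewrite /m ge_min lexx.
have m1 : m <= 1 by rewrite /m ge_min lexx orbT.
have Cge := ler_norm ((a + 1) * (ln (a + 1) - 1)); rewrite -/C in Cge.
have C0 : 0 <= C by rewrite normr_ge0.
have [x0|x0] := leP 0 x.
  rewrite ger0_norm//; nra.
rewrite ltr0_norm//.
have := expR_gt0 x; nra.
Qed.

Lemma Gamma_gt0 a : 0 < a -> 0 < Gamma a.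
Proof.
move=> a0; rewrite -lte_fin GammaE EFin_Rintegral; last exact: integrable_gamma.
by apply: integral_gt0 => [|x]; [mfun|exact: expR_gt0].
Qed.

(** The scaling t -> t / r becomes the translation of x by - ln r. *)
Lemma gamma_scale a r : 0 < a -> 0 < r ->
  (\int[L]_x (expR (a * x - r * expR x))%:E = (r `^ (- a) * Gamma a)%:E)%E.
Proof.
move=> a0 r0.
have mf : measurable_fun setT (fun x : R => (expR (a * x - r * expR x))%:E).
  by mfun.
rewrite -(ge0_integralD1 (- ln r) mf) => [|x]; last by rewrite lee_fin expR_ge0.
rewrite EFinM GammaE EFin_Rintegral; last exact: integrable_gamma.
rewrite -ge0_integralZl//=;
  [|by mfun|by rewrite lee_fin powR_ge0].
apply: eq_integral => x _; rewrite -EFinM; congr EFin.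
rewrite powR_expR_ln// -expRD; congr expR.
rewrite expRD expRN lnK//; field.
by rewrite gt_eqF.
Qed.

(** The inversion t -> 1 / t becomes x -> - x. This is the form met with the heat kernel, whose
    exponent contains 1 / t. *)
Lemma gamma_inv_scale a r : 0 < a -> 0 < r ->
  (\int[L]_x (expR (- (a * x) - r * expR (- x)))%:E =
   (r `^ (- a) * Gamma a)%:E)%E.
Proof.
move=> a0 r0; rewrite -(gamma_scale a0 r0).
rewrite -[RHS](@ge0_integralN1 R (fun x => (expR (a * x - r * expR x))%:E)).
- by apply: eq_integral => x _; rewrite mulrN.
- by mfun.
- by move=> x; rewrite lee_fin expR_ge0.
Qed.

(* [\int_0^oo (1 - exp (- t)) t^(- s - 1) dt], after the substitution [t = e^x]. *)
Definition frac_const s : R := \int[L]_x (expR (- (s * x)) * (1 - expR (- expR x))).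

Lemma onem_expRN_ge0 x : 0 <= x -> 0 <= 1 - expR (- x).
Proof. by move=> x0; rewrite subr_ge0 expR_le1 oppr_le0. Qed.

(** For x >= 0 the bound 1 - exp (- t) <= 1 leaves exp (- s x), which decays because s > 0. For x <
    0 the bound 1 - exp (- t) <= t leaves exp ((1 - s) x), which decays because s < 1. *)
Lemma integrable_frac_const s : 0 < s < 1 -> L.-integrable setT
  (EFin \o (fun x => expR (- (s * x)) * (1 - expR (- expR x)))).
Proof.
move=> /andP[s0 s1]; set m := Num.min s (1 - s).
have m0 : 0 < m by rewrite /m lt_min s0 subr_gt0.
apply: integrable_le (integrable_expN_norm m0) _; first by mfun.
move=> x; rewrite ger0_norm ?mulr_ge0 ?onem_expRN_ge0 ?expR_ge0//.
have ms : m <= s by rewrite /m ge_min lexx.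
have m1 : m <= 1 - s by rewrite /m ge_min lexx orbT.
have [x0|x0] := leP 0 x.
  apply: (@le_trans _ _ (expR (- (s * x)))).
    by rewrite ler_piMr ?expR_ge0// gerBl expR_ge0.
  by rewrite ler_expR lerN2 ger0_norm// ler_wpM2r.
apply: (@le_trans _ _ (expR (- (s * x)) * expR x)).
  rewrite ler_wpM2l ?expR_ge0// lerBlDl -lerBlDr.
  exact: expR_ge1Dx.
rewrite -expRD ler_expR ltr0_norm//; nra.
Qed.

Lemma frac_const_gt0 s : 0 < s < 1 -> 0 < frac_const s.
Proof.
move=> s01; rewrite -lte_fin EFin_Rintegral; last exact: integrable_frac_const.
apply: integral_gt0 => [|x]; first by mfun.
by rewrite mulr_gt0 ?expR_gt0// subr_gt0 expR_lt1 oppr_lt0 expR_gt0.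
Qed.

Lemma frac_const_scale s r : 0 < s < 1 -> 0 <= r ->
  (\int[L]_x (expR (- (s * x)) * (1 - expR (- (r * expR x))))%:E =
   (r `^ s * frac_const s)%:E)%E.
Proof.
move=> s01; rewrite le_eqVlt => /predU1P[<-|r0].
  rewrite powR0 ?gt_eqF ?(andP s01).1// mul0r integral0_eq// => x _.
  by rewrite mul0r oppr0 expR0 subrr mulr0.
have mf : measurable_fun setT
    (fun x : R => (expR (- (s * x)) * (1 - expR (- (r * expR x))))%:E).
  by mfun.
rewrite -(ge0_integralD1 (- ln r) mf) => [|x]; last first.
  by rewrite lee_fin mulr_ge0 ?expR_ge0 ?onem_expRN_ge0 ?mulr_ge0 ?expR_ge0// ltW.
rewrite EFinM EFin_Rintegral; last exact: integrable_frac_const.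
rewrite -ge0_integralZl//=;
  [|by mfun|by rewrite lee_fin powR_ge0].
apply: eq_integral => x _; rewrite -EFinM; congr EFin.
rewrite powR_expR_ln// mulrA -expRD; congr (_ * _).
  by congr expR; ring.
congr (1 - expR (- _)).
rewrite expRD expRN lnK//; field.
by rewrite gt_eqF.
Qed.

End gamma_integrals.

(** * Fourier transform of Gaussians *)

Section pointwise_derivatives.
Context (R : realType).
Implicit Types (f g : R -> R) (x a b : R).

Lemma is_derive1_D f g x a b : is_derive x 1 f a -> is_derive x 1 g b ->
  is_derive x 1 (fun y => f y + g y) (a + b).
Proof. by move=> fa gb; exact: is_deriveD. Qed.

Lemma is_derive1_N f x a : is_derive x 1 f a ->
  is_derive x 1 (fun y => - f y) (- a).
Proof. by move=> fa; exact: is_deriveN. Qed.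

Lemma is_derive1_M f g x a b : is_derive x 1 f a -> is_derive x 1 g b ->
  is_derive x 1 (fun y => f y * g y) (a * g x + f x * b).
Proof.
move=> fa gb; apply: (is_derive_eq (is_deriveM fa gb)).
by rewrite /GRing.scale/= addrC (mulrC (g x)).
Qed.

Lemma is_derive1_cst (c : R) x : is_derive x 1 (fun=> c) 0.
Proof. exact: is_derive_cst. Qed.

Lemma is_derive1_id x : is_derive x 1 (fun y : R => y) 1.
Proof. exact: is_derive_id. Qed.

Lemma is_derive1_Ml (c : R) f x a : is_derive x 1 f a ->
  is_derive x 1 (fun y => c * f y) (c * a).
Proof.
move=> fa; have := is_derive1_M (is_derive1_cst c x) fa.
by rewrite mul0r add0r.
Qed.

Lemma is_derive1_continuous f x a : is_derive x 1 f a -> {for x, continuous f}.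
Proof.
by move=> [df _]; apply: differentiable_continuous; apply/derivable1_diffP.
Qed.

Lemma is_derive1E f x a : is_derive x 1 f a -> f^`()%classic x = a.
Proof. by move=> fa; rewrite derive1E; exact: (@derive_val _ _ _ _ _ _ _ fa). Qed.

End pointwise_derivatives.

Section gauss1.
Context (R : realType).
Local Notation L := (@lebesgue_measure R).
Implicit Types (a x xi th : R).

(** The normal density of variance 1 / (2 a); its total mass one then gives the Gaussian
    integral. *)
Lemma gauss1_normalE a x : 0 < a ->
  expR (- (a * x ^+ 2)) =
  Num.sqrt (pi / a) * normal_pdf 0 (Num.sqrt (2 * a))^-1 x.
Proof.
move=> a0.
have s0 : 0 < (Num.sqrt (2 * a))^-1 by rewrite invr_gt0 sqrtr_gt0 mulr_gt0.
have s2 : (Num.sqrt (2 * a))^-1 ^+ 2 = (2 * a)^-1.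
  by rewrite exprVn sqr_sqrtr// mulr_ge0// ltW.
rewrite normal_pdfE ?gt_eqF//= /normal_peak /normal_fun s2 subr0.
have -> : (2 * a)^-1 * pi *+ 2 = pi / a.
  by rewrite -mulr_natr; field; rewrite gt_eqF.
rewrite [RHS]mulrA divff ?mul1r; last first.
  by rewrite gt_eqF// sqrtr_gt0 divr_gt0 ?pi_gt0.
congr expR; rewrite -mulr_natr; field; by rewrite gt_eqF.
Qed.

Lemma integrable_gauss1 a : 0 < a ->
  L.-integrable setT (EFin \o (fun x => expR (- (a * x ^+ 2)))).
Proof.
move=> a0; under eq_fun do rewrite gauss1_normalE//.
by apply: integrable_mulrl; exact: integrable_normal_pdf.
Qed.

Lemma Rintegral_gauss1 a : 0 < a ->
  \int[L]_x expR (- (a * x ^+ 2)) = Num.sqrt (pi / a).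
Proof.
move=> a0; under eq_Rintegral do rewrite gauss1_normalE//.
rewrite RintegralZl//; last exact: integrable_normal_pdf.
by rewrite /Rintegral integral_normal_pdf mulr1.
Qed.

(** |x| <= 1 + x^2, and half of the exponent absorbs x^2, since u exp (- u) <= 1 with u = a x^2 /
    2. *)
Lemma integrable_gauss1_norm a : 0 < a ->
  L.-integrable setT (EFin \o (fun x => `|x| * expR (- (a * x ^+ 2)))).
Proof.
move=> a0.
have a20 : 0 < a / 2 by rewrite divr_gt0.
have ig := integrable_addr (integrable_gauss1 a0)
  (integrable_mulrl (a / 2)^-1 (integrable_gauss1 a20)).
apply: integrable_le ig _; first by mfun.
move=> x; rewrite ger0_norm ?mulr_ge0 ?expR_ge0//.
apply: (@le_trans _ _ ((1 + x ^+ 2) * expR (- (a * x ^+ 2)))).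
  rewrite ler_wpM2r ?expR_ge0//.
  have -> : 1 + x ^+ 2 = 1 + `|x| ^+ 2 by rewrite real_normK ?num_real.
  nra.
rewrite mulrDl mul1r lerD2l ler_pdivlMl// mulrA.
rewrite (_ : - (a * x ^+ 2) = - (a / 2 * x ^+ 2) - (a / 2 * x ^+ 2)); last first.
  by field.
rewrite expRD mulrA ler_piMl ?expR_ge0// -ler_pdivlMr ?expR_gt0//.
rewrite div1r -expRN opprK.
apply: le_trans (expR_ge1Dx _); by rewrite lerDr.
Qed.

Lemma Rintegral_derive0 (F f : R -> R) :
  (forall x, is_derive x 1 F (f x)) -> continuous f ->
  L.-integrable setT (EFin \o f) ->
  F k%:R @[k --> \oo] --> 0 -> F (- k%:R) @[k --> \oo] --> 0 ->
  \int[L]_x f x = 0.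
Proof.
move=> dF cf fi F1 F2.
pose B (k : nat) : set R := [set` `[- k%:R, k%:R]].
have mB k : measurable (B k) by exact: measurable_itv.
pose f_ k := f \_ (B k).
have c1 : \int[L]_x f_ k x @[k --> \oo] --> \int[L]_x f x.
  apply: (@Rintegral_dominated_cvg _ _ _ L f_ f (fun x => `|f x|)).
  - move=> k; apply/(measurable_restrictT f (mB k)).
    exact: measurable_funTS (integrable_meas fi).
  - move=> x; apply: cvg_near_cst.
    exists (Num.trunc `|x|).+1 => // k /= xk.
    rewrite /f_ patchE mem_set// /B/= in_itv/= -ler_norml.
    by apply: le_trans (ltW (truncnS_gt _)) _; rewrite ler_nat.
  - exact: integrable_norm fi.
  - move=> k x; rewrite /f_ patchE; case: ifPn => _ //.
    by rewrite normr0.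
have dcF : continuous F.
  move=> x; apply: differentiable_continuous; apply/derivable1_diffP.
  by case: (dF x).
(* With k + 1 in place of k the interval is never reduced to a point, as the fundamental theorem of
   calculus requires. *)
have fE k : \int[L]_x f_ k.+1 x = F k.+1%:R - F (- k.+1%:R).
  rewrite -Rintegral_mkcond /Rintegral (@continuous_FTC2 R f F)//.
  - by rewrite gtrN.
  - exact: continuous_subspaceT.
  - split; first by move=> x _; case: (dF x).
      by apply: cvg_at_right_filter; exact: dcF.
    by apply: cvg_at_left_filter; exact: dcF.
  - by move=> x _; rewrite derive1E; exact: (@derive_val _ _ _ _ _ _ _ (dF x)).
have c2 : \int[L]_x f_ k.+1 x @[k --> \oo] --> 0.
  rewrite (_ : (fun k => _) = (fun k => F k.+1%:R - F (- k.+1%:R))); last first.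
    by apply/funext.
  rewrite -[X in _ --> X](subr0 0).
  apply: cvgB; first by move: F1; rewrite -(cvg_shiftS (fun k => F k%:R)).
  by move: F2; rewrite -(cvg_shiftS (fun k => F (- k%:R))).
move: c1; rewrite -(cvg_shiftS (fun k => \int[L]_x f_ k x)) => c1.
by rewrite -(cvg_lim _ c1)// (cvg_lim _ c2).
Qed.

Let e a x := expR (- (a * x ^+ 2)).

Let de a x : is_derive x 1 (e a) (- (2 * a * x) * e a x).
Proof.
have d2 : is_derive x 1 (fun y => - (a * y ^+ 2)) (- (2 * a * x)).
  have := is_derive1_N (is_derive1_Ml a
    (is_derive1_M (is_derive1_id x) (is_derive1_id x))).
  by rewrite mul1r mulr1 -mulr2n mulrnAr -mulrnAl -mulr_natl.
have := is_derive1_comp (f := expR) (g := fun y => - (a * y ^+ 2))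
  (is_derive_expR _) d2.
by rewrite mulrC.
Qed.

Let dlin a b x : is_derive x 1 (fun y => a * y + b) a.
Proof.
have := is_derive1_D (is_derive1_Ml a (is_derive1_id x)) (is_derive1_cst b x).
by rewrite mulr1 addr0.
Qed.

Let dsin x xi th :
  is_derive x 1 (fun x => sin (xi * x + th)) (cos (xi * x + th) * xi).
Proof. exact: (is_derive1_comp (f := @sin R)
  (g := fun x => xi * x + th) (is_derive_sin (xi * x + th)) (dlin xi th x)). Qed.

Let dcos x xi th :
  is_derive xi 1 (fun xi => cos (x * xi + th)) (- sin (x * xi + th) * x).
Proof. exact: (is_derive1_comp (f := @cos R)
  (g := fun xi => x * xi + th) (is_derive_cos (x * xi + th)) (dlin x th xi)). Qed.

Let cos_le1 x : `|cos x| <= 1.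
Proof. by rewrite ler_norml cos_geN1 cos_le1. Qed.

Let sin_le1 x : `|sin x| <= 1.
Proof. by rewrite ler_norml sin_geN1 sin_le1. Qed.

Let ee_ge0 a x : 0 <= e a x. Proof. exact: expR_ge0. Qed.

Let ie a xi th : 0 < a ->
  L.-integrable setT (EFin \o (fun x => e a x * cos (x * xi + th))).
Proof.
move=> a0; apply: integrable_le (integrable_gauss1 a0) _; first by rewrite /e; mfun.
by move=> x; rewrite normrM ger0_norm ?ee_ge0// ler_piMr ?ee_ge0.
Qed.

Let ixe a xi th : 0 < a ->
  L.-integrable setT (EFin \o (fun x => x * e a x * sin (x * xi + th))).
Proof.
move=> a0; apply: integrable_le (integrable_gauss1_norm a0) _; first by rewrite /e; mfun.
move=> x; rewrite 2!normrM (@ger0_norm _ (e a x)) ?ee_ge0//.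
by rewrite ler_piMr// mulr_ge0 ?ee_ge0.
Qed.

Let e_cvg0 a (u : nat -> R) : 0 < a -> (forall k, u k ^+ 2 = k%:R ^+ 2) ->
  e a (u k) @[k --> \oo] --> 0.
Proof.
move=> a0 uk.
have c0 : expR (- k%:R) @[k --> \oo] --> (0 : R) by exact: cvgn_expR.
apply: (@squeeze_cvgr _ _ _ _ (fun=> 0) (fun k => expR (- k%:R) `^ a)).
- apply: nearW => k; rewrite ee_ge0/= /e uk -expRM ler_expR mulNr lerN2 mulrC.
  rewrite ler_wpM2l ?(ltW a0)// -natrX ler_nat.
  by case: k => // k; rewrite -mulnn leq_pmulr.
- exact: cvg_cst.
- rewrite (_ : (fun k => _) = (fun k => (expR (- a)) ^+ k)); last first.
    by apply/funext => k; rewrite -expRM -expRM_natl mulrN mulNr.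
  by apply: cvg_expr; rewrite ger0_norm ?expR_ge0// expR_lt1 oppr_lt0.
Qed.

(** The difference of the two sides is the integral of the derivative of exp (- a x^2) sin (x xi +
    th), which vanishes at both infinities. *)
Lemma gauss1_ibp a xi th : 0 < a ->
  xi * \int[L]_x (e a x * cos (x * xi + th)) =
  2 * a * \int[L]_x (x * e a x * sin (x * xi + th)).
Proof.
move=> a0; apply/eqP; rewrite -subr_eq0; apply/eqP.
rewrite -RintegralZl//; last exact: ie.
rewrite -RintegralZl//; last exact: ixe.
have i1 := integrable_mulrl xi (ie xi th a0).
have i2 := integrable_mulrl (2 * a) (ixe xi th a0).
rewrite -RintegralB//.
apply: (Rintegral_derive0 (F := fun x => e a x * sin (xi * x + th))).
- move=> x; have := is_derive1_M (de a x) (dsin x xi th).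
  by move=> D; apply: (is_derive_eq D); rewrite (mulrC xi x); ring.
- move=> x.
  have c1 : {for x, continuous (e a)} := is_derive1_continuous (de a x).
  have cl : {for x, continuous (fun x => x * xi + th)}.
    rewrite (_ : (fun x => _) = (fun x => xi * x + th)).
      exact: is_derive1_continuous (dlin xi th x).
    by apply/funext => y; rewrite mulrC.
  apply: cvgB.
    apply: cvgM; first exact: cvg_cst.
    apply: cvgM; first exact: c1.
    exact: (continuous_comp cl (@continuous_cos _ _)).
  apply: cvgM; first exact: cvg_cst.
  apply: cvgM; first by apply: cvgM; [exact: cvg_id|exact: c1].
  exact: (continuous_comp cl (@continuous_sin _ _)).
- have := integrable_addr i1 (integrable_mulrl (-1) i2).
  by apply: eq_integrable => // x _; rewrite /= mulN1r.
- apply: norm_cvg0; apply: (@squeeze_cvgr _ _ _ _ (fun=> 0) (fun k => e a k%:R)).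
  + apply: nearW => k; rewrite normr_ge0/= normrM ger0_norm ?ee_ge0//.
    by rewrite ler_piMr ?ee_ge0.
  + exact: cvg_cst.
  + exact: e_cvg0.
- apply: norm_cvg0; apply: (@squeeze_cvgr _ _ _ _ (fun=> 0) (fun k => e a (- k%:R))).
  + apply: nearW => k; rewrite normr_ge0/= normrM ger0_norm ?ee_ge0//.
    by rewrite ler_piMr ?ee_ge0.
  + exact: cvg_cst.
  + by apply: e_cvg0 => // k; rewrite sqrrN.
Qed.

(** Differentiation under the integral, with |x| exp (- a x^2) as a majorant uniform in the
    frequency, followed by [gauss1_ibp]. *)
Lemma gauss1_fourier_derive a xi th : 0 < a ->
  is_derive xi 1 (fun xi => \int[L]_x (e a x * cos (x * xi + th)))
    (- (xi / (2 * a)) * \int[L]_x (e a x * cos (x * xi + th))).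
Proof.
move=> a0.
pose f xi x := e a x * cos (x * xi + th).
have df (r x : R) : is_derive r 1 (f ^~ x) (- (x * e a x * sin (x * r + th))).
  have := is_derive1_Ml (e a x) (dcos x r th).
  by move=> D; apply: (is_derive_eq D); ring.
have Ixi : `]xi - 1, xi + 1[%classic xi.
  by rewrite /= in_itv/= ltrDl gtrBl ltr01.
have h1 : forall r, `]xi - 1, xi + 1[%classic r -> L.-integrable setT (EFin \o f r).
  by move=> r _; exact: ie.
have h2 : forall r x, `]xi - 1, xi + 1[%classic r -> setT x -> derivable (f ^~ x) r 1.
  by move=> r x _ _; case: (df r x).
have h3 : forall x, 0 <= `|x| * e a x by move=> x; rewrite mulr_ge0 ?ee_ge0.
have h4 : forall r x, `]xi - 1, xi + 1[%classic r -> setT x ->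
    `|partial1of2 f r x| <= `|x| * e a x.
  move=> r x _ _; rewrite /partial1of2 (is_derive1E (df r x)).
  rewrite normrN 2!normrM (@ger0_norm _ (e a x)) ?ee_ge0//.
  by rewrite ler_piMr// mulr_ge0 ?ee_ge0.
have d1 := derivable_under_integral measurableT Ixi h1 h2 h3
  (integrable_gauss1_norm a0) h4.
have d2 := differentiation_under_integral measurableT Ixi h1 h2 h3
  (integrable_gauss1_norm a0) h4.
apply: DeriveDef => //.
rewrite -derive1E d2.
under eq_Rintegral => x _ do rewrite /partial1of2 (is_derive1E (df xi x)) -mulN1r.
rewrite RintegralZl//; last exact: ixe.
rewrite mulN1r mulNr mulrAC gauss1_ibp// [in RHS]mulrAC divff ?mul1r//.
by rewrite mulf_neq0// gt_eqF.
Qed.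

(* As a function of [xi] the integral solves J' = - xi / (2 a) J. *)
Lemma gauss1_fourier a xi th : 0 < a ->
  \int[L]_x (expR (- (a * x ^+ 2)) * cos (x * xi + th)) =
  Num.sqrt (pi / a) * expR (- (xi ^+ 2 / (4 * a))) * cos th.
Proof.
move=> a0.
pose F r := \int[L]_x (e a x * cos (x * r + th)).
pose H r := expR (r ^+ 2 / (4 * a)) * F r.
have dH (r : R) : is_derive r 1 H 0.
  have d2 : is_derive r 1 (fun y => y ^+ 2 / (4 * a)) (r / (2 * a)).
    have := is_derive1_Ml (4 * a)^-1
      (is_derive1_M (is_derive1_id r) (is_derive1_id r)).
    rewrite mul1r mulr1.
    under eq_fun do rewrite mulrC.
    by move=> D; apply: (is_derive_eq D); field; rewrite gt_eqF.
  have := is_derive1_M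
    (is_derive1_comp (f := expR) (g := fun y => y ^+ 2 / (4 * a))
      (is_derive_expR _) d2)
    (gauss1_fourier_derive r th a0).
  by move=> D; apply: (is_derive_eq D); rewrite /=; ring.
have := is_derive_0_is_cst xi 0 dH.
rewrite /H expr0n/= mul0r expR0 mul1r.
rewrite /F; under [in RHS]eq_Rintegral do rewrite mulr0 add0r mulrC.
rewrite RintegralZl//; last exact: integrable_gauss1.
rewrite Rintegral_gauss1// => Hxi.
have E0 : expR (xi ^+ 2 / (4 * a)) != 0 by rewrite gt_eqF ?expR_gt0.
rewrite expRN; apply: (mulfI E0); rewrite Hxi.
by field.
Qed.

End gauss1.

Section leb_induction.
Context (R : realType).
Local Notation L := (@lebesgue_measure R).

Lemma measurable_comp_cons n d (T : measurableType d) (f : 'rV[R]_n.+1 -> T) :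
  measurable_fun setT f ->
  measurable_fun setT (fun p : R * 'rV[R]_n => f (cons_rV (p.1, p.2))).
Proof.
move=> mf.
have := measurableT_comp mf (@measurable_cons_rV R n).
by congr (measurable_fun _ _); apply/funext => -[].
Qed.

Lemma integrable_lebS n (f : 'rV[R]_n.+1 -> R) : measurable_fun setT f ->
  (\int[leb n]_v \int[L]_t `|f (cons_rV (t, v))|%:E < +oo)%E ->
  (leb n.+1).-integrable setT (EFin \o f).
Proof.
move=> mf fy; apply: integrable_normP => //.
by rewrite (ge0_integral_lebS (f := fun x => `|f x|%:E)) => //; mfun.
Qed.

Lemma Rintegral_lebS n (f : 'rV[R]_n.+1 -> R) : measurable_fun setT f ->
  (\int[leb n]_v \int[L]_t `|f (cons_rV (t, v))|%:E < +oo)%E ->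
  \int[leb n.+1]_x f x = \int[leb n]_v \int[L]_t f (cons_rV (t, v)).
Proof.
move=> mf fy.
have mfc := measurable_comp_cons mf.
have fy' : (\int[L]_t \int[leb n]_v `|f (cons_rV (t, v))|%:E < +oo)%E.
  by rewrite (@tonelli_abs _ _ _ _ _ L (leb n) (fun t v => f (cons_rV (t, v)))).
have fi := integrable_lebS mf fy.
rewrite -(@Rintegral_fubini _ _ _ _ _ L (leb n) (fun t v => f (cons_rV (t, v))))//.
rewrite -(@Rintegral_prod _ _ _ _ _ L (leb n) (fun t v => f (cons_rV (t, v))))//.
rewrite /Rintegral; congr fine.
rewrite integral_leb_prod; last exact/measurable_EFinP.
by apply: eq_integral => -[].
Qed.

Definition tail_rV n (v : 'rV[R]_n.+1) : 'rV[R]_n := \row_i v ord0 (lift ord0 i).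

Lemma dotp_cons n t (v : 'rV[R]_n) xi :
  dotp (cons_rV (t, v)) xi = t * xi ord0 ord0 + dotp v (tail_rV xi).
Proof.
rewrite /dotp big_ord_recl cons_rV0; congr (_ + _).
by apply: eq_bigr => i _; rewrite cons_rVS mxE.
Qed.

Lemma tail_cons n t (v : 'rV[R]_n) : tail_rV (cons_rV (t, v)) = v.
Proof. by apply/rowP => i; rewrite mxE cons_rVS. Qed.

Lemma dotpSr n (x : 'rV[R]_n.+1) :
  dotp x x = x ord0 ord0 ^+ 2 + dotp (tail_rV x) (tail_rV x).
Proof.
rewrite /dotp big_ord_recl -expr2; congr (_ + _).
by apply: eq_bigr => i _; rewrite !mxE.
Qed.

Lemma dotp0 (x y : 'rV[R]_0) : dotp x y = 0.
Proof. by rewrite /dotp big_ord0. Qed.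

Lemma integral_leb0 (f : 'rV[R]_0 -> \bar R) : (\int[leb 0]_x f x)%E = f 0.
Proof.
have -> : f = cst (f 0) by apply/funext => x; congr f; apply/rowP => -[].
by rewrite leb0E integral_dirac//= diracE mem_set// mul1e.
Qed.

Lemma Rintegral_leb0 (f : 'rV[R]_0 -> R) : \int[leb 0]_x f x = f 0.
Proof. by rewrite /Rintegral integral_leb0. Qed.

End leb_induction.

Section gauss_rV.
Context (R : realType).
Local Notation L := (@lebesgue_measure R).

Lemma gauss_cons n (a t : R) (v : 'rV[R]_n) :
  expR (- (a * dotp (cons_rV (t, v)) (cons_rV (t, v)))) =
  expR (- (a * dotp v v)) * expR (- (a * t ^+ 2)).
Proof.
rewrite dotpSr tail_cons cons_rV0/= -expRD; congr expR; ring.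
Qed.

Lemma ge0_integral_gauss n (a : R) : 0 < a ->
  (\int[leb n]_x (expR (- (a * dotp x x)))%:E = (Num.sqrt (pi / a) ^+ n)%:E)%E.
Proof.
move=> a0; elim: n => [|n ih].
  by rewrite integral_leb0 dotp0 mulr0 oppr0 expR0 expr0.
rewrite ge0_integral_lebS; last 2 first.
- by mfun.
- by move=> x; rewrite lee_fin expR_ge0.
under eq_integral => v _.
  under eq_integral => t _ do rewrite gauss_cons EFinM.
  rewrite ge0_integralZl//=; last by mfun.
  rewrite -EFin_Rintegral; last exact: integrable_gauss1.
  rewrite Rintegral_gauss1//.
  over.
rewrite ge0_integralZr//=; last by mfun.
by rewrite ih -EFinM exprSr.
Qed.

Lemma integrable_gauss n (a : R) : 0 < a ->
  (leb n).-integrable setT (EFin \o (fun x => expR (- (a * dotp x x)))).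
Proof.
move=> a0; apply: integrable_normP; first by mfun.
under eq_integral do rewrite ger0_norm ?expR_ge0//.
by rewrite ge0_integral_gauss// ltry.
Qed.

Lemma norm_cos_le1 (x : R) : `|cos x| <= 1.
Proof. by rewrite ler_norml cos_geN1 cos_le1. Qed.

Lemma integrable_mul_cos d (T : measurableType d) (m : {measure set T -> \bar R})
  (f g : T -> R) : measurable_fun setT g -> m.-integrable setT (EFin \o f) ->
  m.-integrable setT (EFin \o (fun x => f x * cos (g x))).
Proof.
move=> mg fi; have mf := integrable_meas fi.
have nfi : m.-integrable setT (EFin \o (fun x => `|f x|)).
  exact: integrable_norm fi.
apply: integrable_le nfi _; first by mfun.
by move=> x; rewrite normrM ler_piMr// norm_cos_le1.
Qed.

(** The phase closes the induction: for the inner integral over the first coordinate, the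
    contribution of all other coordinates is a phase. *)
Lemma gauss_fourier n (a : R) (xi : 'rV[R]_n) (th : R) : 0 < a ->
  \int[leb n]_x (expR (- (a * dotp x x)) * cos (dotp x xi + th)) =
  Num.sqrt (pi / a) ^+ n * expR (- (dotp xi xi / (4 * a))) * cos th.
Proof.
move=> a0; elim: n xi th => [|n ih] xi th.
  by rewrite Rintegral_leb0 !dotp0 mulr0 mul0r oppr0 expR0 expr0 add0r !mul1r.
have mf : measurable_fun setT
    (fun x : 'rV[R]_n.+1 => expR (- (a * dotp x x)) * cos (dotp x xi + th)).
  by mfun.
rewrite Rintegral_lebS//; last first.
  rewrite -(ge0_integral_lebS (f := fun x : 'rV[R]_n.+1 =>
    `|expR (- (a * dotp x x)) * cos (dotp x xi + th)|%:E)) => //; last by mfun.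
  apply: integrable_norm_lty; apply: integrable_mul_cos; first by mfun.
  exact: integrable_gauss.
have inner v : \int[L]_t (expR (- (a * dotp (cons_rV (t, v)) (cons_rV (t, v)))) *
      cos (dotp (cons_rV (t, v)) xi + th)) =
    Num.sqrt (pi / a) * expR (- (xi ord0 ord0 ^+ 2 / (4 * a))) *
    (expR (- (a * dotp v v)) * cos (dotp v (tail_rV xi) + th)).
  under eq_Rintegral => t _ do rewrite gauss_cons dotp_cons -!addrA -mulrA.
  rewrite RintegralZl//; last first.
    by apply: integrable_mul_cos; [mfun|exact: integrable_gauss1].
  by rewrite gauss1_fourier// mulrCA.
under eq_Rintegral => v _ do rewrite inner.
rewrite RintegralZl//; last first.
  by apply: integrable_mul_cos; [mfun|exact: integrable_gauss].
rewrite ih dotpSr.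
set A := xi ord0 ord0 ^+ 2; set B := dotp (tail_rV xi) _.
have -> : expR (- ((A + B) / (4 * a))) =
    expR (- (A / (4 * a))) * expR (- (B / (4 * a))).
  by rewrite -expRD -opprD mulrDl.
rewrite exprSr; ring.
Qed.

End gauss_rV.

(** * Fourier transform of test functions *)

Section test_functions.
Context (R : realType) (n : nat).
Implicit Types (f phi : 'rV[R]_n -> R) (x y xi : 'rV[R]_n) (i : 'I_n).
Local Notation e_ i := (delta_mx ord0 i : 'rV[R]_n).

Lemma continuous_measurable_rV f : continuous f -> measurable_fun setT f.
Proof.
move=> cf; apply: (measurability _ (RGenOpens.measurableE R)).
move=> _ [_ [a [b ->]] <-]; rewrite setTI; apply: open_measurable_rV.
by apply: open_comp; [move=> x _; exact: cf|exact: interval_open].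
Qed.

Lemma rV_coord_le x i : `|x ord0 i| <= `|x|.
Proof.
have -> : `|x| = mx_norm x by [].
rewrite mx_normrE.
exact: (le_bigmax _ (fun ij => `|x ij.1 ij.2|) (ord0, i)).
Qed.

Lemma compact_box (K : set 'rV[R]_n) : compact K ->
  exists2 M : R, 0 < M & K `<=` box M.
Proof.
move=> /compact_bounded[M [_ HM]]; exists (`|M| + 1); first by rewrite ltr_wpDl.
move=> x Kx i; apply: le_trans (rV_coord_le x i) _.
by apply: HM => //; rewrite ltr_pwDr// ler_norm.
Qed.

Lemma compact_closed_box (M : R) : compact (@box R n M).
Proof.
apply: bounded_closed_compact.
  exists `|M|; split; first exact: num_real.
  move=> r Mr x bx /=; have -> : `|x| = mx_norm x by [].
rewrite mx_normrE.
  apply: bigmax_le => [|[j i] _ /=].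
    by rewrite (le_trans _ (ltW Mr)).
  by rewrite (ord1 j) (le_trans (bx i))// (le_trans (ler_norm _))// ltW.
rewrite (_ : box M = \bigcap_(i in [set: 'I_n])
    ((fun v : 'rV[R]_n => v ord0 i) @^-1` [set r | `|r| <= M])).
  apply: closed_bigI => i _; apply: preimage_closed.
    by move=> x _; exact: coord_continuous.
  have -> : [set r : R | `|r| <= M] = [set` `[- M, M]].
    by apply/seteqP; split => r /=; rewrite in_itv/= ler_norml.
  exact: interval_closed.
by apply/seteqP; split => x bx i; [move=> _|]; exact: bx.
Qed.

Lemma continuous_bounded_box f (M : R) : continuous f ->
  exists2 B : R, 0 <= B & forall x, box M x -> `|f x| <= B.
Proof.
move=> cf.
have : compact (f @` box M).
  by apply: continuous_compact; [exact: continuous_subspaceT|exact: compact_closed_box].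
move=> /compact_bounded[B [_ HB]]; exists (`|B| + 1); first by rewrite addr_ge0.
move=> x bx; apply: HB; last by exists x.
by rewrite ltr_pwDr// ler_norm.
Qed.

Lemma Ck_continuous k f : Ck k f -> continuous f.
Proof. by case: k => [|k] []. Qed.

Lemma test_continuous phi : test_function phi -> continuous phi.
Proof. by move=> [/(_ 0%N)/Ck_continuous]. Qed.

Lemma test_measurable phi : test_function phi -> measurable_fun setT phi.
Proof. by move=> /test_continuous/continuous_measurable_rV. Qed.

Lemma test_support phi : test_function phi ->
  exists2 M : R, 0 < M & forall x, ~ box M x -> phi x = 0.
Proof.
move=> [_ /compact_box[M M0 HM]]; exists M => // x.
apply: contra_notP => /eqP px; apply: HM; exact: subset_closure.
Qed.

Lemma test_bounded phi : test_function phi ->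
  exists2 B : R, 0 <= B & forall x, `|phi x| <= B.
Proof.
move=> tp; have [M _ HM] := test_support tp.
have [B B0 HB] := continuous_bounded_box M (test_continuous tp).
exists B => // x; have [bx|nbx] := pselect (box M x); first exact: HB.
by rewrite HM// normr0.
Qed.

Lemma integrable_box (M c : R) :
  (leb n).-integrable setT (EFin \o (fun x => c * \1_(box M) x)).
Proof.
apply: integrable_mulrl; apply: integrable_normP.
  by apply: measurable_indic; exact: measurable_box.
under eq_integral do rewrite ger0_norm//.
rewrite integral_indic//; last exact: measurable_box.
by rewrite setIT; exact: leb_box_lty.
Qed.

Lemma bounded_support_integrable phi (M B : R) : measurable_fun setT phi ->
  (forall x, ~ box M x -> phi x = 0) -> (forall x, `|phi x| <= B) ->
  (leb n).-integrable setT (EFin \o phi).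
Proof.
move=> mp HM HB; apply: integrable_le (integrable_box M B) _ => // x.
rewrite indicE; have [bx|nbx] := pselect (box M x).
  by rewrite mem_set// mulr1.
by rewrite HM// memNset// mulr0 normr0.
Qed.

Lemma test_integrable phi : test_function phi ->
  (leb n).-integrable setT (EFin \o phi).
Proof.
move=> tp; have [M _ HM] := test_support tp; have [B _ HB] := test_bounded tp.
by apply: bounded_support_integrable HM HB; exact: test_measurable.
Qed.

(** Off the closed support of phi, phi vanishes in a neighbourhood and so does its derivative; the
    support of the derivative is thus a closed subset of a compact set. *)
Lemma test_partial phi i : test_function phi -> test_function (partial i phi).
Proof.
move=> [Cphi cphi]; split=> [k|].
  by have [_ /(_ i)[]] := Cphi k.+1.
apply: subclosed_compact cphi _; first exact: closed_closure.
rewrite closureE => x; apply; split; first exact: closed_closure.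
move=> y /= /eqP; apply: contra_notP => ny; rewrite /partial.
have oC : open (~` closure [set x | phi x != 0]).
  by apply: closed_openC; exact: closed_closure.
have : \forall z \near y, phi z = 0.
  have : nbhs y (~` closure [set x | phi x != 0]) by exact: open_nbhs_nbhs.
  apply: filterS => z /= nz; apply: contra_notP nz => /eqP pz.
  exact: subset_closure.
move=> nz; have -> : 'D_(e_ i) (phi : 'rV[R]_n -> R^o) y =
    'D_(e_ i) (cst 0 : 'rV[R]_n -> R^o) y.
  by apply: near_eq_derive => //; apply: filterS nz.
exact: derive_cst.
Qed.

Lemma test_is_derive_slice phi i y (t : R) : test_function phi ->
  is_derive t 1 (fun t => phi (y + t *: e_ i)) (partial i phi (y + t *: e_ i)).
Proof.
move=> [/(_ 1%N)[_ /(_ i)[d _]] _].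
have E : (fun h : R => h^-1 *: (((fun t => phi (y + t *: e_ i)) \o shift t) (h *: 1)
     - phi (y + t *: e_ i))) =
    (fun h => h^-1 *: (((phi : 'rV[R]_n -> R^o) \o shift (y + t *: e_ i)) (h *: e_ i)
     - phi (y + t *: e_ i))).
  apply/funext => h /=; congr (_ *: (phi _ - _)).
  by rewrite /GRing.scale/= mulr1 addrCA -scalerDl addrC.
apply: DeriveDef; first by rewrite /derivable E; exact: d.
by rewrite /partial/derive E.
Qed.

Lemma test_mvt phi i y (h B : R) : test_function phi ->
  (forall z, `|partial i phi z| <= B) -> 0 <= h ->
  `|phi (y + h *: e_ i) - phi y| <= B * h.
Proof.
move=> tp HB h0.
have := @MVT_segment _ (fun t => phi (y + t *: e_ i))
  (fun t => partial i phi (y + t *: e_ i)) 0 h h0.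
case=> [t _|t|c _].
- exact: test_is_derive_slice.
- apply: continuous_subspaceT => {}t.
  exact: is_derive1_continuous (test_is_derive_slice i y t tp).
rewrite scale0r addr0 subr0 => ->.
by rewrite normrM (ger0_norm h0) ler_wpM2r.
Qed.

End test_functions.

Section difference_quotients.
Context (R : realType).

Lemma is_derive_seq (f : R -> R) (x l : R) (h : nat -> R) :
  is_derive x 1 f l -> (forall k, h k != 0) -> h k @[k --> \oo] --> 0 ->
  (f (x + h k) - f x) / h k @[k --> \oo] --> l.
Proof.
move=> [df <-] h0 hc.
have /cvgr_dnbhsP/(_ h (conj h0 hc)) :
    (fun t : R => t^-1 *: ((f \o shift x) (t *: 1) - f x)) t @[t --> 0^'] -->
    'D_1 f x by exact: df.
apply: cvg_trans; apply: near_eq_cvg; apply: nearW => k /=.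
by rewrite /GRing.scale/= mulr1 mulrC (addrC x).
Qed.

Lemma cos_lipschitz (a b : R) : `|cos a - cos b| <= `|a - b|.
Proof.
wlog ab : a b / b <= a.
  move=> H; have [/H//|/ltW/H] := leP b a.
  by rewrite distrC [X in _ <= X]distrC.
have [] := @MVT_segment _ cos (fun x => - sin x) b a ab.
  by apply: continuous_subspaceT; exact: continuous_cos.
move=> c _ ->; rewrite normrM normrN ler_piMl//.
by rewrite ler_norml sin_geN1 sin_le1.
Qed.

End difference_quotients.

Section translation_invariance.
Context (R : realType) (n : nat).

Lemma Rintegral_lebD (a : 'rV[R]_n) (f : 'rV[R]_n -> R) : measurable_fun setT f ->
  \int[leb n]_x f (x + a) = \int[leb n]_x f x.
Proof.
move=> mf; rewrite /Rintegral; congr fine.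
by apply: (integral_lebD a (f := fun x => (f x)%:E)); exact/measurable_EFinP.
Qed.

Lemma integrable_lebD (a : 'rV[R]_n) (f : 'rV[R]_n -> R) :
  (leb n).-integrable setT (EFin \o f) ->
  (leb n).-integrable setT (EFin \o (fun x => f (x + a))).
Proof.
move=> fi; have mf := integrable_meas fi.
apply: integrable_normP; first by mfun.
rewrite (integral_lebD a (f := fun x => `|f x|%:E)); last by mfun.
exact: integrable_norm_lty.
Qed.

End translation_invariance.

Section fourier_decay.
Context (R : realType) (n : nat).
Implicit Types (phi : 'rV[R]_n -> R) (x y xi : 'rV[R]_n) (i : 'I_n) (th : R).
Local Notation e_ i := (delta_mx ord0 i : 'rV[R]_n).

(* The phase makes [fourier_re] (th = 0) and [fourier_im] (th = pi / 2) special
   cases, and stays stable under differentiation and translation of phi. *)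
Definition ft phi xi th : R := \int[leb n]_y (phi y * cos (dotp y xi + th)).

Lemma dotpDl x y xi : dotp (x + y) xi = dotp x xi + dotp y xi.
Proof.
by rewrite /dotp -big_split; apply: eq_bigr => i _; rewrite mxE mulrDl.
Qed.

Lemma dotpZl (c : R) x xi : dotp (c *: x) xi = c * dotp x xi.
Proof.
by rewrite /dotp mulr_sumr; apply: eq_bigr => i _; rewrite mxE mulrA.
Qed.

Lemma dotpNl x xi : dotp (- x) xi = - dotp x xi.
Proof. by rewrite -scaleN1r dotpZl mulN1r. Qed.

Lemma dotpC x y : dotp x y = dotp y x.
Proof. by apply: eq_bigr => i _; rewrite mulrC. Qed.

Lemma dotp_delta i xi : dotp (e_ i) xi = xi ord0 i.
Proof.
rewrite /dotp (bigD1 i)//= mxE !eqxx mul1r big1 ?addr0// => j ji.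
by rewrite mxE eqxx/= (negbTE ji) mul0r.
Qed.

(* Integration by parts, done on difference quotients: it then reduces to the
   translation invariance of Lebesgue measure. *)
Lemma ft_partial phi i xi th : test_function phi ->
  ft (partial i phi) xi th = xi ord0 i * ft phi xi (th - pi / 2).
Proof.
move=> tp; have tdp := test_partial i tp.
have mphi := test_measurable tp; have iphi := test_integrable tp.
have [M M0 HM] := test_support tp; have [B B0 HB] := test_bounded tdp.
pose h (k : nat) : R := k.+1%:R^-1.
have h0 k : 0 < h k by rewrite invr_gt0.
have h1 k : h k <= 1 by rewrite invf_le1// ler1n.
have hc : h k @[k --> \oo] --> 0 by exact: cvg_harmonic.
pose c y := dotp y xi + th.
have mc : measurable_fun setT c by rewrite /c; mfun.
pose f1 k y := (phi (y + h k *: e_ i) - phi y) / h k * cos (c y).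
pose f2 k y := phi y * ((cos (c y - h k * xi ord0 i) - cos (c y)) / h k).
have i1 k : (leb n).-integrable setT
    (EFin \o (fun y => phi (y + h k *: e_ i) * cos (c y))).
  by apply: integrable_mul_cos => //; exact: integrable_lebD.
have i2 : (leb n).-integrable setT (EFin \o (fun y => phi y * cos (c y))).
  exact: integrable_mul_cos.
have i3 k : (leb n).-integrable setT
    (EFin \o (fun y => phi y * cos (c y - h k * xi ord0 i))).
  by apply: integrable_mul_cos => //; mfun.
have f12 k : \int[leb n]_y f1 k y = \int[leb n]_y f2 k y.
  have -> : f1 k = (fun y => (h k)^-1 *
      (phi (y + h k *: e_ i) * cos (c y) - phi y * cos (c y))).
    by apply/funext => y; rewrite /f1; ring.
  have -> : f2 k = (fun y => (h k)^-1 *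
      (phi y * cos (c y - h k * xi ord0 i) - phi y * cos (c y))).
    by apply/funext => y; rewrite /f2; ring.
  rewrite !RintegralZl//; last 2 first.
  - have := integrableB measurableT (i3 k) i2.
    by apply: eq_integrable => // y _; rewrite /= EFinB.
  - have := integrableB measurableT (i1 k) i2.
    by apply: eq_integrable => // y _; rewrite /= EFinB.
  rewrite !RintegralB//; congr (_ * (_ - _)).
  rewrite -[RHS](Rintegral_lebD (h k *: e_ i)); last exact: integrable_meas (i3 k).
  apply: eq_Rintegral => y _; congr (_ * cos _).
  by rewrite /c dotpDl dotpZl dotp_delta; ring.
have c1 : \int[leb n]_y f1 k y @[k --> \oo] -->
    \int[leb n]_y (partial i phi y * cos (c y)).
  (* B comes from the mean value theorem. As h k <= 1, phi and its translate both vanish off the box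
     enlarged by 1. *)
  apply: (@Rintegral_dominated_cvg _ _ _ _ f1 _ (fun y => B * \1_(box (M + 1)) y)).
  - by move=> k; rewrite /f1; mfun.
  - move=> y; apply: cvgM; last exact: cvg_cst.
    have := is_derive_seq (test_is_derive_slice i y 0 tp) (fun k => lt0r_neq0 (h0 k)) hc.
    under eq_fun do rewrite add0r scale0r addr0.
    by rewrite scale0r addr0.
  - exact: integrable_box.
  - move=> k y; rewrite /f1 normrM.
    apply: (@le_trans _ _ `|(phi (y + h k *: e_ i) - phi y) / h k|).
      by rewrite ler_piMr// norm_cos_le1.
    rewrite normrM normfV (gtr0_norm (h0 k)) ler_pdivrMr//.
    rewrite indicE; have [bx|nbx] := pselect (box (M + 1) y).
      by rewrite mem_set// mulr1; exact: test_mvt (ltW (h0 k)).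
    rewrite memNset// mulr0 mul0r.
    have n1 : ~ box M y.
      by apply: contra_not nbx => bM j; rewrite (le_trans (bM j))// lerDl.
    have n2 : ~ box M (y + h k *: e_ i).
      apply: contra_not nbx => bM j.
      have := bM j; rewrite !mxE eqxx/= => bj.
      rewrite -[y ord0 j](addrK (h k * (j == i)%:R)).
      rewrite (le_trans (ler_normB _ _))// lerD// normrM (gtr0_norm (h0 k)).
      by case: eqP => _; rewrite ?normr1 ?mulr1// normr0 mulr0.
    by rewrite !HM// subr0 normr0.
have c2 : \int[leb n]_y f2 k y @[k --> \oo] -->
    \int[leb n]_y (phi y * (sin (c y) * xi ord0 i)).
  apply: (@Rintegral_dominated_cvg _ _ _ _ f2 _ (fun y => `|xi ord0 i| * `|phi y|)).
  - by move=> k; rewrite /f2; mfun.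
  - move=> y; apply: cvgM; first exact: cvg_cst.
    have dl : is_derive (0:R) 1 (fun t => c y - t * xi ord0 i) (- xi ord0 i).
      have := is_derive1_D (is_derive1_cst (c y) 0) (is_derive1_N
        (is_derive1_M (is_derive1_id (0:R)) (is_derive1_cst (xi ord0 i) 0))).
      by rewrite mul1r mulr0 addr0 add0r.
    have dc := is_derive1_comp (f := cos) (g := fun t => c y - t * xi ord0 i)
      (is_derive_cos _) dl.
    have := is_derive_seq dc (fun k => lt0r_neq0 (h0 k)) hc.
    rewrite /= mulrNN mul0r subr0.
    by under eq_fun do rewrite add0r.
  - by apply: integrable_mulrl; exact: integrable_norm iphi.
  - move=> k y; rewrite /f2 normrM mulrC ler_wpM2r//.
    rewrite normrM normfV (gtr0_norm (h0 k)) ler_pdivrMr//.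
    rewrite (le_trans (cos_lipschitz _ _))// addrAC subrr add0r normrN normrM.
    by rewrite (gtr0_norm (h0 k)) mulrC.
rewrite /ft -(cvg_lim _ c1)//.
rewrite (_ : (fun k => _) = (fun k => \int[leb n]_y f2 k y)); last by apply/funext.
rewrite (cvg_lim _ c2)//.
rewrite -RintegralZl//; last by apply: integrable_mul_cos => //; mfun.
by apply: eq_Rintegral => y _; rewrite /c addrA cosBpihalf; ring.
Qed.

End fourier_decay.

Section decay_weight.
Context (R : realType).
Local Notation L := (@lebesgue_measure R).

Lemma measurable_bigprod d (T : measurableType d) I (s : seq I) (g : I -> T -> R) :
  (forall i, measurable_fun setT (g i)) ->
  measurable_fun setT (fun x => \prod_(i <- s) g i x).
Proof.
move=> mg; elim: s => [|i s ih].
  by under eq_fun do rewrite big_nil; exact: measurable_cst.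
by under eq_fun do rewrite big_cons; exact: measurable_funM.
Qed.

(** The integrable majorant of Fourier transforms. Its product form reduces its integral to the n-th
    power of the integral of 1 / (1 + t^2). *)
Definition wgt n (xi : 'rV[R]_n) : R := \prod_i (oneDsqr (xi ord0 i))^-1.

Lemma measurable_wgt n : measurable_fun setT (@wgt n).
Proof.
apply: measurable_bigprod => i.
apply: (measurableT_comp (continuous_measurable_fun (@continuous_oneDsqrV R))
  (g := fun xi : 'rV[R]_n => xi ord0 i)).
exact: measurable_coord.
Qed.

Lemma wgt_gt0 n (xi : 'rV[R]_n) : 0 < wgt xi.
Proof. by apply: prodr_gt0 => i _; rewrite invr_gt0 (lt_le_trans _ (oneDsqr_ge1 _)). Qed.

Lemma wgt_cons n t (v : 'rV[R]_n) : wgt (cons_rV (t, v)) = wgt v * (oneDsqr t)^-1.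
Proof.
rewrite /wgt big_ord_recl cons_rV0/= mulrC; congr (_ * _).
by apply: eq_bigr => i _; rewrite cons_rVS.
Qed.

Lemma integral_oneDsqrV : (\int[L]_x ((@oneDsqr R x)^-1)%:E = pi%:E)%E.
Proof.
rewrite (@ge0_symfun_integralT R (fun x => (oneDsqr x)^-1)).
- by rewrite -set_itvcy integral0y_oneDsqr -EFinM mulrC divfK.
- by move=> x; rewrite invr_ge0 (le_trans _ (oneDsqr_ge1 _)).
- exact: continuous_oneDsqrV.
- by move=> x /=; rewrite /oneDsqr sqrrN.
Qed.

Lemma integral_wgt n : (\int[leb n]_xi (wgt xi)%:E = (pi ^+ n)%:E)%E.
Proof.
elim: n => [|n ih]; first by rewrite integral_leb0 /wgt big_ord0.
have m1 : measurable_fun setT (fun x : R => (oneDsqr x)^-1).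
  exact: (continuous_measurable_fun (@continuous_oneDsqrV R)).
have mw := @measurable_wgt n.
rewrite ge0_integral_lebS; last 2 first.
- by apply/measurable_EFinP; exact: measurable_wgt.
- by move=> x; rewrite lee_fin ltW ?wgt_gt0.
under eq_integral => v _.
  under eq_integral => t _.
    rewrite wgt_cons EFinM.
    over.
  rewrite ge0_integralZl//=; last 2 first.
  - exact/measurable_EFinP.
  - by rewrite lee_fin ltW// wgt_gt0.
  rewrite integral_oneDsqrV.
  over.
rewrite ge0_integralZr//=; last 3 first.
- exact/measurable_EFinP.
- by move=> x _; rewrite lee_fin ltW// wgt_gt0.
- by rewrite lee_fin pi_ge0.
by rewrite ih -EFinM exprSr.
Qed.

Lemma integrable_wgt n : (leb n).-integrable setT (EFin \o @wgt n).
Proof.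
apply: integrable_normP; first exact: measurable_wgt.
under eq_integral do rewrite ger0_norm ?ltW ?wgt_gt0//.
by rewrite integral_wgt ltry.
Qed.

Lemma onem_sum_le_prod I (s : seq I) (a : I -> R) : (forall i, 0 <= a i) ->
  1 + \sum_(i <- s) a i <= \prod_(i <- s) (1 + a i).
Proof.
move=> a0; elim: s => [|i s ih]; first by rewrite !big_nil addr0.
rewrite !big_cons; have S0 : 0 <= \sum_(j <- s) a j by exact: sumr_ge0.
have := a0 i; nra.
Qed.

End decay_weight.

Section fourier_decay_bound.
Context (R : realType) (n : nat).
Implicit Types (phi : 'rV[R]_n -> R) (x y xi : 'rV[R]_n) (i : 'I_n) (th : R).

Lemma ft_le phi xi th : test_function phi ->
  `|ft phi xi th| <= \int[leb n]_y `|phi y|.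
Proof.
move=> tp; have iphi := test_integrable tp.
have ic : (leb n).-integrable setT (EFin \o (fun y => phi y * cos (dotp y xi + th))).
  by apply: integrable_mul_cos => //; mfun.
apply: le_trans (le_normr_Rintegral measurableT ic) _.
apply: le_Rintegral => //.
- exact: (integrable_norm ic).
- exact: (integrable_norm iphi).
- by move=> y _; rewrite normrM ler_piMr// norm_cos_le1.
Qed.

(** By induction on the list, for all phi at once: a factor xi_i^2 is absorbed by differentiating
    phi twice in coordinate i. This shifts the phase by pi, which is harmless because the bound is
    uniform in the phase. *)
Lemma ft_weight (s : seq 'I_n) phi : test_function phi ->
  exists2 C, 0 <= C & forall xi th,
    \prod_(i <- s) (1 + xi ord0 i ^+ 2) * `|ft phi xi th| <= C.
Proof.
elim: s phi => [|i s ih] phi tp.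
  exists (\int[leb n]_y `|phi y|); first by apply: Rintegral_ge0 => y _.
  by move=> xi th; rewrite big_nil mul1r ft_le.
have [C C0 HC] := ih _ tp.
have [D D0 HD] := ih _ (test_partial i (test_partial i tp)).
exists (C + D); first by rewrite addr_ge0.
move=> xi th; rewrite big_cons -mulrA mulrDl mul1r lerD//.
have -> : xi ord0 i ^+ 2 * (\prod_(j <- s) (1 + xi ord0 j ^+ 2) * `|ft phi xi th|) =
    \prod_(j <- s) (1 + xi ord0 j ^+ 2) *
    `|ft (partial i (partial i phi)) xi (th + pi / 2 + pi / 2)|.
  have -> : ft (partial i (partial i phi)) xi (th + pi / 2 + pi / 2) =
      xi ord0 i ^+ 2 * ft phi xi th.
    rewrite (ft_partial _ _ _ (test_partial i tp)) (ft_partial _ _ _ tp) !addrK.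
    by rewrite mulrA -expr2.
  by rewrite normrM normrX real_normK ?num_real// mulrCA.
exact: HD.
Qed.

(** Each coordinate is listed twice in [ft_weight]: one copy of the product dominates 1 + |xi|^2,
    the other is the inverse of [wgt]. *)
Lemma ft_decay phi : test_function phi ->
  exists2 C, 0 <= C & forall xi th,
    (1 + dotp xi xi) * `|ft phi xi th| <= C * wgt xi.
Proof.
move=> tp; have [C C0 HC] := ft_weight (index_enum 'I_n ++ index_enum 'I_n) tp.
exists C => // xi th.
have wE : wgt xi = (\prod_i (1 + xi ord0 i ^+ 2))^-1 by rewrite -prodfV.
have P0 : 0 < \prod_i (1 + xi ord0 i ^+ 2) by rewrite -invr_gt0 -wE wgt_gt0.
rewrite wE ler_pdivlMr// mulrC mulrA; apply: le_trans (HC xi th).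
rewrite big_cat/= ler_wpM2r// ler_wpM2l ?(ltW P0)//.
have := @onem_sum_le_prod R _ (index_enum 'I_n) (fun i => xi ord0 i ^+ 2).
move=> H; apply: le_trans (H _); last by move=> i; exact: sqr_ge0.
by rewrite lerD2l /dotp; apply: ler_sum => i _; rewrite expr2.
Qed.

Lemma dotp_ge0 x : 0 <= dotp x x.
Proof. by apply: sumr_ge0 => i _; rewrite -expr2 sqr_ge0. Qed.

Lemma enorm_sqr x : enorm x ^+ 2 = dotp x x.
Proof. by rewrite sqr_sqrtr// dotp_ge0. Qed.

Lemma enorm_ge0 x : 0 <= enorm x. Proof. exact: sqrtr_ge0. Qed.

Lemma powR_le1D (s r : R) : 0 < s < 1 -> 0 <= r -> r `^ s <= 1 + r.
Proof.
move=> /andP[s0 s1] r0; have [r1|r1] := leP r 1.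
  apply: (@le_trans _ _ 1); last by rewrite lerDl.
  have -> : 1 = 1 `^ s :> R by rewrite powR1.
  by rewrite ge0_ler_powR ?nnegrE// ltW.
apply: (@le_trans _ _ r); last by rewrite lerDr.
by apply: ler1_powR; apply/ltW.
Qed.

Lemma ft_powR_decay (s : R) phi : 0 < s < 1 -> test_function phi ->
  exists2 C, 0 <= C & forall xi th,
    `|ft phi xi th| <= C * wgt xi /\
    enorm xi `^ (2 * s) * `|ft phi xi th| <= C * wgt xi.
Proof.
move=> s01 tp; have [C C0 HC] := ft_decay tp; exists C => // xi th.
have H := HC xi th; have d0 := dotp_ge0 xi; split; apply: le_trans H.
  by rewrite ler_peMl// lerDl.
rewrite ler_wpM2r// powRrM powR_mulrn ?enorm_ge0// enorm_sqr.
exact: powR_le1D.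
Qed.

Lemma ftE phi xi th : test_function phi ->
  ft phi xi th = cos th * fourier_re phi xi + sin th * fourier_im phi xi.
Proof.
move=> tp; have iphi := test_integrable tp.
have i1 : (leb n).-integrable setT (EFin \o (fun y => phi y * cos (dotp y xi))).
  by apply: integrable_mul_cos => //; mfun.
have i2 : (leb n).-integrable setT (EFin \o (fun y => phi y * sin (dotp y xi))).
  have : (leb n).-integrable setT
      (EFin \o (fun y => phi y * cos (dotp y xi - pi / 2))).
    by apply: integrable_mul_cos => //; mfun.
  by apply: eq_integrable => // y _ /=; rewrite cosBpihalf.
rewrite /fourier_re /fourier_im mulrN.
rewrite -lebE -RintegralZl// -RintegralZl// -RintegralB//.
- by apply: eq_Rintegral => y _; rewrite cosD; ring.
- exact: (integrable_mulrl (cos th) i1).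
- exact: (integrable_mulrl (sin th) i2).
Qed.

(** The phase - x.xi merges the real and imaginary parts into a single transform. *)
Lemma frac_laplacianE (s : R) phi x : test_function phi ->
  frac_laplacian s phi x = (2 * pi) ^- n *
    \int[leb n]_xi (enorm xi `^ (2 * s) * ft phi xi (- dotp x xi)).
Proof.
move=> tp; rewrite /frac_laplacian -lebE; congr (_ * _).
apply: eq_Rintegral => xi _; congr (_ * _).
by rewrite ftE// cosN sinN mulNr.
Qed.

Lemma measurable_ft phi : test_function phi ->
  measurable_fun setT (fun p : 'rV[R]_n * R => ft phi p.1 p.2).
Proof.
move=> tp; have mp := test_measurable tp.
apply: (@measurable_Rintegral_param _ _ _ _ _ (leb n)
  (fun (p : 'rV[R]_n * R) y => phi y * cos (dotp y p.1 + p.2))).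
by mfun.
Qed.

End fourier_decay_bound.

(** * Heat kernel and Fourier inversion *)

Section product_bound.
Context d1 d2 (T1 : measurableType d1) (T2 : measurableType d2) (R : realType).
Variable m1 : {sigma_finite_measure set T1 -> \bar R}.
Variable m2 : {sigma_finite_measure set T2 -> \bar R}.

(** The criterion by which the hypothesis of Fubini is checked when the integrand is dominated by a
    product. *)
Lemma product_bound_lty (f : T1 -> T2 -> R) (g : T1 -> R) (h : T2 -> R) :
  measurable_fun setT (fun p : T1 * T2 => f p.1 p.2) ->
  m1.-integrable setT (EFin \o g) -> m2.-integrable setT (EFin \o h) ->
  (forall x y, `|f x y| <= g x * h y) ->
  (\int[m1]_x \int[m2]_y `|f x y|%:E < +oo)%E.
Proof.
move=> mf gi hi fgh; have mg := integrable_meas gi; have mh := integrable_meas hi.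
have mfn : measurable_fun setT (fun p : T1 * T2 => `|f p.1 p.2|) by mfun.
apply: (@le_lt_trans _ _ (\int[m1]_x (`|g x|%:E * \int[m2]_y `|h y|%:E))%E).
  apply: ge0_le_integral => //.
  - by move=> x _; apply: integral_ge0 => y _; rewrite lee_fin.
  - apply: (measurable_fun_fubini_tonelli_F (fun p => `|f p.1 p.2|%:E)) => //.
    exact/measurable_EFinP.
  - by apply: emeasurable_funM; mfun.
  move=> x _; rewrite -ge0_integralZl//; last by mfun.
  apply: ge0_le_integral => //.
  - have := measurable_param_l mf x; move=> mfx; mfun.
  - by apply: emeasurable_funM; mfun.
  - by move=> y _; rewrite -EFinM lee_fin -normrM (le_trans (fgh x y))// ler_norm.
rewrite ge0_integralZr//; last 2 first.
- by mfun.
- by apply: integral_ge0 => y _; rewrite lee_fin.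
apply: lte_mul_pinfty.
- by apply: integral_ge0 => y _; rewrite lee_fin.
- rewrite ge0_fin_numE; first exact: integrable_norm_lty.
  by apply: integral_ge0 => y _; rewrite lee_fin.
- exact: integrable_norm_lty.
Qed.

End product_bound.

Section heat_kernel.
Context (R : realType) (n : nat).
Implicit Types (t : R) (x y z xi : 'rV[R]_n) (phi : 'rV[R]_n -> R).

(** The prefactor is (4 pi t)^(- n / 2), written so that it cancels the [Num.sqrt (pi / a) ^+ n] of
    the Gaussian integral at a = 1 / (4 t). *)
Definition heat t z : R :=
  (Num.sqrt (4 * pi * t)) ^- n * expR (- ((4 * t)^-1 * dotp z z)).

Lemma heat_ge0 t z : 0 <= heat t z.
Proof. by rewrite mulr_ge0 ?expR_ge0// invr_ge0 exprn_ge0// sqrtr_ge0. Qed.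

Lemma measurable_heat t : measurable_fun setT (heat t).
Proof. by rewrite /heat; mfun. Qed.

Let quarter_gt0 t : 0 < t -> 0 < (4 * t)^-1.
Proof. by move=> t0; rewrite invr_gt0 mulr_gt0. Qed.

Let sqrt_gt0 t : 0 < t -> 0 < Num.sqrt (4 * pi * t).
Proof. by move=> t0; rewrite sqrtr_gt0 !mulr_gt0 ?pi_gt0. Qed.

Let sqrtE t : 0 < t -> Num.sqrt (pi / (4 * t)^-1) = Num.sqrt (4 * pi * t).
Proof. by move=> t0; rewrite invrK; congr Num.sqrt; ring. Qed.

Lemma integrable_heat t : 0 < t -> (leb n).-integrable setT (EFin \o heat t).
Proof.
by move=> t0; apply: integrable_mulrl; apply: integrable_gauss; exact: quarter_gt0.
Qed.

Lemma heat_fourier t xi th : 0 < t ->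
  \int[leb n]_x (heat t x * cos (dotp x xi + th)) =
  expR (- (t * dotp xi xi)) * cos th.
Proof.
move=> t0.
have E x : heat t x * cos (dotp x xi + th) = (Num.sqrt (4 * pi * t)) ^- n *
    (expR (- ((4 * t)^-1 * dotp x x)) * cos (dotp x xi + th)) by rewrite mulrA.
under eq_Rintegral => x _ do rewrite E.
rewrite RintegralZl//; last first.
  apply: integrable_mul_cos; first by mfun.
  by apply: integrable_gauss; exact: quarter_gt0.
rewrite gauss_fourier ?quarter_gt0// sqrtE// !mulrA mulVf ?mul1r; last first.
  by rewrite expf_neq0// gt_eqF// sqrt_gt0.
congr (expR (- _) * _); field; by rewrite gt_eqF.
Qed.

Lemma Rintegral_heat t : 0 < t -> \int[leb n]_x heat t x = 1.
Proof.
move=> t0; have := heat_fourier 0 0 t0.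
rewrite cos0 mulr1 (_ : dotp 0 0 = 0); last by rewrite /dotp big1// => i _; rewrite mxE mul0r.
rewrite mulr0 oppr0 expR0 => <-; apply: eq_Rintegral => x _.
by rewrite (_ : dotp x 0 = 0) ?addr0 ?cos0 ?mulr1// /dotp big1// => i _; rewrite mxE mulr0.
Qed.

Lemma integral_heat t : 0 < t -> (\int[leb n]_x (heat t x)%:E = 1)%E.
Proof.
by move=> t0; rewrite -EFin_Rintegral ?Rintegral_heat//; exact: integrable_heat.
Qed.

Lemma heatN t z : heat t (- z) = heat t z.
Proof. by rewrite /heat dotpNl dotpC dotpNl opprK. Qed.

Lemma heat_conv_cos t xi y th : 0 < t ->
  \int[leb n]_x (heat t (x - y) * cos (dotp x xi + th)) =
  expR (- (t * dotp xi xi)) * cos (dotp y xi + th).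
Proof.
move=> t0; have mh := measurable_heat t.
rewrite -(Rintegral_lebD y (f := fun x => heat t (x - y) * cos (dotp x xi + th))).
  rewrite -heat_fourier//; apply: eq_Rintegral => x _.
  by rewrite addrK dotpDl addrA.
by mfun.
Qed.

(** As a function of x, the transform with phase - x.xi is a combination of cos (x.xi) and sin
    (x.xi), and the heat kernel multiplies both by the same Gaussian factor. *)
Lemma heat_conv_ft t phi xi y : 0 < t -> test_function phi ->
  \int[leb n]_x (heat t (x - y) * ft phi xi (- dotp x xi)) =
  expR (- (t * dotp xi xi)) * ft phi xi (- dotp y xi).
Proof.
move=> t0 tp; have mh := measurable_heat t.
have ih : (leb n).-integrable setT (EFin \o (fun x => heat t (x - y))).
  by apply: (integrable_lebD (- y)); exact: integrable_heat.
have E x : heat t (x - y) * ft phi xi (- dotp x xi) =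
    fourier_re phi xi * (heat t (x - y) * cos (dotp x xi + 0)) +
    - fourier_im phi xi * (heat t (x - y) * cos (dotp x xi + (- (pi / 2)))).
  by rewrite ftE// cosN sinN cosBpihalf addr0; ring.
under eq_Rintegral => x _ do rewrite E.
have i1 th : (leb n).-integrable setT
    (EFin \o (fun x => heat t (x - y) * cos (dotp x xi + th))).
  by apply: integrable_mul_cos => //; mfun.
rewrite RintegralD//; last 2 first.
- exact: (integrable_mulrl (fourier_re phi xi) (i1 0)).
- exact: (integrable_mulrl (- fourier_im phi xi) (i1 (- (pi / 2)))).
rewrite !RintegralZl// !heat_conv_cos// ftE// cosN sinN cosBpihalf addr0; ring.
Qed.

(** With u = |z|^2 / (8 t), half of the exponent absorbs the square by u exp (- u) <= 1, and the
    other half is the exponent at time 2 t. The power of sqrt 2 corrects the normalization. *)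
Lemma heat_moment t z : 0 < t ->
  dotp z z * heat t z <= 8 * t * Num.sqrt 2 ^+ n * heat (2 * t) z.
Proof.
move=> t0; rewrite /heat; set D := dotp z z.
have D0 : 0 <= D by exact: dotp_ge0.
have t80 : 0 < 8 * t by rewrite mulr_gt0.
have -> : Num.sqrt (4 * pi * (2 * t)) = Num.sqrt 2 * Num.sqrt (4 * pi * t).
  by rewrite -sqrtrM//; congr Num.sqrt; ring.
rewrite exprMn (invfM (Num.sqrt 2 ^+ n)).
set S := Num.sqrt (4 * pi * t) ^- n.
have S0 : 0 <= S by rewrite invr_ge0 exprn_ge0// sqrtr_ge0.
have s20 : Num.sqrt 2 ^+ n != 0 :> R by rewrite expf_neq0// gt_eqF// sqrtr_gt0.
have -> : 8 * t * Num.sqrt 2 ^+ n * (Num.sqrt 2 ^- n * S *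
    expR (- ((4 * (2 * t))^-1 * D))) = S * (8 * t * expR (- ((8 * t)^-1 * D))).
  have -> : (4 * (2 * t))^-1 = (8 * t)^-1 by congr (_^-1); ring.
  by move: (expR _) => E; field.
rewrite mulrCA ler_wpM2l// -ler_pdivrMl//.
have -> : - ((4 * t)^-1 * D) = - ((8 * t)^-1 * D) - ((8 * t)^-1 * D).
  by field; rewrite gt_eqF.
rewrite expRD; set F := expR _.
have -> : (8 * t)^-1 * (D * (F * F)) = ((8 * t)^-1 * D * F) * F.
  by rewrite !mulrA.
rewrite ler_piMl ?expR_ge0// -ler_pdivlMr ?expR_gt0//.
rewrite div1r -expRN opprK; apply: le_trans (expR_ge1Dx _).
by rewrite lerDr.
Qed.

(** The Gaussian factor makes the double integral absolutely convergent; after the exchange the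
    integral over xi is the transform of a Gaussian. *)
Lemma heat_fourier_inversion t phi x : 0 < t -> test_function phi ->
  (2 * pi) ^- n *
    \int[leb n]_xi (expR (- (t * dotp xi xi)) * ft phi xi (- dotp x xi)) =
  \int[leb n]_y (phi y * heat t (y - x)).
Proof.
move=> t0 tp; have mp := test_measurable tp; have ip := test_integrable tp.
have mf : measurable_fun setT (fun p : 'rV[R]_n * 'rV[R]_n =>
    expR (- (t * dotp p.1 p.1)) * (phi p.2 * cos (dotp p.2 p.1 + - dotp x p.1))).
  by mfun.
have fy : (\int[leb n]_xi \int[leb n]_y
   `|expR (- (t * dotp xi xi)) * (phi y * cos (dotp y xi + - dotp x xi))|%:E < +oo)%E.
  apply: (product_bound_lty (f := fun xi y => expR (- (t * dotp xi xi)) *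
    (phi y * cos (dotp y xi + - dotp x xi))) mf (integrable_gauss n t0)
    (integrable_norm ip)) => xi y.
  rewrite normrM (ger0_norm (expR_ge0 _)) ler_wpM2l ?expR_ge0//.
  by rewrite normrM ler_piMr// norm_cos_le1.
have E1 xi : expR (- (t * dotp xi xi)) * ft phi xi (- dotp x xi) =
    \int[leb n]_y (expR (- (t * dotp xi xi)) * (phi y * cos (dotp y xi + - dotp x xi))).
  by rewrite RintegralZl//; apply: integrable_mul_cos => //; mfun.
under eq_Rintegral => xi _ do rewrite E1.
rewrite (@Rintegral_fubini _ _ _ _ _ (leb n) (leb n) (fun xi y =>
  expR (- (t * dotp xi xi)) * (phi y * cos (dotp y xi + - dotp x xi))))//.
have E2 y : \int[leb n]_xi (expR (- (t * dotp xi xi)) *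
      (phi y * cos (dotp y xi + - dotp x xi))) =
    (2 * pi) ^+ n * (phi y * heat t (y - x)).
  have -> : (fun xi => expR (- (t * dotp xi xi)) *
      (phi y * cos (dotp y xi + - dotp x xi))) =
    (fun xi => phi y * (expR (- (t * dotp xi xi)) * cos (dotp xi (y - x) + 0))).
    apply/funext => xi; rewrite mulrCA; congr (_ * (_ * cos _)).
    by rewrite addr0 (dotpC xi) dotpDl dotpNl.
  rewrite RintegralZl//; last first.
    by apply: integrable_mul_cos; [mfun|exact: integrable_gauss].
  rewrite gauss_fourier// cos0 mulr1 [in RHS]mulrCA; congr (_ * _).
  rewrite /heat mulrA; congr (_ * expR (- _)); last first.
    by rewrite mulrC.
  (* This identity is the origin of the factor (2 pi)^n: it converts the Gaussian constant in xi
     into the prefactor of the heat kernel. *)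
  have -> : Num.sqrt (pi / t) = 2 * pi / Num.sqrt (4 * pi * t).
    have P : 0 <= 2 * pi :> R by rewrite mulr_ge0// pi_ge0.
    rewrite -[2 * pi in RHS](ger0_norm P) -sqrtr_sqr -sqrtrV ?mulr_ge0 ?pi_ge0 ?ltW// -sqrtrM ?sqr_ge0//.
    have H (p : R) : p != 0 -> p / t = (2 * p) ^+ 2 / (4 * p * t).
      by move=> p0; field; rewrite p0 gt_eqF.
    by congr Num.sqrt; apply: H; rewrite gt_eqF ?pi_gt0.
  by rewrite expr_div_n.
under eq_Rintegral => y _ do rewrite E2.
rewrite RintegralZl//.
  by rewrite mulrA mulVf ?mul1r// expf_neq0// gt_eqF// mulr_gt0 ?pi_gt0.
have [B B0 HB] := test_bounded tp.
have ih : (leb n).-integrable setT (EFin \o (fun y => B * heat t (y - x))).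
  apply: integrable_mulrl.
  by apply: (integrable_lebD (- x)); exact: integrable_heat.
have mh := measurable_heat t.
apply: integrable_le ih _; first by mfun.
by move=> y; rewrite normrM (ger0_norm (heat_ge0 _ _)) ler_wpM2r ?heat_ge0.
Qed.

End heat_kernel.

Section fourier_inversion.
Context (R : realType) (n : nat).
Implicit Types (t : R) (x y z xi : 'rV[R]_n) (phi : 'rV[R]_n -> R).

Lemma norm_sqr_le_dotp z : `|z| ^+ 2 <= dotp z z.
Proof.
have -> : `|z| = mx_norm z by [].
have [->|z0] := eqVneq (mx_norm z) 0; first by rewrite expr0n dotp_ge0.
have [[i j] /= ->] := mx_norm_neq0 z0; rewrite (ord1 i) real_normK ?num_real//.
rewrite /dotp (bigD1 j)//= -expr2 lerDl.
by apply: sumr_ge0 => k _; rewrite -expr2 sqr_ge0.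
Qed.

(** Continuity at x in a form that can be integrated against the heat kernel, whose second moment is
    of order t. For z of size at least d, the bound 2 B is at most 2 B |z|^2 / d^2. *)
Lemma test_modulus phi x (eta : R) : test_function phi -> 0 < eta ->
  exists2 D, 0 <= D & forall z, `|phi (x + z) - phi x| <= eta + D * dotp z z.
Proof.
move=> tp eta0; have cp : phi y @[y --> x] --> phi x by exact: test_continuous tp x.
have [B B0 HB] := test_bounded tp.
have /nbhs_ballP[d /= d0 Hd] :
    \forall y \near x, `|phi x - phi y| <= eta by exact: cvgr_dist_le cp _ eta0.
exists (2 * B / d ^+ 2); first by rewrite !mulr_ge0// invr_ge0 exprn_ge0// ltW.
move=> z; have [zd|zd] := ltP `|z| d.
  have -> : `|phi (x + z) - phi x| = `|phi x - phi (x + z)| by rewrite distrC.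
  apply: (@le_trans _ _ eta).
    apply: Hd; rewrite -ball_normE/=.
    by rewrite opprD addrA subrr add0r normrN.
  by rewrite lerDl !mulr_ge0 ?dotp_ge0// invr_ge0 exprn_ge0// ltW.
apply: (@le_trans _ _ (2 * B)).
  by rewrite (le_trans (ler_normB _ _))// mulr_natl mulr2n lerD.
apply: (@le_trans _ _ (2 * B / d ^+ 2 * dotp z z)); last first.
  by rewrite lerDr ltW.
rewrite -mulrA ler_peMr ?mulr_ge0// mulrC ler_pdivlMr ?exprn_gt0// mul1r.
apply: le_trans (norm_sqr_le_dotp z).
by rewrite ler_pXn2r ?nnegrE ?(ltW d0).
Qed.

Lemma integrable_test_heat t phi x : 0 < t -> test_function phi ->
  (leb n).-integrable setT (EFin \o (fun y => phi y * heat t (y - x))).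
Proof.
move=> t0 tp; have [B B0 HB] := test_bounded tp.
have mp := test_measurable tp; have mh := @measurable_heat R n t.
have ih : (leb n).-integrable setT (EFin \o (fun y => B * heat t (y - x))).
  apply: integrable_mulrl.
  by apply: (integrable_lebD (- x)); exact: integrable_heat.
apply: integrable_le ih _; first by mfun.
by move=> y; rewrite normrM (ger0_norm (heat_ge0 _ _)) ler_wpM2r ?heat_ge0.
Qed.

(** In the bound of [test_modulus], eta is kept by the total mass one and the quadratic term becomes
    a multiple of t by [heat_moment]. *)
Lemma heat_approx phi x (eta : R) : test_function phi -> 0 < eta ->
  exists D, forall t, 0 < t ->
    `|\int[leb n]_y (phi y * heat t (y - x)) - phi x| <= eta + D * t.
Proof.
move=> tp eta0; have [D D0 HD] := test_modulus x tp eta0.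
exists (D * (8 * Num.sqrt 2 ^+ n)) => t t0.
have mp := test_measurable tp; have mh := @measurable_heat R n t.
have t20 : 0 < 2 * t by rewrite mulr_gt0.
have ih := @integrable_heat R n t t0.
have ih2 := @integrable_heat R n _ t20.
have -> : \int[leb n]_y (phi y * heat t (y - x)) =
    \int[leb n]_z (phi (x + z) * heat t z).
  rewrite -(Rintegral_lebD x (f := fun y => phi y * heat t (y - x))); last by mfun.
  by apply: eq_Rintegral => z _; rewrite addrK addrC.
have i1 : (leb n).-integrable setT (EFin \o (fun z => phi (x + z) * heat t z)).
  have := integrable_lebD x (integrable_test_heat x t0 tp).
  by apply: eq_integrable => // z _ /=; rewrite addrK addrC.
have -> : phi x = \int[leb n]_z (phi x * heat t z).
  by rewrite RintegralZl// Rintegral_heat// mulr1.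
have i2 : (leb n).-integrable setT (EFin \o (fun z => phi x * heat t z)).
  exact: integrable_mulrl.
have i3 : (leb n).-integrable setT
    (EFin \o (fun z => phi (x + z) * heat t z - phi x * heat t z)).
  have := integrableB measurableT i1 i2.
  by apply: eq_integrable => // z _; rewrite /= EFinB.
rewrite -RintegralB//.
pose G z := eta * heat t z + (D * (8 * t * Num.sqrt 2 ^+ n)) * heat (2 * t) z.
have iG1 : (leb n).-integrable setT (EFin \o (fun z => eta * heat t z)).
  exact: integrable_mulrl.
have iG2 : (leb n).-integrable setT
    (EFin \o (fun z => (D * (8 * t * Num.sqrt 2 ^+ n)) * heat (2 * t) z)).
  by apply: integrable_mulrl; exact: integrable_heat.
have iG : (leb n).-integrable setT (EFin \o G) by exact: integrable_addr.
apply: (@le_trans _ _ (\int[leb n]_z G z)); last first.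
  rewrite RintegralD// (_ : \int[leb n]_z (eta * heat t z) = eta); last first.
    by rewrite RintegralZl// Rintegral_heat// mulr1.
  rewrite lerD2l (RintegralZl _ measurableT ih2)// Rintegral_heat// mulr1.
  by rewrite le_eqVlt; apply/orP; left; apply/eqP; ring.
apply: le_trans (le_normr_Rintegral measurableT i3) _.
apply: le_Rintegral => //; first exact: (integrable_norm i3).
move=> z _; rewrite -mulrBl normrM (ger0_norm (heat_ge0 _ _)).
apply: (@le_trans _ _ ((eta + D * dotp z z) * heat t z)).
  by rewrite ler_wpM2r ?heat_ge0.
rewrite mulrDl lerD2l -[leLHS]mulrA -[leRHS]mulrA ler_wpM2l//.
exact: heat_moment.
Qed.

Lemma measurable_ftx phi : test_function phi ->
  measurable_fun setT (fun p : 'rV[R]_n * 'rV[R]_n => ft phi p.2 (- dotp p.1 p.2)).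
Proof.
move=> tp; apply: (measurableT_comp (measurable_ft tp)
  (g := fun p : 'rV[R]_n * 'rV[R]_n => (p.2, - dotp p.1 p.2))).
by apply: measurable_fun_pair; mfun.
Qed.

Lemma measurable_ft_l phi x : test_function phi ->
  measurable_fun setT (fun xi => ft phi xi (- dotp x xi)).
Proof.
move=> tp; exact: (measurable_param_l
  (f := fun x xi => ft phi xi (- dotp x xi)) (measurable_ftx tp)).
Qed.

Lemma integrable_ft phi x : test_function phi ->
  (leb n).-integrable setT (EFin \o (fun xi => ft phi xi (- dotp x xi))).
Proof.
(* An arbitrary exponent in (0, 1), as the bound extracted below is the one without the power. *)
move=> tp; have half : (0 < (2^-1 : R) < 1)%R by rewrite invr_gt0 ltr0n invf_lt1 ?ltr1n ?ltr0n.
have [C C0 HC] := ft_powR_decay half tp.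
apply: integrable_le (integrable_mulrl C (integrable_wgt R n)) _.
  exact: measurable_ft_l.
by move=> xi; have [] := HC xi (- dotp x xi).
Qed.

(** The factor exp (- t |xi|^2) with t = 1 / (k + 1) regularizes the integral. Its limit is computed
    by dominated convergence on the Fourier side and by [heat_approx] on the other. *)
Lemma fourier_inversion phi x : test_function phi ->
  (2 * pi) ^- n * \int[leb n]_xi ft phi xi (- dotp x xi) = phi x.
Proof.
move=> tp; pose h (k : nat) : R := k.+1%:R^-1.
have h0 k : 0 < h k by rewrite invr_gt0.
have hc : h k @[k --> \oo] --> 0 by exact: cvg_harmonic.
have mft := measurable_ft_l x tp.
pose u k := (2 * pi) ^- n *
    \int[leb n]_xi (expR (- (h k * dotp xi xi)) * ft phi xi (- dotp x xi)).
have c1 : u k @[k --> \oo] -->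
    (2 * pi) ^- n * \int[leb n]_xi ft phi xi (- dotp x xi).
  apply: cvgM; first exact: cvg_cst.
  apply: (@Rintegral_dominated_cvg _ _ _ _ (fun k xi =>
    expR (- (h k * dotp xi xi)) * ft phi xi (- dotp x xi)) _
    (fun xi => `|ft phi xi (- dotp x xi)|)).
  - by move=> k; mfun.
  - move=> xi; rewrite -[X in _ --> X]mul1r; apply: cvgM; last exact: cvg_cst.
    have c0 : - (h k * dotp xi xi) @[k --> \oo] --> (0 : R).
      by rewrite -oppr0 -(mul0r (dotp xi xi)); apply: cvgN; apply: cvgM => //; exact: cvg_cst.
    by have := cvg_comp _ _ c0 (@continuous_expR R 0); rewrite expR0.
  - exact: integrable_norm (integrable_ft x tp).
  - move=> k xi; rewrite normrM (ger0_norm (expR_ge0 _)) ler_piMl//.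
    by rewrite expR_le1 oppr_le0 mulr_ge0 ?dotp_ge0// ltW.
have c2 : u k @[k --> \oo] --> phi x.
  apply/cvgrPdist_le => e e0.
  have e20 : 0 < e / 2 by rewrite divr_gt0.
  have [D HD] := heat_approx x tp e20.
  have cD : D * h k @[k --> \oo] --> 0.
    by rewrite -(mulr0 D); apply: cvgM => //; exact: cvg_cst.
  have : \forall k \near \oo, D * h k <= e / 2 by exact: (cvgr_le _ cD _ e20).
  apply: filterS => k Dk.
  rewrite distrC /u heat_fourier_inversion//.
  by rewrite (le_trans (HD _ (h0 k)))// [leRHS](splitr e) lerD2l.
by rewrite -(cvg_lim _ c1)// (cvg_lim _ c2).
Qed.

End fourier_inversion.

(** * The fractional Laplacian of a test function *)

Section more_integral_tools.
Context (R : realType).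

Lemma le_abs_Rintegral d (T : measurableType d) (m : {measure set T -> \bar R})
    (f : T -> R) : measurable_fun setT f ->
  (`|\int[m]_x f x|%:E <= \int[m]_x `|f x|%:E)%E.
Proof.
move=> mf; apply: (@le_trans _ _ `|\int[m]_x (f x)%:E|%E).
  by rewrite /Rintegral; case: (\int[m]_x (f x)%:E)%E => //= ; rewrite normr0 leey.
by apply: le_abse_integral => //; exact/measurable_EFinP.
Qed.

Lemma tonelli3 d1 d2 d3 (T1 : measurableType d1) (T2 : measurableType d2)
    (T3 : measurableType d3) (m1 : {sigma_finite_measure set T1 -> \bar R})
    (m2 : {sigma_finite_measure set T2 -> \bar R})
    (m3 : {sigma_finite_measure set T3 -> \bar R}) (f : T1 -> T2 -> T3 -> R) :
  measurable_fun setT (fun p : (T1 * T2) * T3 => f p.1.1 p.1.2 p.2) ->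
  (forall x y z, 0 <= f x y z) ->
  (\int[m1]_x \int[m2]_y \int[m3]_z (f x y z)%:E =
   \int[m2]_y \int[m3]_z \int[m1]_x (f x y z)%:E)%E.
Proof.
move=> mf f0.
rewrite (fubini_tonelli (m1 := m1) (m2 := m2)
  (fun p => \int[m3]_z (f p.1 p.2 z)%:E)%E); last 2 first.
- apply: (measurable_fun_fubini_tonelli_F
    (fun q : (T1 * T2) * T3 => (f q.1.1 q.1.2 q.2)%:E)).
    exact/measurable_EFinP.
  by move=> q; rewrite lee_fin.
- by move=> p; apply: integral_ge0 => z _; rewrite lee_fin.
apply: eq_integral => y _; apply: tonelli => //.
apply: (measurableT_comp mf (g := fun q : T1 * T3 => ((q.1, y), q.2))).
apply: measurable_fun_pair; last exact: measurable_snd.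
by apply: measurable_fun_pair; [exact: measurable_fst|exact: measurable_cst].
Qed.

End more_integral_tools.

Section heat_exp.
Context (R : realType) (n : nat).
Implicit Types (tau : R) (x y z xi : 'rV[R]_n).

Lemma heat_expE tau z : heat (expR tau) z = Num.sqrt (4 * pi) ^- n *
  (expR (- (n%:R / 2 * tau)) * expR (- (4^-1 * expR (- tau) * dotp z z))).
Proof.
have p0 : 0 <= 4 * pi :> R by rewrite mulr_ge0// pi_ge0.
rewrite /heat mulrA; congr (_ * expR (- (_ * _))).
  rewrite sqrtrM// exprMn invfM; congr (_ * _).
  have -> : Num.sqrt (expR tau) = expR (tau / 2).
    rewrite -[LHS](_ : Num.sqrt (expR (tau / 2) ^+ 2) = _); last first.
      by rewrite -expRM_natl mulrC divfK.
    by rewrite sqrtr_sqr ger0_norm ?expR_ge0.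
  by rewrite -expRM_natl -expRN; congr expR; ring.
by rewrite invfM expRN.
Qed.

(** Joint measurability in time and space, as Tonelli requires; in the exponential form the square
    root and the inverse of the time disappear. *)
Lemma measurable_heat_exp d (T : measurableType d) (f : T -> R) (g : T -> 'rV[R]_n) :
  measurable_fun setT f -> measurable_fun setT g ->
  measurable_fun setT (fun t => heat (expR (f t)) (g t)).
Proof.
move=> mf mg.
have -> : (fun t => heat (expR (f t)) (g t)) = (fun t => Num.sqrt (4 * pi) ^- n *
    (expR (- (n%:R / 2 * f t)) *
     expR (- (4^-1 * expR (- f t) * dotp (g t) (g t))))).
  by apply/funext => t; exact: heat_expE.
by mfun.
Qed.

End heat_exp.

Ltac mfun_heat :=
  repeat first [match goal with
  | |- measurable_fun _ (fun x => heat (expR (@?f x)) (@?g x)) =>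
      apply: (measurable_heat_exp (f := f) (g := g))
  end | mfun1].

Section fractional_laplacian_of_test.
Context (R : realType) (n : nat) (s : R).
Hypothesis s01 : 0 < s < 1.
Local Notation L := (@lebesgue_measure R).
Implicit Types (phi : 'rV[R]_n -> R) (x y z xi : 'rV[R]_n).

Lemma enorm_powR2 x (p : R) : enorm x `^ (2 * p) = dotp x x `^ p.
Proof. by rewrite powRrM powR_mulrn ?enorm_ge0// enorm_sqr. Qed.

Lemma measurable_frac_laplacian phi : test_function phi ->
  measurable_fun setT (frac_laplacian s phi).
Proof.
move=> tp.
have -> : frac_laplacian s phi = (fun x => (2 * pi) ^- n *
    \int[leb n]_xi (enorm xi `^ (2 * s) * ft phi xi (- dotp x xi))).
  by apply/funext => x; rewrite frac_laplacianE.
apply: measurable_funM; first exact: measurable_cst.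
have mft := measurable_ftx tp.
apply: (@measurable_Rintegral_param _ _ _ _ _ (leb n)
  (fun x xi => enorm xi `^ (2 * s) * ft phi xi (- dotp x xi))).
by apply: measurable_funM => //; mfun.
Qed.

Lemma integrable_ft_powR phi x : test_function phi ->
  (leb n).-integrable setT
    (EFin \o (fun xi => enorm xi `^ (2 * s) * ft phi xi (- dotp x xi))).
Proof.
move=> tp; have [C C0 HC] := ft_powR_decay s01 tp; have mft := measurable_ft_l x tp.
apply: integrable_le (integrable_mulrl C (integrable_wgt R n)) _; first by mfun.
move=> xi; rewrite normrM ger0_norm ?powR_ge0//.
by have [] := HC xi (- dotp x xi).
Qed.

Lemma frac_laplacian_bounded phi : test_function phi ->
  exists2 B, 0 <= B & forall x, `|frac_laplacian s phi x| <= B.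
Proof.
move=> tp; have [C C0 HC] := ft_powR_decay s01 tp.
have p0 : 0 <= (2 * pi) ^- n :> R by rewrite invr_ge0 exprn_ge0// mulr_ge0// pi_ge0.
have w0 : 0 <= \int[leb n]_xi @wgt R n xi.
  by apply: Rintegral_ge0 => xi _; exact: ltW (wgt_gt0 xi).
exists ((2 * pi) ^- n * (C * \int[leb n]_xi @wgt R n xi)); first by rewrite !mulr_ge0.
move=> x; rewrite frac_laplacianE// normrM ger0_norm// ler_wpM2l//.
have ii := integrable_ft_powR x tp.
apply: le_trans (le_normr_Rintegral measurableT ii) _.
rewrite -RintegralZl//; last exact: integrable_wgt.
apply: le_Rintegral => //.
- exact: (integrable_norm ii).
- exact: (integrable_mulrl C (integrable_wgt R n)).
- move=> xi _; rewrite normrM ger0_norm ?powR_ge0//.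
  by have [] := HC xi (- dotp x xi).
Qed.

Let c := frac_const s.

(* |xi|^(2 s) is a multiple of \int_0^oo t^(- s - 1) (1 - exp (- t |xi|^2)) dt, and
   the multiplier exp (- t |xi|^2) is convolution with the heat kernel. *)
Lemma frac_laplacian_heat phi x : test_function phi ->
  c * frac_laplacian s phi x = \int[L]_tau (expR (- (s * tau)) *
    (phi x - \int[leb n]_y (phi y * heat (expR tau) (y - x)))).
Proof.
move=> tp; have mft := measurable_ft_l x tp.
set k := (2 * pi) ^- n : R.
pose F xi := ft phi xi (- dotp x xi); have mF : measurable_fun setT F by [].
pose f xi tau := expR (- (s * tau)) * (1 - expR (- (dotp xi xi * expR tau))) *
  (k * F xi).
have mf : measurable_fun setT (fun p : 'rV[R]_n * R => f p.1 p.2).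
  by rewrite /f; mfun.
have e0 xi tau : 0 <= expR (- (s * tau)) * (1 - expR (- (dotp xi xi * expR tau))).
  by rewrite mulr_ge0 ?expR_ge0// onem_expRN_ge0// mulr_ge0 ?dotp_ge0 ?expR_ge0.
have me xi : measurable_fun setT
    (fun tau => expR (- (s * tau)) * (1 - expR (- (dotp xi xi * expR tau)))).
  by mfun.
have c0 : 0 < c by exact: frac_const_gt0.
have ie xi : (\int[L]_tau (expR (- (s * tau)) *
    (1 - expR (- (dotp xi xi * expR tau))))%:E = (enorm xi `^ (2 * s) * c)%:E)%E.
  by rewrite frac_const_scale ?dotp_ge0// enorm_powR2.
have iet xi : L.-integrable setT (EFin \o (fun tau => expR (- (s * tau)) *
    (1 - expR (- (dotp xi xi * expR tau))))).
  apply: integrable_normP ; first exact: me.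
  by under eq_integral do rewrite ger0_norm//; rewrite ie ltry.
have fy : (\int[leb n]_xi \int[L]_tau `|f xi tau|%:E < +oo)%E.
  apply: (@le_lt_trans _ _ (\int[leb n]_xi
      `|c * (k * (enorm xi `^ (2 * s) * ft phi xi (- dotp x xi)))|%:E)%E); last first.
    apply: integrable_norm_lty; do 2 apply: integrable_mulrl.
    exact: integrable_ft_powR.
  rewrite le_eqVlt; apply/orP; left; apply/eqP; apply: eq_integral => xi _.
  under eq_integral do rewrite normrM ger0_norm// EFinM.
  rewrite ge0_integralZr//=; last 2 first.
  - by apply/measurable_EFinP; exact: me.
  - by move=> tau _; rewrite lee_fin.
  rewrite ie -EFinM !normrM (ger0_norm (ltW c0)) (@ger0_norm _ (powR _ _)) ?powR_ge0//.
  by congr EFin; ring.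
have fub := Rintegral_fubini (m1 := leb n) (m2 := L) mf fy.
(* Integrating first in tau restores the multiplier |xi|^(2 s), up to the factor c. *)
have E1 xi : \int[L]_tau f xi tau =
    c * (k * (enorm xi `^ (2 * s) * ft phi xi (- dotp x xi))).
  have ieR : \int[L]_tau (expR (- (s * tau)) *
      (1 - expR (- (dotp xi xi * expR tau)))) = enorm xi `^ (2 * s) * c.
    by rewrite /Rintegral ie.
  by rewrite RintegralZr// ieR /F; ring.
(* Integrating first in xi uses inversion twice: plain for the constant 1, regularized for the
   exponential. *)
have E2 tau : \int[leb n]_xi f xi tau = expR (- (s * tau)) *
    (phi x - \int[leb n]_y (phi y * heat (expR tau) (y - x))).
  have i1 := integrable_ft x tp.
  have i2 : (leb n).-integrable setT (EFin \o
      (fun xi => expR (- (expR tau * dotp xi xi)) * ft phi xi (- dotp x xi))).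
    apply: integrable_le (integrable_norm i1) _; first by mfun.
    move=> xi; rewrite normrM ger0_norm ?expR_ge0// ler_piMl// expR_le1 oppr_le0.
    by rewrite mulr_ge0 ?expR_ge0 ?dotp_ge0.
  rewrite -heat_fourier_inversion ?expR_gt0// -{1}(fourier_inversion x tp).
  have i3 : (leb n).-integrable setT (EFin \o (fun xi => ft phi xi (- dotp x xi) -
      expR (- (expR tau * dotp xi xi)) * ft phi xi (- dotp x xi))).
    have := integrableB measurableT i1 i2.
    by apply: eq_integrable => // xi _; rewrite /= EFinB.
  rewrite -mulrBr mulrA -RintegralB// -RintegralZl//.
  by apply: eq_Rintegral => xi _; rewrite /f /F /k [dotp xi xi * _]mulrC; ring.
move: fub; under eq_Rintegral => xi _ do rewrite E1.
under [in RHS]eq_Rintegral => tau _ do rewrite E2.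
have ii := integrable_ft_powR x tp.
rewrite RintegralZl//; last exact: (integrable_mulrl k ii).
by rewrite RintegralZl// frac_laplacianE.
Qed.

End fractional_laplacian_of_test.

(** * Integrability of (- Delta)^s phi *)

Section integrability.
Context (R : realType) (n : nat) (s : R).
Hypothesis s01 : 0 < s < 1.
Local Notation L := (@lebesgue_measure R).
Implicit Types (phi : 'rV[R]_n -> R) (x y z xi : 'rV[R]_n).
Let c := frac_const s.

(** Once phi x is 0, no cancellation at small times is left to exploit, and absolute values may be
    taken inside the integral. *)
Lemma frac_laplacian_off_support phi x : test_function phi -> phi x = 0 ->
  (`|c * frac_laplacian s phi x|%:E <= \int[L]_tau \int[leb n]_y
     (expR (- (s * tau)) * `|phi y| * heat (expR tau) (y - x))%:E)%E.
Proof.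
move=> tp px; have mp := test_measurable tp; rewrite frac_laplacian_heat// px.
have mh : measurable_fun setT
    (fun p : R * 'rV[R]_n => phi p.2 * heat (expR p.1) (p.2 - x)).
  by mfun_heat.
have mH : measurable_fun setT
    (fun tau : R => \int[leb n]_y (phi y * heat (expR tau) (y - x))).
  exact: (@measurable_Rintegral_param _ _ _ _ _ (leb n)
    (fun tau y => phi y * heat (expR tau) (y - x)) mh).
have mN : measurable_fun setT (fun p : R * 'rV[R]_n =>
    expR (- (s * p.1)) * `|phi p.2| * heat (expR p.1) (p.2 - x)).
  by mfun_heat.
apply: le_trans (le_abs_Rintegral _ _) _; first by mfun.
apply: ge0_le_integral => //.
- by apply/measurable_EFinP; mfun.
- apply: (measurable_fun_fubini_tonelli_F (fun p : R * 'rV[R]_n =>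
    (expR (- (s * p.1)) * `|phi p.2| * heat (expR p.1) (p.2 - x))%:E)).
    exact/measurable_EFinP.
  by move=> p; rewrite lee_fin !mulr_ge0 ?expR_ge0 ?heat_ge0.
move=> tau _; rewrite sub0r normrM normrN (ger0_norm (expR_ge0 _)) EFinM.
have mhx : measurable_fun setT (fun y => phi y * heat (expR tau) (y - x)).
  by have mht := @measurable_heat R n (expR tau); mfun.
apply: (@le_trans _ _ ((expR (- (s * tau)))%:E *
    \int[leb n]_y `|phi y * heat (expR tau) (y - x)|%:E)%E).
  by rewrite lee_pmul2l ?lte_fin ?expR_gt0//; exact: le_abs_Rintegral.
rewrite -ge0_integralZl//=; last by mfun_heat.
rewrite le_eqVlt; apply/orP; left; apply/eqP; apply: eq_integral => y _.
by rewrite -EFinM normrM (ger0_norm (heat_ge0 _ _)) mulrA.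
Qed.

Lemma heat_off_diagonal tau y : (leb n).-integrable setT
   (EFin \o (fun x => dotp (x - y) (x - y) * heat (expR tau) (x - y))) /\
  \int[leb n]_x (dotp (x - y) (x - y) * heat (expR tau) (x - y)) <=
    8 * expR tau * Num.sqrt 2 ^+ n.
Proof.
have mht := @measurable_heat R n (expR tau).
have t20 : 0 < 2 * expR tau by rewrite mulr_gt0 ?expR_gt0.
have i1 : (leb n).-integrable setT (EFin \o
    (fun x => 8 * expR tau * Num.sqrt 2 ^+ n * heat (2 * expR tau) x)).
  by apply: integrable_mulrl; exact: integrable_heat.
have i2 : (leb n).-integrable setT (EFin \o
    (fun x => dotp x x * heat (expR tau) x)).
  apply: integrable_le i1 _; first by mfun.
  move=> x; rewrite ger0_norm ?mulr_ge0 ?dotp_ge0 ?heat_ge0//.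
  by apply: heat_moment; exact: expR_gt0.
split; first exact: (integrable_lebD (- y) i2).
rewrite (Rintegral_lebD (- y) (f := fun x => dotp x x * heat (expR tau) x)); last first.
  exact: integrable_meas i2.
apply: (@le_trans _ _ (\int[leb n]_x
    (8 * expR tau * Num.sqrt 2 ^+ n * heat (2 * expR tau) x))).
  apply: le_Rintegral => // x _; apply: heat_moment; exact: expR_gt0.
rewrite (RintegralZl _ measurableT (integrable_heat n t20)).
by rewrite Rintegral_heat// mulr1.
Qed.

(* The factor 1 controls large times in [integrable_frac_laplacian], the second
   moment bound small times. *)
Lemma integral_off_box (M : R) tau y : box M y ->
  (\int[leb n]_x (\1_(~` box (M + 1)) x * heat (expR tau) (y - x))%:E <=
   (Num.min 1 (8 * expR tau * Num.sqrt 2 ^+ n))%:E)%E.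
Proof.
move=> bM; have mht := @measurable_heat R n (expR tau).
have mb : measurable_fun setT (\1_(~` @box R n (M + 1)) : 'rV[R]_n -> R).
  by apply: measurable_indic; apply: measurableC; exact: measurable_box.
have m1 : measurable_fun setT
    (fun x => \1_(~` @box R n (M + 1)) x * heat (expR tau) (y - x)) by mfun.
have hE x : heat (expR tau) (y - x) = heat (expR tau) (x - y).
  by rewrite -heatN opprB.
have ih : (leb n).-integrable setT (EFin \o (fun x => heat (expR tau) (x - y))).
  by apply: (integrable_lebD (- y)); apply: integrable_heat; exact: expR_gt0.
have ge0 x : 0 <= \1_(~` @box R n (M + 1)) x * heat (expR tau) (y - x).
  by rewrite mulr_ge0 ?heat_ge0.
rewrite EFin_min le_min; apply/andP; split.
  apply: (@le_trans _ _ (\int[leb n]_x (heat (expR tau) (x - y))%:E)%E).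
    apply: ge0_le_integralT => //; first exact: (integrable_meas ih).
    move=> x; rewrite hE ler_piMl ?heat_ge0//.
  rewrite (integral_lebD (- y) (f := fun x => (heat (expR tau) x)%:E)).
    by rewrite integral_heat// expR_gt0.
  exact/measurable_EFinP.
have [i2 H2] := heat_off_diagonal tau y.
rewrite -lee_fin in H2; apply: le_trans H2.
rewrite (EFin_Rintegral i2).
apply: (@ge0_le_integralT _ _ R (leb n)
  (fun x => \1_(~` @box R n (M + 1)) x * heat (expR tau) (y - x))
  (fun x => dotp (x - y) (x - y) * heat (expR tau) (x - y)) m1
  (integrable_meas i2) ge0).
move=> x; rewrite hE ler_wpM2r ?heat_ge0// indicE.
have [bx|nbx] := pselect (box (M + 1) x).
  by rewrite memNset ?dotp_ge0//=; apply.
rewrite mem_set//.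
(* A coordinate that leaves the larger box differs from that of y by at least 1, so |x - y|^2 >= 1
   and the second moment dominates. *)
have [i ni] : exists i, ~ `|x ord0 i| <= M + 1 by apply/existsNP.
apply: (@le_trans _ _ (`|x ord0 i - y ord0 i| ^+ 2)).
  rewrite -[leLHS](expr1n _ 2) ler_pXn2r ?nnegrE//.
  move/negP: ni; rewrite -ltNge => ni.
  have := lerB_dist (x ord0 i) (y ord0 i); have := bM i; lra.
rewrite real_normK ?num_real// /dotp (bigD1 i)//= !mxE -expr2 lerDl.
by apply: sumr_ge0 => k _; rewrite -expr2 sqr_ge0.
Qed.

(** On the box enlarged by 1 the function is bounded; off it the heat formula applies, and Tonelli
    brings the integral over x innermost, where [integral_off_box] bounds it. *)
Lemma integrable_frac_laplacian phi : test_function phi ->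
  (leb n).-integrable setT (EFin \o frac_laplacian s phi).
Proof.
move=> tp; have mp := test_measurable tp; have mg := measurable_frac_laplacian s tp.
have [M M0 HM] := test_support tp; have [B B0 HB] := frac_laplacian_bounded s01 tp.
have c0 : 0 < c by exact: frac_const_gt0.
apply: integrable_normP => //.
have mb : measurable_fun setT (\1_(~` @box R n (M + 1)) : 'rV[R]_n -> R).
  by apply: measurable_indic; apply: measurableC; exact: measurable_box.
have mb' : measurable_fun setT (\1_(@box R n (M + 1)) : 'rV[R]_n -> R).
  by apply: measurable_indic; exact: measurable_box.
pose J x tau y := \1_(~` @box R n (M + 1)) x *
  (expR (- (s * tau)) * `|phi y| * heat (expR tau) (y - x)).
have J0 x tau y : 0 <= J x tau y.
  by rewrite /J !mulr_ge0 ?expR_ge0 ?heat_ge0.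
have mJ : measurable_fun setT
    (fun p : ('rV[R]_n * R) * 'rV[R]_n => J p.1.1 p.1.2 p.2).
  by rewrite /J; mfun_heat.
have mJ2 : measurable_fun setT
    (fun x => \int[L]_tau \int[leb n]_y (J x tau y)%:E)%E.
  apply: (@measurable_fun_fubini_tonelli_F _ _ _ _ _ L (fun p : 'rV[R]_n * R =>
    \int[leb n]_y (J p.1 p.2 y)%:E)%E).
    apply: (measurable_fun_fubini_tonelli_F
      (fun p : ('rV[R]_n * R) * 'rV[R]_n => (J p.1.1 p.1.2 p.2)%:E)).
      exact/measurable_EFinP.
    by move=> p; rewrite lee_fin.
  by move=> p; apply: integral_ge0 => y _; rewrite lee_fin.
have J20 x : (0 <= \int[L]_tau \int[leb n]_y (J x tau y)%:E)%E.
  by do 2 (apply: integral_ge0 => ? _); rewrite lee_fin.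
apply: (@le_lt_trans _ _ (\int[leb n]_x ((B * \1_(box (M + 1)) x)%:E +
    (c^-1)%:E * \int[L]_tau \int[leb n]_y (J x tau y)%:E))%E).
  apply: ge0_le_integral => //.
  - by apply/measurable_EFinP; mfun.
  - apply: emeasurable_funD; first by mfun.
    exact: measurable_funeM.
  move=> x _; have [bx|nbx] := pselect (box (M + 1) x).
    rewrite indicE mem_set// mulr1.
    apply: (@le_trans _ _ B%:E); first by rewrite lee_fin.
    by rewrite leeDl// mule_ge0// lee_fin invr_ge0 ltW.
  rewrite indicE memNset// mulr0 add0e.
  have px : phi x = 0.
    apply: HM; apply: contra_not nbx => bM j.
    by rewrite (le_trans (bM j))// lerDl.
  rewrite -(@lee_pmul2l _ c%:E) ?lte_fin//.
  rewrite muleA -!EFinM divff ?gt_eqF// mul1e -[X in X * _](ger0_norm (ltW c0)) -normrM.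
  apply: le_trans (frac_laplacian_off_support tp px) _.
  rewrite le_eqVlt; apply/orP; left; apply/eqP.
  apply: eq_integral => tau _; apply: eq_integral => y _.
  by rewrite /J indicE mem_set// mul1r.
rewrite ge0_integralD//=; last 4 first.
- by move=> x _; rewrite lee_fin mulr_ge0.
- by mfun.
- by move=> x _; rewrite mule_ge0// lee_fin invr_ge0 ltW.
- exact: measurable_funeM.
rewrite lte_add_pinfty//.
  have := integrable_norm_lty (@integrable_box R n (M + 1) B).
  by under eq_integral do rewrite ger0_norm ?mulr_ge0//.
rewrite ge0_integralZl//=; last by rewrite lee_fin invr_ge0 ltW.
rewrite lte_mul_pinfty// ?lee_fin ?invr_ge0 ?ltW//.
rewrite (@tonelli3 R _ _ _ _ _ _ (leb n) L (leb n) J mJ J0).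
have /andP[s0 s1] := s01.
set m := Num.min s (1 - s).
have m0 : 0 < m by rewrite /m lt_min s0 subr_gt0.
pose K : R := 8 * Num.sqrt 2 ^+ n.
have K1 : 1 <= K.
  have q1 : 1 <= Num.sqrt 2 ^+ n :> R.
    apply: exprn_ege1; rewrite -[leLHS]sqrtr1 ler_wsqrtr//; exact: (ler1n R 2).
  by rewrite /K; lra.
(* For tau >= 0 the factor 1 of the minimum leaves exp (- s tau). For tau < 0 the other factor
   leaves K exp ((1 - s) tau). As K >= 1, one constant covers both. *)
have key tau y : (\int[leb n]_x (J x tau y)%:E <=
    (expR (- (m * `|tau|)) * (K * `|phi y|))%:E)%E.
  have [by_|nby] := pselect (box M y); last first.
    rewrite /J HM// normr0 !mulr0 integral0_eq// => x _.
    by rewrite mul0r mulr0.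
  have -> : (\int[leb n]_x (J x tau y)%:E = (expR (- (s * tau)) * `|phi y|)%:E *
      \int[leb n]_x (\1_(~` box (M + 1)) x * heat (expR tau) (y - x))%:E)%E.
    rewrite -ge0_integralZl//=; last 2 first.
    - by have mht := @measurable_heat R n (expR tau); mfun.
    - by move=> x _; rewrite lee_fin mulr_ge0 ?heat_ge0.
    by apply: eq_integral => x _; rewrite -EFinM /J mulrCA.
  apply: (@le_trans _ _ ((expR (- (s * tau)) * `|phi y|)%:E *
      (Num.min 1 (8 * expR tau * Num.sqrt 2 ^+ n))%:E)%E).
    by rewrite lee_wpmul2l ?lee_fin ?mulr_ge0 ?expR_ge0//; exact: integral_off_box.
  rewrite -EFinM lee_fin [leLHS]mulrAC [leRHS]mulrA ler_wpM2r//.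
  have ms : m <= s by rewrite /m ge_min lexx.
  have m1 : m <= 1 - s by rewrite /m ge_min lexx orbT.
  have [t0|t0] := leP 0 tau.
    apply: (@le_trans _ _ (expR (- (s * tau)) * 1)).
      by rewrite ler_wpM2l ?expR_ge0// ge_min lexx.
    rewrite ler_pM ?expR_ge0// ler_expR lerN2 ger0_norm// ler_wpM2r//.
  apply: (@le_trans _ _ (expR (- (s * tau)) * (8 * expR tau * Num.sqrt 2 ^+ n))).
    by rewrite ler_wpM2l ?expR_ge0// ge_min lexx orbT.
  have -> : expR (- (s * tau)) * (8 * expR tau * Num.sqrt 2 ^+ n) =
      expR (- (s * tau) + tau) * K by rewrite expRD /K; ring.
  rewrite ler_wpM2r ?(le_trans ler01)// ler_expR ltr0_norm//; nra.
have mK : measurable_fun setT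
    (fun p : R * 'rV[R]_n => expR (- (m * `|p.1|)) * (K * `|phi p.2|)).
  by mfun.
have ge2 tau y : 0 <= expR (- (m * `|tau|)) * (K * `|phi y|).
  by rewrite !mulr_ge0 ?expR_ge0// (le_trans ler01).
apply: (@le_lt_trans _ _ (\int[L]_tau \int[leb n]_y
    `|expR (- (m * `|tau|)) * (K * `|phi y|)|%:E)%E); last first.
  apply: (@product_bound_lty _ _ _ _ R L (leb n)
    (fun tau y => expR (- (m * `|tau|)) * (K * `|phi y|)) _ _ mK
    (integrable_expN_norm m0)
    (integrable_mulrl K (integrable_norm (test_integrable tp)))) => tau y.
  by rewrite ger0_norm.
have mJ3 : measurable_fun setT
    (fun p : R * 'rV[R]_n => \int[leb n]_x (J x p.1 p.2)%:E)%E.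
  apply: (measurable_fun_fubini_tonelli_F
    (fun p : (R * 'rV[R]_n) * 'rV[R]_n => (J p.2 p.1.1 p.1.2)%:E)).
    by apply/measurable_EFinP; rewrite /J; mfun_heat.
  by move=> p; rewrite lee_fin.
apply: ge0_le_integral => //.
- by move=> tau _; do 2 (apply: integral_ge0 => ? _); rewrite lee_fin.
- apply: (measurable_fun_fubini_tonelli_F
    (fun p : R * 'rV[R]_n => \int[leb n]_x (J x p.1 p.2)%:E)%E) => //.
  by move=> p; apply: integral_ge0 => x _; rewrite lee_fin.
- apply: (measurable_fun_fubini_tonelli_F (fun p : R * 'rV[R]_n =>
    `|expR (- (m * `|p.1|)) * (K * `|phi p.2|)|%:E)) => //.
  by apply/measurable_EFinP; mfun.
move=> tau _; apply: ge0_le_integral => //.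
- by move=> y _; apply: integral_ge0 => x _; rewrite lee_fin.
- exact: (measurable_fun_pair2 tau mJ3).
- by apply/measurable_EFinP; mfun.
- by move=> y _; rewrite (le_trans (key tau y))// lee_fin ler_norm.
Qed.

End integrability.

(** * The kernel Phi *)

Section fundamental_solution.
Context (R : realType) (n : nat) (s : R).
Hypothesis (n2 : (2 <= n)%N) (s01 : 0 < s < 1).
Local Notation L := (@lebesgue_measure R).
Implicit Types (x y z xi : 'rV[R]_n).

Lemma n_gt_2s : 2 * s < n%:R.
Proof.
have : 2%:R <= n%:R :> R by rewrite ler_nat.
by move: s01 => /andP[_ ?]; lra.
Qed.

Let a := n%:R / 2 - s.

Lemma half_codim_gt0 : 0 < a.
Proof. by have := n_gt_2s; rewrite /a; lra. Qed.

Lemma kappa_gt0 : 0 < kappa n s.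
Proof.
have /andP[s0 _] := s01.
rewrite /kappa divr_gt0 ?Gamma_gt0//.
  by rewrite divr_gt0// subr_gt0 n_gt_2s.
by rewrite !mulr_gt0 ?powR_gt0 ?pi_gt0 ?Gamma_gt0.
Qed.

Lemma Phi_ge0 z : 0 <= Phi s z.
Proof. by rewrite mulr_ge0 ?powR_ge0// ltW// kappa_gt0. Qed.

Lemma measurable_Phi : measurable_fun setT (@Phi R n s).
Proof. by rewrite /Phi; mfun. Qed.

Lemma enorm0 : enorm (0 : 'rV[R]_n) = 0.
Proof. by rewrite /enorm /dotp big1 ?sqrtr0// => i _; rewrite mxE mul0r. Qed.

Lemma Phi0 : Phi s (0 : 'rV[R]_n) = 0.
Proof.
rewrite /Phi enorm0 powR0 ?mulr0// lt_eqF// subr_lt0.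
exact: n_gt_2s.
Qed.

Lemma enorm_gt0 z : z != 0 -> 0 < enorm z.
Proof.
move=> z0; rewrite lt0r enorm_ge0 andbT; apply: contraNneq z0 => e0.
apply/eqP/rowP => i; rewrite mxE; apply/eqP.
have : dotp z z = 0 by rewrite -enorm_sqr e0 expr0n.
have := norm_sqr_le_dotp z => /[swap] -> h.
have := rV_coord_le z i; have n0 := normr_ge0 z; have c0 := normr_ge0 (z ord0 i).
rewrite -normr_eq0 => le1; apply/eqP; nra.
Qed.

Lemma dotp_gt0 z : z != 0 -> 0 < dotp z z.
Proof. by move=> /enorm_gt0 z0; rewrite -enorm_sqr exprn_gt0. Qed.

Lemma sqrt_Xn (r : R) : 0 <= r -> Num.sqrt r ^- n = r `^ (- (n%:R / 2)).
Proof.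
move=> r0; rewrite powRN -powR12_sqrt// -powR_mulrn ?powR_ge0// -powRrM.
by congr ((_ `^ _)^-1); rewrite mulrC.
Qed.

(** The constant [kappa] in the form in which the heat integral produces it, by 4^a = 4^(n/2) / 4^s
    for a = n/2 - s. *)
Lemma PhiE z : Gamma s * Phi s z =
  Num.sqrt (4 * pi) ^- n * ((4^-1 * dotp z z) `^ (- a) * Gamma a).
Proof.
have /andP[s0 _] := s01.
rewrite /Phi (_ : 2 * s - n%:R = 2 * (- a)); last by rewrite /a; field.
rewrite enorm_powR2 powRM ?dotp_ge0// /kappa.
rewrite (_ : (n%:R - 2 * s) / 2 = a); last by rewrite /a; field.
have p40 : 0 <= 4 * pi :> R by rewrite mulr_ge0// pi_ge0.
rewrite sqrt_Xn// powRM ?pi_ge0//.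
have -> : (4^-1 : R) `^ (- a) = 4 `^ a.
  by rewrite -[4^-1](powR_inv1)// -powRrM mulN1r opprK.
have E : (2 : R) `^ (2 * s) = 4 `^ s.
  by rewrite powRrM powR_mulrn// expr2; congr (_ `^ _); ring.
have G0 : Gamma s != 0 by rewrite gt_eqF// Gamma_gt0.
rewrite E.
have -> : (4 : R) `^ a = 4 `^ (n%:R / 2) / 4 `^ s.
  by rewrite /a powRB// (_ : (4:R) != 0) ?implybT.
rewrite !(powRN _ (n%:R / 2)).
have P1 : (pi : R) `^ (n%:R / 2) != 0 by rewrite gt_eqF// powR_gt0// pi_gt0.
have P2 : (4 : R) `^ (n%:R / 2) != 0 by rewrite gt_eqF// powR_gt0.
have P3 : (4 : R) `^ s != 0 by rewrite gt_eqF// powR_gt0.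
move: P1 P2 P3 G0.
move: (pi `^ _) (4 `^ (n%:R / 2)) (4 `^ s) (Gamma s) (Gamma a) (dotp z z `^ _).
by move=> A B C D E' F A0 B0 C0 D0; field; rewrite A0 B0 C0 D0.
Qed.

(* Gamma s * Phi s = \int_0^oo t^(s - 1) h_t dt with t = exp tau. *)
Lemma Phi_heat z : z != 0 ->
  (\int[L]_tau (expR (s * tau) * heat (expR tau) z)%:E = (Gamma s * Phi s z)%:E)%E.
Proof.
move=> z0; rewrite PhiE EFinM -gamma_inv_scale ?half_codim_gt0//; last first.
  by rewrite mulr_gt0// dotp_gt0.
rewrite -ge0_integralZl//=; last by mfun.
apply: eq_integral => tau _; rewrite -EFinM heat_expE mulrCA -!expRD.
by congr (_ * expR _)%:E; rewrite /a; ring.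
Qed.

(** At z = 0 the left-hand side is 0 by the convention for [powR], so this upper bound has no
    exceptional point. *)
Lemma le_Phi_heat z :
  ((Gamma s * Phi s z)%:E <= \int[L]_tau (expR (s * tau) * heat (expR tau) z)%:E)%E.
Proof.
have [->|z0] := eqVneq z 0; last by rewrite Phi_heat.
rewrite Phi0 mulr0; apply: integral_ge0 => tau _.
by rewrite lee_fin mulr_ge0 ?expR_ge0 ?heat_ge0.
Qed.

Lemma Phi_off_box z : ~ box 1 z -> Phi s z <= kappa n s.
Proof.
move=> nb; rewrite ler_piMr ?(ltW kappa_gt0)//.
have [i ni] : exists i, ~ `|z ord0 i| <= 1 by apply/existsNP.
move/negP: ni; rewrite -ltNge => ni.
have e1 : 1 <= enorm z.
  have h : 1 <= dotp z z.
    apply: le_trans (norm_sqr_le_dotp z).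
    have := rV_coord_le z i; nra.
  by rewrite -[leLHS]sqrtr1 ler_wsqrtr.
rewrite -[leRHS](powRr0 (enorm z)) ler_powR// subr_le0 ltW//.
exact: n_gt_2s.
Qed.

(** In the heat form of Phi, times t <= 1 are controlled by the total mass one of the heat kernel,
    and times t > 1 by its maximum, of order t^(- n / 2), times the volume of the box. After t = exp
    tau these are exp (s tau) and exp (- a tau), up to constants. *)
Lemma integrable_Phi_box :
  (leb n).-integrable setT (EFin \o (fun z => \1_(box 1) z * Phi s z)).
Proof.
have /andP[s0 _] := s01; have G0 : 0 < Gamma s by exact: Gamma_gt0.
have mP := measurable_Phi.
have mb : measurable_fun setT (\1_(@box R n 1) : 'rV[R]_n -> R).
  by apply: measurable_indic; exact: measurable_box.
apply: integrable_normP; first by mfun.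
rewrite -(@lte_pmul2l _ (Gamma s)%:E) ?lte_fin// mulry gtr0_sg// mul1e.
rewrite -ge0_integralZl//=; [|by mfun|by rewrite lee_fin ltW].
pose J z tau := \1_(@box R n 1) z * (expR (s * tau) * heat (expR tau) z).
have J0 z tau : 0 <= J z tau by rewrite /J !mulr_ge0 ?expR_ge0 ?heat_ge0.
have mJ : measurable_fun setT (fun p : 'rV[R]_n * R => J p.1 p.2).
  by rewrite /J; mfun_heat.
apply: (@le_lt_trans _ _ (\int[leb n]_z \int[L]_tau (J z tau)%:E)%E).
  apply: ge0_le_integral => //.
  - by move=> z _; rewrite mule_ge0// lee_fin ltW.
  - by apply: emeasurable_funM; mfun.
  - apply: (@measurable_fun_fubini_tonelli_F _ _ _ _ _ L
      (fun p : 'rV[R]_n * R => (J p.1 p.2)%:E)); first exact/measurable_EFinP.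
    by move=> p; rewrite lee_fin.
  move=> z _; rewrite (ger0_norm (mulr_ge0 _ (Phi_ge0 z)))//.
  rewrite -EFinM mulrCA EFinM.
  apply: (@le_trans _ _ ((\1_(@box R n 1) z)%:E *
      \int[L]_tau (expR (s * tau) * heat (expR tau) z)%:E)%E).
    by rewrite lee_wpmul2l ?lee_fin//; exact: le_Phi_heat.
  rewrite -ge0_integralZl//=; last 2 first.
  - by mfun_heat.
  - by move=> tau _; rewrite lee_fin mulr_ge0 ?expR_ge0 ?heat_ge0.
rewrite (@tonelli _ _ _ _ _ (leb n) L J mJ J0).
set m := Num.min s a.
have m0 : 0 < m by rewrite /m lt_min s0 half_codim_gt0.
have V := @leb_box_lty R n 1.
have V0 : (0 <= leb n (@box R n 1))%E by exact: measure_ge0.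
pose v := fine (leb n (@box R n 1)).
have vE : leb n (@box R n 1) = v%:E by rewrite /v fineK// ge0_fin_numE.
have v0 : 0 <= v by rewrite /v fine_ge0.
pose S : R := Num.sqrt (4 * pi) ^- n.
have S0 : 0 <= S by rewrite invr_ge0 exprn_ge0// sqrtr_ge0.
pose K := 1 + S * v.
have K1 : 1 <= K by rewrite lerDl mulr_ge0.
have key tau : (\int[leb n]_z (J z tau)%:E <= (K * expR (- (m * `|tau|)))%:E)%E.
  have mht := @measurable_heat R n (expR tau).
  have [t0|t0] := leP tau 0.
    apply: (@le_trans _ _ (\int[leb n]_z ((expR (s * tau))%:E * (heat (expR tau) z)%:E))%E).
      apply: ge0_le_integral => //.
      - by move=> z _; rewrite lee_fin.
      - by rewrite /J; mfun.
      - by apply: emeasurable_funM; mfun.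
      move=> z _; rewrite -EFinM lee_fin /J ler_piMl ?mulr_ge0 ?expR_ge0 ?heat_ge0//.
    rewrite ge0_integralZl//=; last 2 first.
    - by mfun.
    - by move=> z _; rewrite lee_fin heat_ge0.
    rewrite integral_heat ?expR_gt0// mule1 lee_fin.
    rewrite -[leLHS]mul1r ler_pM ?expR_ge0// ler_expR ler0_norm//.
    have ms : m <= s by rewrite /m ge_min lexx.
    nra.
  apply: (@le_trans _ _ (\int[leb n]_z ((S * expR (- (a * tau)))%:E * (\1_(box 1) z)%:E))%E).
    apply: ge0_le_integral => //.
    - by move=> z _; rewrite lee_fin.
    - by rewrite /J; mfun.
    - by apply: emeasurable_funM; mfun.
    move=> z _; rewrite -EFinM lee_fin /J mulrC ler_wpM2r//.
    rewrite heat_expE mulrCA ler_wpM2l// mulrA -expRD.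
    rewrite (_ : s * tau + - (n%:R / 2 * tau) = - (a * tau)); last by rewrite /a; ring.
    rewrite ler_piMr ?expR_ge0// expR_le1 oppr_le0.
    by rewrite !mulr_ge0 ?expR_ge0 ?dotp_ge0.
  rewrite ge0_integralZl//=; last 2 first.
  - by mfun.
  - by rewrite lee_fin mulr_ge0 ?expR_ge0.
  rewrite integral_indic//; last exact: measurable_box.
  rewrite setIT -[X in (_ * X)%E]/(leb n (@box R n 1)) vE -EFinM lee_fin mulrAC ler_pM ?mulr_ge0 ?expR_ge0//.
    by rewrite /K lerDr.
  rewrite ler_expR gtr0_norm//.
  have ma : m <= a by rewrite /m ge_min lexx orbT.
  nra.
apply: (@le_lt_trans _ _ (\int[L]_tau `|K * expR (- (m * `|tau|))|%:E)%E); last first.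
  by apply: integrable_norm_lty; apply: integrable_mulrl; exact: integrable_expN_norm.
apply: ge0_le_integral => //.
- by move=> tau _; apply: integral_ge0 => z _; rewrite lee_fin.
- apply: (@measurable_fun_fubini_tonelli_F _ _ _ _ _ (leb n)
    (fun p : R * 'rV[R]_n => (J p.2 p.1)%:E)).
    by apply/measurable_EFinP; rewrite /J; mfun_heat.
  by move=> p; rewrite lee_fin.
- by mfun.
- by move=> tau _; rewrite (le_trans (key tau))// lee_fin ler_norm.
Qed.

(** Inside the unit box around y use |g| <= B and the integrability of Phi; outside use Phi <= kappa
    and the integrability of g. Translation invariance makes the bound independent of y. *)
Lemma Phi_conv_bound (g : 'rV[R]_n -> R) (B : R) : measurable_fun setT g ->
  (forall x, `|g x| <= B) -> (leb n).-integrable setT (EFin \o g) ->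
  exists C : R, forall y,
    (\int[leb n]_x (Phi s (x - y) * `|g x|)%:E <= C%:E)%E.
Proof.
move=> mg gB gi.
have mP := measurable_Phi.
have B0 : 0 <= B by apply: le_trans (gB 0).
have mb : measurable_fun setT (\1_(@box R n 1) : 'rV[R]_n -> R).
  by apply: measurable_indic; exact: measurable_box.
have k0 := ltW kappa_gt0.
have ib := integrable_Phi_box.
exists (B * (\int[leb n]_z (\1_(box 1) z * Phi s z)) +
  kappa n s * \int[leb n]_x `|g x|) => y.
have iG : (leb n).-integrable setT (EFin \o (fun x => kappa n s * `|g x|)).
  by apply: integrable_mulrl; exact: integrable_norm.
have ibB : (leb n).-integrable setT
    (EFin \o (fun x => B * (\1_(box 1) (x - y) * Phi s (x - y)))).
  by apply: integrable_mulrl; exact: (integrable_lebD (- y) ib).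
apply: (@le_trans _ _ (\int[leb n]_x
    (B * (\1_(box 1) (x - y) * Phi s (x - y)) + kappa n s * `|g x|)%:E)%E).
  apply: ge0_le_integralT.
  - by mfun.
  - by mfun.
  - by move=> x; rewrite mulr_ge0 ?Phi_ge0.
  move=> x; rewrite indicE; have [bx|nbx] := pselect (box 1 (x - y)).
    rewrite mem_set// mul1r mulrC (le_trans (ler_wpM2r (Phi_ge0 _) (gB x)))//.
    by rewrite lerDl mulr_ge0.
  rewrite memNset// mul0r mulr0 add0r ler_wpM2r//.
  exact: Phi_off_box.
rewrite -EFin_Rintegral; last exact: (integrable_addr ibB iG).
rewrite RintegralD// lee_fin.
have E1 : \int[leb n]_x (B * (\1_(box 1) (x - y) * Phi s (x - y))) =
    B * \int[leb n]_z (\1_(box 1) z * Phi s z).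
  rewrite -(Rintegral_lebD (- y) (integrable_meas ib)).
  have ib' := integrable_lebD (- y) ib.
  exact: (@RintegralZl _ _ _ (leb n) setT
    (fun x => \1_(box 1) (x - y) * Phi s (x - y)) B measurableT ib').
have E2 : \int[leb n]_x (kappa n s * `|g x|) = kappa n s * \int[leb n]_x `|g x|.
  exact: (RintegralZl (kappa n s) measurableT (integrable_norm gi)).
by rewrite E1 E2.
Qed.

End fundamental_solution.

(** * Convolution with Phi inverts (- Delta)^s on test functions *)

Section inverse_of_fractional_laplacian.
Context (R : realType) (n : nat) (s : R).
Hypothesis (n2 : (2 <= n)%N) (s01 : 0 < s < 1).
Local Notation L := (@lebesgue_measure R).
Implicit Types (x y z xi : 'rV[R]_n) (phi : 'rV[R]_n -> R).

Let n0 : (0 < n)%N. Proof. exact: leq_trans n2. Qed.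
Let s0 : 0 < s. Proof. by case/andP: s01. Qed.
Let G0 : 0 < Gamma s. Proof. exact: Gamma_gt0. Qed.

Lemma norm_mul_le (a b c : R) : 0 <= a -> `|b| <= c -> `|a * b| <= c * a.
Proof. by move=> a0 bc; rewrite normrM (ger0_norm a0) mulrC ler_wpM2r. Qed.

Lemma measurable_neq (y : 'rV[R]_n) :
  measurable_fun setT (fun x : 'rV[R]_n => (x != y)%:R : R).
Proof.
rewrite (_ : (fun x => _) = \1_(~` [set y])).
  by apply: measurable_indic; apply: measurableC; exact: measurable_set1_rV.
apply/funext => x; rewrite indicE; congr (_%:R).
have [->|/eqP xy] := eqVneq x y; first by rewrite memNset//=; apply.
by rewrite mem_set//= => xy'; apply: xy.
Qed.

(** For removing a singular point from an integrand before an exchange and putting it back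
    afterwards. *)
Lemma Rintegral_neq (y : 'rV[R]_n) (F : 'rV[R]_n -> R) : measurable_fun setT F ->
  \int[leb n]_x ((x != y)%:R * F x) = \int[leb n]_x F x.
Proof.
move=> mF; rewrite /Rintegral; congr fine; apply: ae_eq_integral => //.
- apply/measurable_EFinP; apply: measurable_funM => //; exact: measurable_neq.
- exact/measurable_EFinP.
exists [set y]; split; [exact: measurable_set1_rV|exact: leb_set1|].
move=> x /=; apply: contra_notP => /eqP xy _.
by rewrite xy mul1r.
Qed.

(** At a fixed time Fubini is absolute: the heat kernel is integrable in x and the multiplied
    transform is dominated by [wgt] in xi, uniformly in x. *)
Lemma heat_conv_frac_laplacian phi y tau : test_function phi ->
  \int[leb n]_x (heat (expR tau) (x - y) * frac_laplacian s phi x) =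
  (2 * pi) ^- n * \int[leb n]_xi (expR (- (expR tau * dotp xi xi)) *
    (enorm xi `^ (2 * s) * ft phi xi (- dotp y xi))).
Proof.
move=> tp; have t0 := expR_gt0 tau.
have mh := @measurable_heat R n (expR tau).
pose k : R := (2 * pi) ^- n.
pose F x xi := ft phi xi (- dotp x xi).
have mF : measurable_fun setT (fun p : 'rV[R]_n * 'rV[R]_n => F p.1 p.2).
  exact: measurable_ftx.
pose f x xi := heat (expR tau) (x - y) * (enorm xi `^ (2 * s) * F x xi).
have mf : measurable_fun setT (fun p : 'rV[R]_n * 'rV[R]_n => f p.1 p.2).
  by rewrite /f; mfun.
have ih : (leb n).-integrable setT (EFin \o (fun x => heat (expR tau) (x - y))).
  by apply: (integrable_lebD (- y)); exact: integrable_heat.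
have [C C0 HC] := ft_powR_decay s01 tp.
have fy : (\int[leb n]_x \int[leb n]_xi `|f x xi|%:E < +oo)%E.
  apply: (@product_bound_lty _ _ _ _ R (leb n) (leb n) f _ _ mf ih
    (integrable_mulrl C (integrable_wgt R n))) => x xi.
  rewrite normrM (ger0_norm (heat_ge0 _ _)) ler_wpM2l ?heat_ge0//.
  rewrite normrM (ger0_norm (powR_ge0 _ _)).
  by have [] := HC xi (- dotp x xi).
have fub := @Rintegral_fubini _ _ _ _ R (leb n) (leb n) f mf fy.
have E1 x : heat (expR tau) (x - y) * frac_laplacian s phi x =
    k * \int[leb n]_xi f x xi.
  rewrite (frac_laplacianE s x tp) mulrCA; congr (_ * _).
  exact: esym (RintegralZl _ measurableT (integrable_ft_powR s01 x tp)).
have iF : (leb n).-integrable setT (EFin \o (fun x => \int[leb n]_xi f x xi)).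
  exact: (@integrable_Rintegral_param _ _ _ _ R (leb n) (leb n) f mf fy).
under eq_Rintegral => x _ do rewrite E1.
rewrite (RintegralZl _ measurableT iF) fub; congr (_ * _).
apply: eq_Rintegral => xi _.
have ihx : (leb n).-integrable setT
    (EFin \o (fun x => heat (expR tau) (x - y) * F x xi)).
  have mFx : measurable_fun setT (F ^~ xi) by exact: (measurable_param_r mF xi).
  apply: integrable_le (integrable_mulrl (\int[leb n]_z `|phi z|) ih) _; first by mfun.
  move=> x; exact: (norm_mul_le (heat_ge0 _ _) (ft_le _ _ tp)).
have -> : (fun x => f x xi) =
    (fun x => enorm xi `^ (2 * s) * (heat (expR tau) (x - y) * F x xi)).
  by apply/funext => x; rewrite /f mulrCA.
apply: etrans (RintegralZl _ measurableT ihx) _.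
by rewrite [RHS]mulrCA; congr (_ * _); exact: heat_conv_ft.
Qed.

(* Convolving with [Phi] in heat form turns the multiplier |xi|^(2 s) into
   \int_0^oo t^(s - 1) exp (- t |xi|^2) |xi|^(2 s) dt = Gamma s. *)
Lemma Phi_conv_frac_laplacian phi y : test_function phi ->
  \int[leb n]_x (Phi s (x - y) * frac_laplacian s phi x) = phi y.
Proof.
move=> tp; apply: (mulfI (lt0r_neq0 G0)).
pose g := frac_laplacian s phi.
have mg : measurable_fun setT g by exact: measurable_frac_laplacian.
have ig : (leb n).-integrable setT (EFin \o g) by exact: integrable_frac_laplacian.
have [B B0 HB] := frac_laplacian_bounded s01 tp.
have [C HC] := Phi_conv_bound n2 s01 mg HB ig.
have mP := @measurable_Phi R n s.
have mne := measurable_neq y.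
have P0 := @Phi_ge0 R n s n2 s01.
(* The first factor removes the point x = y, where the heat integral diverges while [Phi] has the
   value 0. *)
pose f x tau := (x != y)%:R * (expR (s * tau) * heat (expR tau) (x - y) * g x).
have mf : measurable_fun setT (fun p : 'rV[R]_n * R => f p.1 p.2).
  rewrite /f; apply: measurable_funM; last by mfun_heat.
  exact: (measurableT_comp mne measurable_fst).
have mw x : measurable_fun setT (fun tau => expR (s * tau) * heat (expR tau) (x - y)).
  by mfun_heat.
have w0 x tau : 0 <= expR (s * tau) * heat (expR tau) (x - y).
  by rewrite mulr_ge0 ?expR_ge0 ?heat_ge0.
have fabs x : (\int[L]_tau `|f x tau|%:E = (Gamma s * (Phi s (x - y) * `|g x|))%:E)%E.
  rewrite /f; have [->|xy] := eqVneq x y.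
    rewrite subrr Phi0// mul0r mulr0 integral0_eq// => tau _.
    by rewrite mul0r normr0.
  under eq_integral do rewrite mul1r normrM ger0_norm// EFinM.
  rewrite ge0_integralZr//=; last 2 first.
  - by apply/measurable_EFinP; exact: mw.
  - by move=> tau _; rewrite lee_fin.
  by rewrite Phi_heat ?subr_eq0// -EFinM -mulrA.
have iPg : (leb n).-integrable setT (EFin \o (fun x => Phi s (x - y) * g x)).
  apply: integrable_normP; first by mfun.
  under eq_integral do rewrite normrM ger0_norm//.
  by apply: le_lt_trans (HC y) _; rewrite ltry.
have fy : (\int[leb n]_x \int[L]_tau `|f x tau|%:E < +oo)%E.
  under eq_integral do rewrite fabs.
  have := integrable_norm_lty (integrable_mulrl (Gamma s) iPg).
  apply: le_lt_trans; rewrite le_eqVlt; apply/orP; left; apply/eqP.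
  by apply: eq_integral => x _; rewrite /= (normrM (Gamma s)) (normrM (Phi s (x - y))) (ger0_norm (ltW G0)) (ger0_norm (P0 _)).
have fub := @Rintegral_fubini _ _ _ _ R (leb n) L f mf fy.
have E1 x : \int[L]_tau f x tau = Gamma s * (Phi s (x - y) * g x).
  rewrite /f; have [->|xy] := eqVneq x y.
    rewrite subrr Phi0// mul0r mulr0 /Rintegral integral0_eq// => tau _.
    by rewrite mul0r.
  under eq_Rintegral do rewrite mul1r.
  rewrite RintegralZr//; last first.
    apply: integrable_normP; first exact: mw.
    under eq_integral do rewrite ger0_norm//.
    by rewrite Phi_heat ?subr_eq0// ltry.
  by rewrite /Rintegral Phi_heat ?subr_eq0//= mulrA.
have E2 tau : \int[leb n]_x f x tau = expR (s * tau) * ((2 * pi) ^- n *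
    \int[leb n]_xi (expR (- (expR tau * dotp xi xi)) *
    (enorm xi `^ (2 * s) * ft phi xi (- dotp y xi)))).
  have mht := @measurable_heat R n (expR tau).
  rewrite (Rintegral_neq y (F := fun x => expR (s * tau) * heat (expR tau) (x - y) * g x)).
    rewrite -heat_conv_frac_laplacian//.
    under eq_Rintegral do rewrite -mulrA.
    rewrite RintegralZl//.
    apply: integrable_normP; first by mfun.
    have ih : (leb n).-integrable setT (EFin \o (fun x => heat (expR tau) (x - y))).
      by apply: (integrable_lebD (- y)); apply: integrable_heat; exact: expR_gt0.
    apply: integrable_norm_lty.
    apply: integrable_le (integrable_mulrl B ih) _; first by mfun.
    move=> x; exact: (norm_mul_le (heat_ge0 _ _) (HB _)).
  by mfun.
move: fub; under eq_Rintegral => x _ do rewrite E1.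
under [in RHS]eq_Rintegral => tau _ do rewrite E2.
rewrite (RintegralZl _ measurableT iPg) => ->.
(* It remains to exchange tau and xi: the tau-integral of the multiplier is Gamma s |xi|^(- 2 s),
   which cancels |xi|^(2 s), and Fourier inversion finishes. *)
pose k : R := (2 * pi) ^- n.
pose F xi := ft phi xi (- dotp y xi).
have mF : measurable_fun setT F by exact: measurable_ft_l.
have iF : (leb n).-integrable setT (EFin \o F) by exact: integrable_ft.
pose h xi tau := k * (expR (s * tau - dotp xi xi * expR tau) *
  (enorm xi `^ (2 * s) * F xi)).
have mh : measurable_fun setT (fun p : 'rV[R]_n * R => h p.1 p.2).
  by rewrite /h; mfun.
have gs xi : xi != 0 -> (\int[L]_tau (expR (s * tau - dotp xi xi * expR tau))%:E =
    (dotp xi xi `^ (- s) * Gamma s)%:E)%E.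
  by move=> xi0; rewrite gamma_scale// dotp_gt0.
have me xi : measurable_fun setT (fun tau => expR (s * tau - dotp xi xi * expR tau)).
  by mfun.
have ige xi : xi != 0 -> L.-integrable setT
    (EFin \o (fun tau => expR (s * tau - dotp xi xi * expR tau))).
  move=> xi0; apply: integrable_normP; first exact: me.
  by under eq_integral do rewrite ger0_norm ?expR_ge0//; rewrite gs// ltry.
have cancel xi : xi != 0 -> dotp xi xi `^ (- s) * enorm xi `^ (2 * s) = 1.
  move=> xi0; rewrite enorm_powR2 -powRD ?addNr ?powRr0//.
  by rewrite [dotp _ _ == _]gt_eqF ?implybT ?dotp_gt0.
have alg (a b c d e : R) : a * b = 1 -> c * (b * d) * (a * e) = e * (c * d).
  by move=> ab; rewrite -[RHS]mul1r -ab; ring.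
(* At xi = 0 the integrand is 0 by [powR0] while F xi may not be; the factor accounts for this
   single point. *)
have E3 xi : \int[L]_tau h xi tau = (xi != 0)%:R * (Gamma s * (k * F xi)).
  have [->|xi0] := eqVneq xi 0.
    rewrite mul0r /Rintegral integral0_eq// => tau _.
    by rewrite /h enorm0 powR0 ?mul0r ?mulr0// mulf_neq0// gt_eqF.
  have -> : h xi = (fun tau => k * (enorm xi `^ (2 * s) * F xi) *
      expR (s * tau - dotp xi xi * expR tau)).
    by apply/funext => tau; rewrite /h; ring.
  rewrite (RintegralZl _ measurableT (ige _ xi0)) [X in _ * X]/Rintegral gs//=.
  rewrite mul1r; exact: alg (cancel _ xi0).
have k0 : 0 <= k by rewrite invr_ge0 exprn_ge0// mulr_ge0// pi_ge0.
have hy : (\int[leb n]_xi \int[L]_tau `|h xi tau|%:E < +oo)%E.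
  apply: (@le_lt_trans _ _ (\int[leb n]_xi `|Gamma s * (k * F xi)|%:E)%E); last first.
    by apply: integrable_norm_lty; do 2 apply: integrable_mulrl.
  apply: ge0_le_integral => //.
  - by move=> xi _; apply: integral_ge0 => tau _; rewrite lee_fin.
  - apply: (@measurable_fun_fubini_tonelli_F _ _ _ _ _ L
      (fun p : 'rV[R]_n * R => `|h p.1 p.2|%:E)).
      by apply/measurable_EFinP; rewrite /h; mfun.
    by move=> p; rewrite lee_fin.
  - by mfun.
  move=> xi _; have [->|xi0] := eqVneq xi 0.
    rewrite integral0_eq// => tau _.
    by rewrite /h enorm0 powR0 ?mul0r ?mulr0 ?normr0// mulf_neq0// gt_eqF.
  have -> : (\int[L]_tau `|h xi tau|%:E = (k * (enorm xi `^ (2 * s) * `|F xi|))%:E *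
      \int[L]_tau (expR (s * tau - dotp xi xi * expR tau))%:E)%E.
    rewrite -ge0_integralZl//=; last 2 first.
    - by mfun.
    - by rewrite lee_fin !mulr_ge0 ?powR_ge0.
    apply: eq_integral => tau _; rewrite -EFinM /h; congr EFin.
    rewrite !normrM (ger0_norm k0) (ger0_norm (expR_ge0 _)) (ger0_norm (powR_ge0 _ _)).
    ring.
  rewrite gs// -EFinM lee_fin !normrM (ger0_norm k0) (ger0_norm (ltW G0)).
  rewrite le_eqVlt; apply/orP; left; apply/eqP.
  exact: alg (cancel _ xi0).
have := @Rintegral_fubini _ _ _ _ R (leb n) L h mh hy.
under eq_Rintegral => xi _ do rewrite E3.
rewrite (Rintegral_neq 0 (F := fun xi => Gamma s * (k * F xi))); last by mfun.
rewrite (RintegralZl _ measurableT (integrable_mulrl k iF)).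
rewrite (RintegralZl _ measurableT iF) fourier_inversion// => ->.
apply: eq_Rintegral => tau _.
have iG : (leb n).-integrable setT (EFin \o (fun xi =>
    expR (- (expR tau * dotp xi xi)) * (enorm xi `^ (2 * s) * F xi))).
  apply: integrable_le (integrable_norm (integrable_ft_powR s01 y tp)) _; first by mfun.
  move=> xi; rewrite normrM (ger0_norm (expR_ge0 _)) ler_piMl// expR_le1 oppr_le0.
  by rewrite mulr_ge0 ?expR_ge0 ?dotp_ge0.
rewrite -(RintegralZl _ measurableT iG).
rewrite -(RintegralZl _ measurableT (integrable_mulrl k iG)).
apply: eq_Rintegral => xi _.
by rewrite /h expRD [dotp xi xi * _]mulrC; ring.
Qed.

End inverse_of_fractional_laplacian.

(** * Potentials of signed measures *)

Section charge_variation_finite.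
Context d (T : measurableType d) (R : realType) (nu : {charge set T -> \bar R}).
Context (P N : set T) (nuPN : hahn_decomposition nu P N).

Let finite_charge_variation : fin_num_fun (charge_variation nuPN).
Proof. by move=> A mA; rewrite fin_num_measure. Qed.

(** Supplies the sigma-finiteness of the total variation that Tonelli uses. *)
HB.instance Definition _ := @Measure_isFinite.Build _ _ _
  (charge_variation nuPN) finite_charge_variation.

End charge_variation_finite.

Section signed_measure_tools.
Context d (T : measurableType d) (R : realType).
Implicit Types (mu : {charge set T -> \bar R}) (f : T -> R).
Local Notation pos mu := (jordan_pos (hahnP mu)).
Local Notation neg mu := (jordan_neg (hahnP mu)).

Lemma ge0_integral_tv mu f : measurable_fun setT f -> (forall y, 0 <= f y) ->
  (\int[charge_tv mu]_y (f y)%:E =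
   \int[pos mu]_y (f y)%:E + \int[neg mu]_y (f y)%:E)%E.
Proof.
move=> mf f0; rewrite -ge0_integral_measure_add//; last first.
- exact/measurable_EFinP.
- by move=> y _; rewrite lee_fin.
by apply: eq_measure_integral => A mA _; exact: esym (measure_addE _ _ _).
Qed.

Lemma charge_integrableP mu f : measurable_fun setT f ->
  (\int[charge_tv mu]_y `|f y|%:E < +oo)%E -> charge_integrable mu f.
Proof. exact: integrable_normP. Qed.

Lemma le_abs_charge_integral mu f : measurable_fun setT f ->
  (`|charge_integral mu f|%:E <= \int[charge_tv mu]_y `|f y|%:E)%E.
Proof.
move=> mf; rewrite (ge0_integral_tv mu (f := fun y => `|f y|))//; last by mfun.
apply: (@le_trans _ _ (`|\int[pos mu]_y f y|%:E + `|\int[neg mu]_y f y|%:E)%E).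
  by rewrite -EFinD lee_fin ler_normB.
by apply: leeD; exact: le_abs_Rintegral.
Qed.

(* Integrability is not needed, as both sides are 0 when f is not integrable. *)
Lemma ge0_RintegralZr (m : {measure set T -> \bar R}) f (k : R) :
  measurable_fun setT f -> (forall y, 0 <= f y) ->
  \int[m]_y (f y * k) = \int[m]_y f y * k.
Proof.
move=> mf f0; have mfE : measurable_fun setT (EFin \o f) by exact/measurable_EFinP.
have fine_mul v (c : R) : 0 <= c -> fine (v * c%:E) = fine v * c.
  rewrite le0r => /orP[/eqP ->|c0]; first by rewrite mule0 mulr0.
  by case: v => [r||]//=; rewrite ?gt0_mulye ?gt0_mulNye ?lte_fin//= mul0r.
have fpos c : 0 <= c -> \int[m]_y (f y * c) = \int[m]_y f y * c.
  move=> c0; rewrite /Rintegral -fine_mul//; congr fine.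
  under eq_integral do rewrite EFinM.
  by rewrite ge0_integralZr//= => y _; rewrite lee_fin.
have [k0|/ltW k0] := leP 0 k; first exact: fpos.
rewrite -[k]opprK mulrN -fpos ?oppr_ge0//.
rewrite /Rintegral -fineN -integral_ge0N; last first.
  by move=> y _; rewrite lee_fin mulr_ge0// oppr_ge0.
by congr fine; apply: eq_integral => y _; rewrite opprK mulrN EFinN oppeK.
Qed.

End signed_measure_tools.

Section potential_of_measure.
Context (R : realType) (n : nat) (s : R).
Hypothesis (n2 : (2 <= n)%N) (s01 : 0 < s < 1).
Variable nu : {finite_measure set 'rV[R]_n -> \bar R}.
Implicit Types (x y z : 'rV[R]_n) (g : 'rV[R]_n -> R).

Let P0 z : 0 <= Phi s z. Proof. exact: Phi_ge0. Qed.
Let mP := @measurable_Phi R n s.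

Lemma measurable_Phi_conv g : measurable_fun setT g ->
  measurable_fun setT (fun p : 'rV[R]_n * 'rV[R]_n => Phi s (p.1 - p.2) * g p.1).
Proof.
move=> mg; apply: measurable_funM; last exact: (measurableT_comp mg measurable_fst).
by apply: (measurableT_comp mP); mfun.
Qed.

(** After Tonelli the inner integral over x is bounded uniformly in y by [Phi_conv_bound], and nu
    has finite mass. *)
Lemma Phi_conv_lty g B : measurable_fun setT g -> (forall x, `|g x| <= B) ->
    (leb n).-integrable setT (EFin \o g) ->
  (\int[leb n]_x \int[nu]_y `|Phi s (x - y) * g x|%:E < +oo)%E.
Proof.
move=> mg gB gi; have [C HC] := Phi_conv_bound n2 s01 mg gB gi.
rewrite (@tonelli_abs _ _ _ _ R (leb n) nu _ (measurable_Phi_conv mg)).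
apply: (@le_lt_trans _ _ (\int[nu]_y (cst C%:E y))%E); last first.
  by rewrite integral_cst// ltey_eq fin_numM// fin_num_measure.
apply: ge0_le_integral => //.
- by move=> y _; apply: integral_ge0 => x _; rewrite lee_fin.
- apply: (@measurable_fun_fubini_tonelli_G _ _ _ _ _ (leb n)
    (fun p : 'rV[R]_n * 'rV[R]_n => `|Phi s (p.1 - p.2) * g p.1|%:E)).
    apply/measurable_EFinP; apply: measurableT_comp => //.
    exact: measurable_Phi_conv.
  by move=> p; rewrite lee_fin.
move=> y _; apply: le_trans (HC y).
by under eq_integral do rewrite normrM ger0_norm//.
Qed.

Lemma Rintegral_Phi_mul g x :
  \int[nu]_y (Phi s (x - y) * g x) = \int[nu]_y Phi s (x - y) * g x.
Proof.
apply: (ge0_RintegralZr nu (g x) (f := fun y => Phi s (x - y))) => [|y].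
  by apply: (measurableT_comp mP); mfun.
exact: P0.
Qed.

Lemma integrable_potential_mul g B : measurable_fun setT g ->
    (forall x, `|g x| <= B) -> (leb n).-integrable setT (EFin \o g) ->
  (leb n).-integrable setT (EFin \o (fun x => \int[nu]_y Phi s (x - y) * g x)).
Proof.
move=> mg gB gi; have fy := Phi_conv_lty mg gB gi.
have := @integrable_Rintegral_param _ _ _ _ R (leb n) nu _ (measurable_Phi_conv mg) fy.
by under eq_fun do rewrite Rintegral_Phi_mul.
Qed.

Lemma Rintegral_potential_frac_laplacian phi : test_function phi ->
  \int[leb n]_x (\int[nu]_y Phi s (x - y) * frac_laplacian s phi x) = \int[nu]_y phi y.
Proof.
move=> tp; have mg := measurable_frac_laplacian s tp.
have [B _ gB] := frac_laplacian_bounded s01 tp.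
have fy := Phi_conv_lty mg gB (integrable_frac_laplacian s01 tp).
have := @Rintegral_fubini _ _ _ _ R (leb n) nu _ (measurable_Phi_conv mg) fy.
under eq_Rintegral => x _ do rewrite Rintegral_Phi_mul.
move=> ->; apply: eq_Rintegral => y _; exact: Phi_conv_frac_laplacian.
Qed.

Lemma measurable_measure_potential :
  measurable_fun setT (fun x => \int[nu]_y Phi s (x - y)).
Proof.
apply: (@measurable_Rintegral_param _ _ _ _ R nu (fun x y => Phi s (x - y))).
by apply: (measurableT_comp mP); mfun.
Qed.

Lemma integrable_indic_box (M : R) :
  (leb n).-integrable setT (EFin \o (\1_(box M) : 'rV[R]_n -> R)).
Proof.
by have := @integrable_box R n M 1; under eq_fun do rewrite mul1r.
Qed.

Lemma indic_le1 (A : set 'rV[R]_n) x : `|\1_A x : R| <= 1.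
Proof. by rewrite indicE normr_nat lern1 leq_b1. Qed.

(** For each k the double integral with the indicator of the box of size k is finite, so the inner
    one is finite for almost every x in that box; countably many boxes exhaust the space. *)
Lemma ae_Phi_integrable :
  {ae leb n, forall x, nu.-integrable setT (EFin \o (fun y => Phi s (x - y)))}.
Proof.
have mb k : measurable_fun setT (\1_(box k%:R) : 'rV[R]_n -> R).
  by apply: measurable_indic; exact: measurable_box.
have H (k : nat) : {ae leb n, forall x, setT x ->
    (\int[nu]_y `|Phi s (x - y) * \1_(box k%:R) x|%:E)%E \is a fin_num}.
  apply: integrable_ae => //; apply/integrableP; split.
    apply: (@measurable_fun_fubini_tonelli_F _ _ _ _ _ nu
      (fun p : 'rV[R]_n * 'rV[R]_n => `|Phi s (p.1 - p.2) * \1_(box k%:R) p.1|%:E)).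
      apply/measurable_EFinP; apply: measurableT_comp => //.
      exact: measurable_Phi_conv.
    by move=> p; rewrite lee_fin.
  have := Phi_conv_lty (mb k) (indic_le1 _) (integrable_indic_box _).
  apply: le_lt_trans; rewrite le_eqVlt; apply/orP; left; apply/eqP.
  apply: eq_integral => x _; rewrite gee0_abs//; apply: integral_ge0 => y _.
  by rewrite lee_fin.
have := ae_foralln H.
apply: filterS => x Hx.
have [M M0 /(_ x erefl) xM] := compact_box (@compact_set1 _ x).
pose k := Num.bound M.
have kx : box k%:R x.
  move=> i; apply: le_trans (xM i) _; apply: ltW.
  exact: archi_boundP (ltW M0).
apply: integrable_normP; first by apply: (measurableT_comp mP); mfun.
have := Hx k I; rewrite fin_num_abs.
rewrite gee0_abs; last by apply: integral_ge0 => y _; rewrite lee_fin.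
apply: le_lt_trans; rewrite le_eqVlt; apply/orP; left; apply/eqP.
by apply: eq_integral => y _; rewrite indicE mem_set// mulr1.
Qed.

End potential_of_measure.

Section potential_of_charge.
Context (R : realType) (n : nat) (s : R).
Hypothesis (n2 : (2 <= n)%N) (s01 : 0 < s < 1).
Variable mu : {charge set 'rV[R]_n -> \bar R}.
Implicit Types (x y z : 'rV[R]_n) (g : 'rV[R]_n -> R).

Lemma measurable_Phi_sub x : measurable_fun setT (fun y => Phi s (x - y)).
Proof. by apply: (measurableT_comp (@measurable_Phi R n s)); mfun. Qed.

Lemma measurable_potential : measurable_fun setT (potential s mu).
Proof.
apply: measurable_funB.
  exact: (measurable_measure_potential s (jordan_pos (hahnP mu))).
exact: (measurable_measure_potential s (jordan_neg (hahnP mu))).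
Qed.

Lemma integrable_charge_potential_mul g B : measurable_fun setT g ->
    (forall x, `|g x| <= B) -> (leb n).-integrable setT (EFin \o g) ->
  (leb n).-integrable setT (EFin \o (fun x => potential s mu x * g x)).
Proof.
move=> mg gB gi.
have ip := integrable_potential_mul n2 s01 (jordan_pos (hahnP mu)) mg gB gi.
have iN := integrable_potential_mul n2 s01 (jordan_neg (hahnP mu)) mg gB gi.
have := integrable_addr ip (integrable_mulrl (-1) iN).
rewrite (_ : (fun x => _) = (fun x => potential s mu x * g x))//.
by apply/funext => x; rewrite mulN1r -mulrBl.
Qed.

Lemma potential_locally_integrable : locally_integrable_rV (potential s mu).
Proof.
split; first exact: measurable_potential.
move=> K cK; rewrite -lebE; have [M _ KM] := compact_box cK.
have mK : measurable K.
  rewrite -[K]setCK; apply: measurableC; apply: open_measurable_rV.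
  by apply: closed_openC; apply: compact_closed => //; exact: norm_hausdorff.
have mbx : measurable_fun setT (\1_(box M) : 'rV[R]_n -> R).
  by apply: measurable_indic; exact: measurable_box.
have mp := measurable_potential.
have := integrable_norm_lty (integrable_charge_potential_mul mbx (indic_le1 _)
  (integrable_indic_box n M)).
apply: le_lt_trans; rewrite [leLHS]integral_mkcond; apply: ge0_le_integral => //.
- by move=> x _; apply: erestrict_ge0 => y _; rewrite lee_fin.
- apply/(measurable_restrictT _ mK); apply: measurable_funTS.
  by mfun.
- by mfun.
move=> x _; rewrite /patch; case: ifPn => [xK|_]; last by rewrite lee_fin.
rewrite lee_fin indicE mem_set ?mulr1//; apply: KM; exact: set_mem.
Qed.

Lemma potential_frac_laplace_eq : frac_laplace_eq s (potential s mu) mu.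
Proof.
move=> phi tp; rewrite -!lebE; have mg := measurable_frac_laplacian s tp.
have [B _ gB] := frac_laplacian_bounded s01 tp.
have gi := integrable_frac_laplacian s01 tp.
split; first exact: integrable_charge_potential_mul gi.
have ip := integrable_potential_mul n2 s01 (jordan_pos (hahnP mu)) mg gB gi.
have iN := integrable_potential_mul n2 s01 (jordan_neg (hahnP mu)) mg gB gi.
rewrite /charge_integral.
rewrite -(Rintegral_potential_frac_laplacian n2 s01 (jordan_pos (hahnP mu)) tp).
rewrite -(Rintegral_potential_frac_laplacian n2 s01 (jordan_neg (hahnP mu)) tp).
rewrite -RintegralB//; apply: eq_Rintegral => x _.
by rewrite /potential /charge_integral mulrBl.
Qed.

Lemma ae_charge_integrable_Phi :
  {ae lebesgue_rV R n, forall x, charge_integrable mu (fun y => Phi s (x - y))}.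
Proof.
rewrite -lebE.
have := ae_Phi_integrable n2 s01 (charge_variation (hahnP mu)).
by apply: filterS => x.
Qed.

End potential_of_charge.

(** * Pointwise bounds by Riesz potentials *)

Section riesz_kernel.
Context (R : realType).
Implicit Types a r t : R.
Local Notation L := (@lebesgue_measure R).

(** Encodes the conditions t > 0 and t > r as real factors, which makes the integrand jointly
    measurable in the radius and the point, over the whole line. *)
Definition pos_indic t : R := \1_(`]0, +oo[ : set R) t.

Lemma pos_indic1 t : 0 < t -> pos_indic t = 1.
Proof. by move=> t0; rewrite /pos_indic indicE mem_set//= in_itv/= t0. Qed.

Lemma pos_indic0 t : t <= 0 -> pos_indic t = 0.
Proof.
by move=> t0; rewrite /pos_indic indicE memNset//= in_itv/= andbT; apply/negP; rewrite -leNgt.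
Qed.

Lemma pos_indic_ge0 t : 0 <= pos_indic t.
Proof. by rewrite /pos_indic indicE. Qed.

Lemma measurable_pos_indic d (T : measurableType d) (f : T -> R) :
  measurable_fun setT f -> measurable_fun setT (fun u => pos_indic (f u)).
Proof.
move=> mf; apply: (measurableT_comp (f := pos_indic)) => //.
by apply: measurable_indic; exact: measurable_itv.
Qed.

Lemma powR_cvg_pinfty a : 0 < a -> t `^ (- a) @[t --> +oo] --> (0 : R).
Proof.
move=> a0; apply/cvgrPdist_lt => e e0; near=> t.
have et : e `^ (- a^-1) < t by near: t; apply: nbhs_pinfty_gt; rewrite num_real.
have e1 : 0 < e `^ (- a^-1) by rewrite powR_gt0.
have t0 : 0 < t by exact: lt_trans et.
rewrite sub0r normrN ger0_norm ?powR_ge0// powRN -[ltRHS]invrK.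
rewrite ltf_pV2 ?posrE ?invr_gt0 ?powR_gt0//.
have := gt0_ltr_powR a0 (ltW e1) (ltW t0) et.
by rewrite -powRrM mulNr mulVf ?lt0r_neq0// powR_inv1// ltW.
Unshelve. all: by end_near. Qed.

Lemma integral_powR_tail a r : 0 < a -> 0 < r ->
  (\int[L]_(t in `[r, +oo[) (t `^ (- a - 1))%:E = (r `^ (- a) / a)%:E)%E.
Proof.
move=> a0 r0; pose F t := - a^-1 * t `^ (- a).
have dF t : 0 < t -> is_derive t 1 F (t `^ (- a - 1)).
  move=> t0; have := is_derive1_Ml (- a^-1) (is_derive1_powR (- a) t0).
  by rewrite mulrA mulrNN mulVf ?mul1r ?lt0r_neq0.
have tr t : r < t -> 0 < t by exact: lt_trans.
rewrite (@ge0_continuous_FTC2y R (fun t => t `^ (- a - 1)) F r 0).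
- by rewrite sub0e -EFinN /F mulNr opprK mulrC.
- by move=> t _; exact: powR_ge0.
- apply: continuous_in_subspaceT => t; rewrite inE/= in_itv/= andbT => rt.
  by apply: powR_continuous; exact: lt_le_trans rt.
- by rewrite -[X in _ --> X](mulr0 (- a^-1)); apply: cvgMr; exact: powR_cvg_pinfty.
- by move=> t /tr t0; have [] := dF t t0.
- apply: cvg_at_right_filter; apply: (is_derive1_continuous (dF _ r0)).
- move=> t; rewrite in_itv/= andbT => /tr t0.
  by rewrite derive1E; have [_] := dF t t0.
Qed.

(* \int_r^oo t^(- a - 1) dt, with the value +oo at r = 0. *)
Definition riesz_kernel a r : \bar R :=
  (\int[L]_t (pos_indic t * pos_indic (t - r) * t `^ (- a - 1))%:E)%E.

Lemma measurable_riesz_weight a r :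
  measurable_fun setT (fun t => pos_indic t * pos_indic (t - r) * t `^ (- a - 1)).
Proof.
apply: measurable_funM; last exact: measurable_powR.
by apply: measurable_funM; apply: measurable_pos_indic; mfun.
Qed.

Lemma riesz_weight_ge0 a r t : 0 <= pos_indic t * pos_indic (t - r) * t `^ (- a - 1).
Proof. by rewrite !mulr_ge0 ?pos_indic_ge0 ?powR_ge0. Qed.

Lemma riesz_kernelE a r : 0 < a -> 0 < r -> riesz_kernel a r = (r `^ (- a) / a)%:E.
Proof.
move=> a0 r0; rewrite -integral_powR_tail// -integral_itv_obnd_cbnd; last first.
  apply: measurable_funTS; apply/measurable_EFinP; exact: measurable_powR.
rewrite [RHS]integral_mkcond; apply: eq_integral => t _; rewrite patchE.
case: ifPn => [|tr]; rewrite ?inE/= ?in_itv/= ?andbT.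
  move=> rt; have t0 : 0 < t by exact: lt_trans rt.
  by rewrite !pos_indic1 ?subr_gt0// !mul1r.
rewrite [pos_indic (t - r)]pos_indic0 ?mulr0 ?mul0r// subr_le0 leNgt.
by apply: contraNN tr => rt; rewrite inE/= in_itv/= rt.
Qed.

Lemma riesz_kernel_ge0 a r : (0 <= riesz_kernel a r)%E.
Proof. by apply: integral_ge0 => t _; rewrite lee_fin riesz_weight_ge0. Qed.

Lemma riesz_kernel0 a : 0 < a -> riesz_kernel a 0 = +oo%E.
Proof.
move=> a0; apply: eq_infty => t.
have c0 : 0 < a * (`|t| + 1) by rewrite mulr_gt0// ltr_wpDl.
(* Chosen so that r^(- a) / a = |t| + 1; the kernel at 0 dominates the kernel at every r > 0. *)
pose r := (a * (`|t| + 1)) `^ (- a^-1).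
have r0 : 0 < r by rewrite powR_gt0.
apply: (@le_trans _ _ (riesz_kernel a r)).
  rewrite riesz_kernelE// /r -powRrM mulrNN mulVf ?lt0r_neq0// powRr1 ?(ltW c0)//.
  rewrite mulrAC mulfV ?lt0r_neq0// mul1r lee_fin.
  by rewrite (le_trans (ler_norm t))// lerDl.
apply: ge0_le_integralT; try exact: measurable_riesz_weight.
  by move=> u; exact: riesz_weight_ge0.
move=> u; rewrite subr0 ler_wpM2r ?powR_ge0//.
have [u0|u0] := leP u 0; first by rewrite (pos_indic0 u0) !mul0r.
rewrite (pos_indic1 u0) !mul1r; have [ur|ur] := leP (u - r) 0.
  by rewrite pos_indic0.
by rewrite pos_indic1.
Qed.

Lemma le_riesz_kernel a r : 0 < a -> 0 <= r -> ((r `^ (- a) / a)%:E <= riesz_kernel a r)%E.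
Proof.
move=> a0; rewrite le0r => /orP[/eqP ->|r0]; first by rewrite riesz_kernel0// leey.
by rewrite riesz_kernelE.
Qed.

End riesz_kernel.

Section riesz_potential.
Context (R : realType) (n : nat).
Implicit Types (x y z : 'rV[R]_n) (mu : {charge set 'rV[R]_n -> \bar R}).
Local Notation L := (@lebesgue_measure R).

Lemma enormN z : enorm (- z) = enorm z.
Proof. by rewrite /enorm dotpNl dotpC dotpNl opprK. Qed.

Lemma measurable_riesz_kernel_enorm (a : R) x :
  measurable_fun setT (fun y => riesz_kernel a (enorm (x - y))).
Proof.
apply: (@measurable_fun_fubini_tonelli_G _ _ _ _ _ L (fun p : R * 'rV[R]_n =>
  (pos_indic p.1 * pos_indic (p.1 - enorm (x - p.2)) * p.1 `^ (- a - 1))%:E)).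
  apply/measurable_EFinP; apply: measurable_funM.
    by apply: measurable_funM; apply: measurable_pos_indic; mfun.
  exact: (measurableT_comp (measurable_powR _) measurable_fst).
by move=> p; rewrite lee_fin riesz_weight_ge0.
Qed.

Lemma riesz_potentialE (beta : R) mu x : riesz_potential beta mu x =
  (\int[charge_tv mu]_y riesz_kernel (n%:R - beta) (enorm (x - y)))%E.
Proof.
pose a : R := n%:R - beta.
pose w t (y : 'rV[R]_n) := pos_indic t * pos_indic (t - enorm (x - y)) * t `^ (- a - 1).
have mw : measurable_fun setT (fun p : R * 'rV[R]_n => w p.1 p.2).
  apply: measurable_funM.
    by apply: measurable_funM; apply: measurable_pos_indic; mfun.
  exact: (measurableT_comp (measurable_powR _) measurable_fst).
have w0 t y : 0 <= w t y by exact: riesz_weight_ge0.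
have := @tonelli _ _ _ _ R L (charge_variation (hahnP mu)) w mw w0.
move=> H; apply: etrans H; rewrite /riesz_potential integral_mkcond.
apply: eq_integral => t _; rewrite patchE; case: ifPn => tD; last first.
  rewrite integral0_eq// => y _; rewrite /w pos_indic0 ?mul0r//.
  by rewrite leNgt; apply: contraNN tD => t0; rewrite inE/= in_itv/= t0.
have t0 : 0 < t by move: tD; rewrite inE/= in_itv/= andbT.
have wE y : w t y = \1_(eball x t) y * t `^ (- a - 1).
  rewrite /w pos_indic1// mul1r; congr (_ * _); rewrite indicE.
  rewrite -enormN opprB; have [yt|yt] := ltP (enorm (y - x)) t.
    by rewrite pos_indic1 ?subr_gt0// mem_set.
  by rewrite pos_indic0 ?subr_le0// memNset//= /eball/=; apply/negP; rewrite -leNgt.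
have mb : measurable (eball x t).
  have -> : eball x t = setT `&` (fun y => t - enorm (y - x)) @^-1` `]0, +oo[.
    rewrite setTI; apply/seteqP.
    by split=> y; rewrite /eball/= in_itv/= andbT subr_gt0.
  have me : measurable_fun setT (fun y => t - enorm (y - x)) by mfun.
  by apply: me => //; exact: measurable_itv.
under eq_integral do rewrite wE EFinM.
rewrite ge0_integralZr//=; last 2 first.
- by apply/measurable_EFinP; exact: measurable_indic.
- by rewrite lee_fin powR_ge0.
rewrite integral_indic// setIT; congr (_ * _%:E)%E.
by rewrite -powRN -(powR_inv1 (ltW t0)) -powRD// (gt_eqF t0) implybT.
Qed.

End riesz_potential.

Section charge_integral_riesz.
Context (R : realType) (n : nat) (beta C : R) (f : 'rV[R]_n -> R).
Hypotheses (C0 : 0 <= C) (mf : measurable_fun setT f).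
Hypothesis fC : forall z,
  (`|f z|%:E <= C%:E * riesz_kernel (n%:R - beta) (enorm z))%E.
Variables (mu : {charge set 'rV[R]_n -> \bar R}) (x : 'rV[R]_n).

Let mfx : measurable_fun setT (fun y : 'rV[R]_n => f (x - y)).
Proof. by apply: (measurableT_comp mf); mfun. Qed.

Lemma integral_le_riesz :
  (\int[charge_tv mu]_y `|f (x - y)|%:E <= C%:E * riesz_potential beta mu x)%E.
Proof.
rewrite riesz_potentialE -ge0_integralZl//=; last 2 first.
- exact: measurable_riesz_kernel_enorm.
- by move=> y _; exact: riesz_kernel_ge0.
apply: ge0_le_integral => //.
- apply/measurable_EFinP; exact: (measurableT_comp (@normr_measurable _ setT) mfx).
- apply: measurable_funeM; exact: measurable_riesz_kernel_enorm.
Qed.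

Lemma charge_integrable_riesz : (riesz_potential beta mu x < +oo)%E ->
  charge_integrable mu (fun y => f (x - y)).
Proof.
move=> rx; apply: charge_integrableP => //.
apply: le_lt_trans integral_le_riesz _; rewrite lte_mul_pinfty//.
Qed.

Lemma charge_integral_le_riesz :
  (`|charge_integral mu (fun y => f (x - y))|%:E <= C%:E * riesz_potential beta mu x)%E.
Proof. exact: le_trans (le_abs_charge_integral mu mfx) integral_le_riesz. Qed.

End charge_integral_riesz.

(** * The gradient of Phi and the kernel bounds *)

Section gradient_of_Phi.
Context (R : realType) (n : nat) (s : R).
Hypothesis (n2 : (2 <= n)%N) (s01 : 0 < s < 1).
Implicit Types (x y z : 'rV[R]_n).
Local Notation e_ i := (delta_mx ord0 i : 'rV[R]_n).

Lemma coord_le_enorm z i : `|z ord0 i| <= enorm z.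
Proof.
rewrite -(@ler_pXn2r _ 2)// ?nnegrE ?enorm_ge0// enorm_sqr real_normK ?num_real//.
by rewrite /dotp (bigD1 i)//= -expr2 lerDl sumr_ge0// => j _; rewrite -expr2 sqr_ge0.
Qed.

(** A crude factor n in place of sqrt n; it is the n in the constant of the gradient estimate. *)
Lemma enorm_le_coord z (M : R) : (forall i, `|z ord0 i| <= M) -> enorm z <= n%:R * M.
Proof.
move=> zM; have M0 : 0 <= M by exact: le_trans (normr_ge0 _) (zM (Ordinal n2 : 'I_n)).
rewrite -(@ler_pXn2r _ 2)// ?nnegrE ?enorm_ge0 ?mulr_ge0// enorm_sqr.
apply: (@le_trans _ _ (\sum_(i < n) M ^+ 2)).
  apply: ler_sum => i _; rewrite -expr2 -[leLHS]real_normK ?num_real//.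
  by rewrite lerXn2r ?nnegrE.
rewrite sumr_const card_ord -[leLHS]mulr_natl exprMn ler_wpM2r ?sqr_ge0//.
by rewrite -natrX ler_nat -{1}(expn1 n) leq_pexp2l ?(leq_trans _ n2).
Qed.

(** The classical gradient of Phi away from the origin; the last factor makes it 0 at the origin. *)
Definition gradPhi z i : R :=
  kappa n s * (2 * s - n%:R) * enorm z `^ (2 * s - n%:R - 2) * z ord0 i.

(** Along the line z + t e_i, the function Phi is a power of the quadratic polynomial D, and D 0 =
    |z|^2 > 0, so the one-variable power rule applies. *)
Lemma gradient_Phi z i : z != 0 -> gradient (Phi s) z ord0 i = gradPhi z i.
Proof.
move=> z0; rewrite mxE /partial.
pose q : R := (2 * s - n%:R) / 2.
have q2 : 2 * q = 2 * s - n%:R by rewrite /q mulrC divfK.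
pose D t : R := dotp z z + (2 * z ord0 i * t + t * t).
have DE t : dotp (z + t *: e_ i) (z + t *: e_ i) = D t.
  set v := t *: e_ i; rewrite dotpDl (dotpC z (z + v)) (dotpC v (z + v)) !dotpDl.
  have vE u : dotp v u = t * u ord0 i by rewrite dotpZl dotp_delta.
  by rewrite (dotpC z v) !vE /D /v !mxE !eqxx mulr1; ring.
have d0 : 0 < D 0 by rewrite /D !mulr0 !addr0 dotp_gt0.
have dD : is_derive (0 : R) 1 D (2 * z ord0 i).
  have H := is_derive1_D (is_derive1_cst (dotp z z) 0)
    (is_derive1_D (is_derive1_Ml (2 * z ord0 i) (is_derive1_id 0))
      (is_derive1_M (is_derive1_id 0) (is_derive1_id 0))).
  by apply: (is_derive_eq H); rewrite mulr0 mul0r !add0r addr0 mulr1.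
pose G t : R := Phi s (z + t *: e_ i).
have GE : G = fun t => kappa n s * ((powR (R := R)) ^~ q \o D) t.
  by apply/funext => t; rewrite /G /Phi -q2 enorm_powR2 DE.
have dG : is_derive (0 : R) 1 G (gradPhi z i).
  rewrite GE; have H := is_derive1_Ml (kappa n s)
    (is_derive1_comp (f := (powR (R := R)) ^~ q) (g := D) (is_derive1_powR q d0) dD).
  apply: (is_derive_eq H); rewrite /gradPhi -q2.
  rewrite (_ : 2 * q - 2 = 2 * (q - 1)) ?enorm_powR2; last by ring.
  rewrite /D !mulr0 !addr0 /GRing.scale/=; ring.
have E : (fun h : R => h^-1 *: (((Phi s : 'rV[R]_n -> R^o) \o shift z) (h *: e_ i)
      - (Phi s z : R^o))) =
    (fun h => h^-1 *: ((G \o shift 0) (h *: (1 : R)) - G 0)).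
  apply/funext => h /=.
  have -> : h *: (1 : R) + 0 = h by rewrite addr0 [LHS]mulr1.
  by rewrite /G scale0r addr0 [z + _]addrC.
have DG : derive (G : R -> R^o) 0 1 = gradPhi z i by case: dG.
by rewrite /derive E; exact: DG.
Qed.

(** The derivative at 0 is an unspecified value, so the gradient is written as [gradPhi] plus a
    correction carried by the single point 0. *)
Lemma measurable_gradient_Phi i :
  measurable_fun setT (fun z => gradient (Phi s) z ord0 i).
Proof.
have -> : (fun z => gradient (Phi s) z ord0 i) = (fun z : 'rV[R]_n =>
    gradPhi z i + (1 - (z != 0)%:R) * gradient (Phi s) 0 ord0 i).
  apply/funext => z; have [->|z0] := eqVneq z 0.
    by rewrite subr0 mul1r /gradPhi [(0 : 'rV[R]_n) ord0 i]mxE mulr0 add0r.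
  by rewrite subrr mul0r addr0 gradient_Phi.
apply: measurable_funD.
  rewrite /gradPhi; apply: measurable_funM; last exact: measurable_coord.
  by mfun.
apply: measurable_funM => //; apply: measurable_funB => //.
exact: (measurable_neq 0).
Qed.

Let a0 : 0 < n%:R - 2 * s. Proof. by rewrite subr_gt0; exact: n_gt_2s. Qed.
Let k0 : 0 < kappa n s. Proof. exact: kappa_gt0. Qed.

(** The factor n - 2 s compensates the division by a in [riesz_kernelE]. *)
Lemma Phi_le_riesz_kernel z : (`|Phi s z|%:E <=
  (kappa n s * (n%:R - 2 * s))%:E * riesz_kernel (n%:R - 2 * s) (enorm z))%E.
Proof.
rewrite ger0_norm ?(Phi_ge0 n2 s01)//.
apply: (@le_trans _ _ ((kappa n s * (n%:R - 2 * s))%:E *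
    (enorm z `^ (- (n%:R - 2 * s)) / (n%:R - 2 * s))%:E)%E).
  by rewrite -EFinM lee_fin opprB mulrAC -mulrA mulfVK ?lt0r_neq0// mulrC.
rewrite lee_pmul2l//; last exact: mulr_gt0 k0 a0.
exact: le_riesz_kernel a0 (enorm_ge0 z).
Qed.

(* At z = 0, where the gradient is a junk value, the right-hand side is +oo. *)
Lemma gradient_Phi_le_riesz_kernel z i : (`|gradient (Phi s) z ord0 i|%:E <=
  (kappa n s * (n%:R - 2 * s) * (n%:R - (2 * s - 1)))%:E *
  riesz_kernel (n%:R - (2 * s - 1)) (enorm z))%E.
Proof.
have b0 : 0 < n%:R - (2 * s - 1) by move: a0; lra.
have c0 : 0 < kappa n s * (n%:R - 2 * s) * (n%:R - (2 * s - 1)).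
  exact: mulr_gt0 (mulr_gt0 k0 a0) b0.
have [->|z0] := eqVneq z 0; first by rewrite enorm0 riesz_kernel0// gt0_muley ?lte_fin// leey.
have ez := enorm_gt0 z0.
rewrite riesz_kernelE// -EFinM lee_fin gradient_Phi// /gradPhi.
rewrite [leRHS]mulrA [leRHS]mulrAC mulfK ?lt0r_neq0//.
have -> : - (n%:R - (2 * s - 1)) = (2 * s - n%:R - 2) + 1 by ring.
rewrite [in leRHS]powRD ?(gt_eqF ez) ?implybT// powRr1 ?enorm_ge0// [leRHS]mulrA.
have normE (k c e w : R) : 0 <= k -> c <= 0 -> 0 <= e ->
    `|k * c * e * w| = k * - c * e * `|w|.
  by move=> hk hc he; rewrite !normrM (ger0_norm hk) (ler0_norm hc) (ger0_norm he).
rewrite normE ?powR_ge0 ?(ltW k0)//; last by move: a0; lra.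
rewrite opprB; apply: ler_wpM2l (coord_le_enorm z i).
exact: mulr_ge0 (ltW (mulr_gt0 k0 a0)) (powR_ge0 _ _).
Qed.

Lemma potential_le_riesz (mu : {charge set 'rV[R]_n -> \bar R}) x :
  (riesz_potential (2 * s) mu x < +oo)%E ->
  charge_integrable mu (fun y => Phi s (x - y)) /\
  (`|potential s mu x|%:E <=
     (kappa n s * (n%:R - 2 * s))%:E * riesz_potential (2 * s) mu x)%E.
Proof.
have c0 : 0 <= kappa n s * (n%:R - 2 * s) by exact: ltW (mulr_gt0 k0 a0).
have mP := @measurable_Phi R n s.
move=> rx; split.
  exact (charge_integrable_riesz c0 mP Phi_le_riesz_kernel rx).
exact (charge_integral_le_riesz c0 mP Phi_le_riesz_kernel mu x).
Qed.

Lemma grad_potential_le_riesz (mu : {charge set 'rV[R]_n -> \bar R}) x :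
  (riesz_potential (2 * s - 1) mu x < +oo)%E ->
  (forall i, charge_integrable mu (fun y => gradient (Phi s) (x - y) ord0 i)) /\
  ((enorm (grad_potential s mu x))%:E <=
     (n%:R * (kappa n s * (n%:R - 2 * s) * (n%:R - (2 * s - 1))))%:E *
     riesz_potential (2 * s - 1) mu x)%E.
Proof.
set c := kappa n s * _ * _ => rx.
have b0 : 0 < n%:R - (2 * s - 1) by move: a0; lra.
have c0 : 0 <= c by exact: ltW (mulr_gt0 (mulr_gt0 k0 a0) b0).
split=> [i|].
  exact (charge_integrable_riesz c0 (measurable_gradient_Phi i)
    (fun z => gradient_Phi_le_riesz_kernel z i) rx).
have r0 : (0 <= riesz_potential (2 * s - 1) mu x)%E.
  by rewrite riesz_potentialE; apply: integral_ge0 => y _; exact: riesz_kernel_ge0.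
have H i := charge_integral_le_riesz c0 (measurable_gradient_Phi i)
  (fun z => gradient_Phi_le_riesz_kernel z i) mu x.
move: r0 rx H; case: (riesz_potential (2 * s - 1) mu x) => [r||]//= r0 _ H.
rewrite -EFinM lee_fin -mulrA; apply: enorm_le_coord => i.
by rewrite mxE -lee_fin EFinM; exact: H.
Qed.

End gradient_of_Phi.

(** * The Dirac mass *)

Section dirac_charge.
Context (R : realType) (n : nat).
Local Notation D := (delta0 R n).

(** Whatever Hahn sets were chosen, the negative part is minus a restriction of the Dirac mass,
    hence nonpositive, and it is also a measure. *)
Lemma jordan_neg_delta0 A : measurable A -> jordan_neg (hahnP D) A = 0%E.
Proof.
move=> mA; apply/eqP; rewrite eq_le measure_ge0 andbT.
rewrite jordan_negE cjordan_negE /crestr0 mem_set// /crestr oppe_le0.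
exact: (measure_ge0 (dirac (0 : 'rV[R]_n))).
Qed.

Lemma jordan_pos_delta0 A : measurable A ->
  jordan_pos (hahnP D) A = dirac (0 : 'rV[R]_n) A.
Proof.
move=> mA; have := jordan_decomp (hahnP D) mA.
rewrite /cadd/= /cscale/= jordan_neg_delta0// mule0 adde0 => <-.
by [].
Qed.

Lemma charge_integral_delta0 (f : 'rV[R]_n -> R) : measurable_fun setT f ->
  charge_integral D f = f 0.
Proof.
move=> mf; rewrite /charge_integral /Rintegral.
rewrite (@eq_measure_integral _ _ _ setT (dirac (0 : 'rV[R]_n)) (jordan_pos (hahnP D))); last first.
  by move=> A mA _; exact: jordan_pos_delta0.
rewrite (@eq_measure_integral _ _ _ setT mzero (jordan_neg (hahnP D))); last first.
  by move=> A mA _; exact: jordan_neg_delta0.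
rewrite integral_measure_zero subr0 integral_dirac//; last exact/measurable_EFinP.
by rewrite diracT mul1e.
Qed.

Lemma riesz_potential_delta0 (beta : R) x : beta < n%:R -> x != 0 ->
  riesz_potential beta D x = (enorm x `^ (beta - n%:R) / (n%:R - beta))%:E.
Proof.
move=> bn x0; rewrite riesz_potentialE.
rewrite (@eq_measure_integral _ _ _ setT (dirac (0 : 'rV[R]_n))); last first.
  move=> A mA _.
  apply: etrans (_ : (jordan_pos (hahnP D) A + jordan_neg (hahnP D) A = _)%E) => //.
  by rewrite jordan_neg_delta0// adde0 jordan_pos_delta0.
rewrite integral_dirac//; last exact: measurable_riesz_kernel_enorm.
by rewrite diracT mul1e subr0 riesz_kernelE ?subr_gt0 ?enorm_gt0// opprB.
Qed.

End dirac_charge.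

(** * Sharpness of the orders *)

Section sharpness.
Context (R : realType) (n : nat) (s : R).
Hypothesis (n2 : (2 <= n)%N) (s01 : 0 < s < 1).
Implicit Types (x : 'rV[R]_n).
Local Notation D := (delta0 R n).

Lemma potential_delta0 x : potential s D x = Phi s x.
Proof.
rewrite /potential charge_integral_delta0 ?subr0//; exact: measurable_Phi_sub.
Qed.

Lemma enormZ (c : R) x : 0 <= c -> enorm (c *: x) = c * enorm x.
Proof.
move=> c0; rewrite /enorm dotpZl dotpC dotpZl mulrA -expr2 sqrtrM ?sqr_ge0//.
by rewrite sqrtr_sqr ger0_norm.
Qed.

(** The gradient is a scalar multiple of x, and the length of x raises the exponent 2 s - n - 2 by
    one. *)
Lemma enorm_grad_potential_delta0 x : x != 0 -> enorm (grad_potential s D x) =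
  kappa n s * (n%:R - 2 * s) * enorm x `^ (2 * s - 1 - n%:R).
Proof.
move=> x0; have ex := enorm_gt0 x0.
pose c := kappa n s * (n%:R - 2 * s) * enorm x `^ (2 * s - n%:R - 2).
have -> : grad_potential s D x = - (c *: x).
  apply/rowP => i; rewrite [LHS]mxE charge_integral_delta0; last first.
    apply: (measurableT_comp (measurable_gradient_Phi s i)); mfun.
  rewrite subr0 gradient_Phi// /gradPhi /c [RHS]mxE [(_ *: x) _ _]mxE; ring.
have a0 : 0 <= n%:R - 2 * s by rewrite subr_ge0 ltW//; exact: n_gt_2s.
rewrite enormN enormZ; last first.
  exact: mulr_ge0 (mulr_ge0 (ltW (kappa_gt0 n2 s01)) a0) (powR_ge0 _ _).
rewrite /c -mulrA; congr (_ * _).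
rewrite -[X in _ * X](powRr1 (ltW ex)) -powRD ?(gt_eqF ex) ?implybT//.
by congr (_ `^ _); ring.
Qed.

Lemma exists_small_powR_lt (p q c C r : R) : p < q -> 0 < c -> 0 < r ->
  exists t, [/\ 0 < t, t < r & C * t `^ q < c * t `^ p].
Proof.
(* The added 1 makes the bound positive whatever C is; the claim then reduces to t^(q - p) < c / C1,
   which holds for t small. *)
move=> pq c0 r0; pose C1 := `|C| + 1.
have C10 : 0 < C1 by rewrite ltr_wpDl.
have qp : 0 < q - p by rewrite subr_gt0.
pose u := (c / C1) `^ (q - p)^-1.
have cC : 0 < c / C1 by rewrite divr_gt0.
have u0 : 0 < u by rewrite powR_gt0.
pose t := Num.min (r / 2) (u / 2).
have t0 : 0 < t by rewrite lt_min !divr_gt0.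
have tr : t < r by rewrite gt_min; apply/orP; left; lra.
have tu : t < u by rewrite gt_min; apply/orP; right; lra.
exists t; split=> //.
have tq : t `^ (q - p) < c / C1.
  have := gt0_ltr_powR qp (ltW t0) (ltW u0) tu.
  by rewrite /u -powRrM mulVf ?lt0r_neq0// powRr1// ltW.
have -> : t `^ q = t `^ (q - p) * t `^ p.
  by rewrite -powRD ?subrK// (gt_eqF t0) implybT.
rewrite mulrA ltr_pM2r ?powR_gt0//.
apply: (@le_lt_trans _ _ (C1 * t `^ (q - p))).
  rewrite ler_wpM2r ?powR_ge0// /C1 (le_trans (ler_norm C))// lerDl//.
by rewrite mulrC -ltr_pdivlMr.
Qed.

(** Common to both estimates: raising the order from p to beta weakens the singularity of the Riesz
    potential at the origin, so the inequality fails along a coordinate axis at a small enough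
    distance. *)
Lemma sharp_delta0 (F : 'rV[R]_n -> R) (beta p c C r : R) :
    (forall x, x != 0 -> F x = c * enorm x `^ (p - n%:R)) -> 0 < c ->
    p < beta -> beta < n%:R -> 0 < r ->
  exists x : 'rV[R]_n,
    [/\ 0 < enorm x < r, (riesz_potential beta D x < +oo)%E &
        (C%:E * riesz_potential beta D x < (F x)%:E)%E].
Proof.
move=> FE c0 pb bn r0; have nb : 0 < n%:R - beta by rewrite subr_gt0.
have pq : p - n%:R < beta - n%:R by rewrite ltrD2r.
have [t [t0 tr tC]] := exists_small_powR_lt (C / (n%:R - beta)) pq c0 r0.
pose e : 'rV[R]_n := delta_mx ord0 (Ordinal n2 : 'I_n).
have e1 : enorm e = 1 by rewrite /enorm dotp_delta mxE !eqxx sqrtr1.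
have xt : enorm (t *: e) = t by rewrite enormZ ?(ltW t0)// e1 mulr1.
have x0 : t *: e != 0.
  by apply: contraTneq t0 => x0; rewrite -xt x0 enorm0 ltxx.
exists (t *: e); rewrite riesz_potential_delta0// FE// xt t0 tr.
split=> //; first exact: ltry.
by rewrite -EFinM lte_fin mulrA mulrAC.
Qed.

End sharpness.

(** Since [charge_integral] is total, the claims on potentials come with the integrability that
    gives them meaning. Sharpness takes two forms: the reverse estimates for the Dirac mass, and the
    failure of every larger order below n at arbitrarily small distances. *)
Theorem theorem2p3 (R : realType) (n : nat) (s : R)
    (hn : (2 <= n)%N) (hs1 : 2^-1 < s) (hs2 : s < 1) :
  (exists C : R, 0 < C /\
    forall mu : {charge set 'rV[R]_n -> \bar R},
      compact (msupport (charge_tv mu)) ->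
      [/\ {ae lebesgue_rV R n,
             forall x, charge_integrable mu (fun y => Phi s (x - y))},
          locally_integrable_rV (potential s mu),
          frac_laplace_eq s (potential s mu) mu,
          (forall x, (riesz_potential (2 * s) mu x < +oo)%E ->
             charge_integrable mu (fun y => Phi s (x - y)) /\
             (`|potential s mu x|%:E <= C%:E * riesz_potential (2 * s) mu x)%E) &
          (forall x, (riesz_potential (2 * s - 1) mu x < +oo)%E ->
             (forall i, charge_integrable mu
                (fun y => gradient (Phi s) (x - y) ord0 i)) /\
             ((enorm (grad_potential s mu x))%:E <=
                C%:E * riesz_potential (2 * s - 1) mu x)%E)])
  /\ (exists c : R, 0 < c /\
       forall x : 'rV[R]_n, x != 0 ->
         (c%:E * riesz_potential (2 * s) (delta0 R n) x <=
            `|potential s (delta0 R n) x|%:E)%E /\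
         (c%:E * riesz_potential (2 * s - 1) (delta0 R n) x <=
            (enorm (grad_potential s (delta0 R n) x))%:E)%E)
  /\ (forall beta : R, 2 * s < beta -> beta < n%:R ->
       forall C r : R, 0 < r ->
       exists x : 'rV[R]_n,
         [/\ 0 < enorm x < r,
             (riesz_potential beta (delta0 R n) x < +oo)%E &
             (C%:E * riesz_potential beta (delta0 R n) x <
                `|potential s (delta0 R n) x|%:E)%E])
  /\ (forall beta : R, 2 * s - 1 < beta -> beta < n%:R ->
       forall C r : R, 0 < r ->
       exists x : 'rV[R]_n,
         [/\ 0 < enorm x < r,
             (riesz_potential beta (delta0 R n) x < +oo)%E &
             (C%:E * riesz_potential beta (delta0 R n) x <
                (enorm (grad_potential s (delta0 R n) x))%:E)%E]).
Proof.
have s01 : 0 < s < 1 by rewrite hs2 andbT (lt_trans _ hs1).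
have k0 := kappa_gt0 hn s01.
have a0 : 0 < n%:R - 2 * s by rewrite subr_gt0; exact: n_gt_2s.
have b0 : 0 < n%:R - (2 * s - 1) by lra.
have PE x : `|potential s (delta0 R n) x| = kappa n s * enorm x `^ (2 * s - n%:R).
  by rewrite potential_delta0 ger0_norm// Phi_ge0.
have c0 : 0 < kappa n s * (n%:R - 2 * s) by exact: mulr_gt0.
have d0 : 0 < kappa n s * (n%:R - 2 * s) * (n%:R - (2 * s - 1)) by exact: mulr_gt0.
have riesz_ge0 beta mu x : (0 <= @riesz_potential R n beta mu x)%E.
  by rewrite riesz_potentialE; apply: integral_ge0 => y _; exact: riesz_kernel_ge0.
split; [|split; [|split]].
- pose C1 : R := kappa n s * (n%:R - 2 * s).
  pose C2 : R := n%:R * (C1 * (n%:R - (2 * s - 1))).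
  exists (Num.max C1 C2); split; first by rewrite lt_max c0.
  move=> mu _; split.
  + exact: ae_charge_integrable_Phi.
  + exact: potential_locally_integrable.
  + exact: potential_frac_laplace_eq.
  + move=> x /(potential_le_riesz hn s01)[fi H]; split=> //.
    apply: le_trans H _; apply: lee_wpmul2r; first exact: riesz_ge0.
    by rewrite lee_fin le_max lexx.
  + move=> x /(grad_potential_le_riesz hn s01)[fi H]; split=> //.
    apply: le_trans H _; apply: lee_wpmul2r; first exact: riesz_ge0.
    by rewrite lee_fin le_max lexx orbT.
(* Each of the two constants turns its own estimate into an equality for the Dirac mass; the minimum
   serves both. *)
- exists (Num.min (kappa n s * (n%:R - 2 * s))
    (kappa n s * (n%:R - 2 * s) * (n%:R - (2 * s - 1)))).
  split=> [|x x0]; first by rewrite lt_min c0 d0.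
  have ex := enorm_gt0 x0.
  split; (rewrite riesz_potential_delta0//; last by lra).
    rewrite PE -EFinM lee_fin.
    apply: (@le_trans _ _ (kappa n s * (n%:R - 2 * s) *
        (enorm x `^ (2 * s - n%:R) / (n%:R - 2 * s)))).
      by rewrite ler_wpM2r ?ge_min ?lexx// divr_ge0 ?powR_ge0 ?(ltW a0).
    by rewrite mulrACA mulfV ?lt0r_neq0// mulr1.
  rewrite enorm_grad_potential_delta0// -EFinM lee_fin.
  apply: (@le_trans _ _ (kappa n s * (n%:R - 2 * s) * (n%:R - (2 * s - 1)) *
      (enorm x `^ (2 * s - 1 - n%:R) / (n%:R - (2 * s - 1))))).
    by rewrite ler_wpM2r ?ge_min ?lexx ?orbT// divr_ge0 ?powR_ge0 ?(ltW b0).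
  by rewrite mulrACA mulfV ?lt0r_neq0// mulr1.
- move=> beta hb bn C r r0.
  by apply: (sharp_delta0 hn C _ k0 hb bn r0) => x _; exact: PE.
- move=> beta hb bn C r r0.
  by apply: (sharp_delta0 hn C _ c0 hb bn r0) => x; exact: enorm_grad_potential_delta0.
Qed.
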